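(* Let $\mathbb{K}$ be a field of characteristic zero, $R$ a polynomial ring over $\mathbb{K}$, and $A$ a finitely generated $\mathbb{K}$-subalgebra of $R$ such that $A$ is a direct summand of $R$ (as an $A$-module). Given $\underline f=f_1,\dots,f_\ell\in A$ and $g\in A$, there exists a nonzero polynomial $b(s)\in\mathbb{Q}[s]$ such that $$b(s_1+\cdots+s_\ell)\,g\,f_1^{s_1}\cdots f_\ell^{s_\ell}$$ is in the $D_{A|\mathbb{K}}[\underline s]$-submodule of $M^A[\underline f^{\underline s}]$ generated by all $$\prod_{i\in\operatorname{nsupp}(c)}\binom{s_i}{-c_i}\,f_1^{c_1}\cdots f_\ell^{c_\ell}\,g\,f_1^{s_1}\cdots f_\ell^{s_\ell},$$ where $c=(c_1,\dots,c_\ell)$ runs over the elements of $\mathbb{Z}^\ell$ such that $|c|=c_1+\cdots+c_\ell=1$, and $\operatorname{nsupp}(c)=\{i:c_i<0\}$.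
   Context: $D_{A|\mathbb{K}}$ is Grothendieck's ring of $\mathbb{K}$-linear differential operators on $A$; modules are left modules with action $\bullet$. $\underline s=s_1,\dots,s_\ell$ are indeterminates and $\binom{s_i}{m}=s_i(s_i-1)\cdots(s_i-m+1)/m!$. $M^A[\underline f^{\underline s}]=A_{f_1\cdots f_\ell}[\underline s]\,f_1^{s_1}\cdots f_\ell^{s_\ell}$ is the free rank-one $A_{f_1\cdots f_\ell}[\underline s]$-module on the formal symbol $f_1^{s_1}\cdots f_\ell^{s_\ell}$, with the unique $D_{A|\mathbb{K}}[\underline s]$-module structure such that $\varphi_t(\delta\bullet v)=\delta(t)\bullet\varphi_t(v)$ for all $v$, $\delta\in D_{A|\mathbb{K}}[\underline s]$, $t\in\mathbb{Z}^\ell$, where $\varphi_t(h(\underline s)f_1^{s_1}\cdots f_\ell^{s_\ell})=h(t)f_1^{t_1}\cdots f_\ell^{t_\ell}\in A_{f_1\cdots f_\ell}$, $\delta(t)$ is $\delta$ with $\underline s$ replaced by $t$, and $A_{f_1\cdots f_\ell}$ has its usual $D_{A|\mathbb{K}}$-module structure (unique extension of operators to the localization). *)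

(* Defs.v *)
From HB Require Import structures.
From mathcomp Require Import all_boot all_order all_algebra.
From mathcomp Require Import generic_quotient boolp zify ring.
From mathcomp.multinomials Require Import mpoly.

Set Implicit Arguments.
Unset Strict Implicit.
Unset Printing Implicit Defensive.

Import GRing.Theory.
Local Open Scope ring_scope.
Local Open Scope quotient_scope.

Section Subalgebra.
Variables (K : fieldType) (R : comAlgType K) (A : subalgClosed R).

Record subalg := Subalg { subalg_val :> R; _ : subalg_val \in A }.

HB.instance Definition _ := [isSub for subalg_val].
HB.instance Definition _ := [Choice of subalg by <:].
HB.instance Definition _ := [SubChoice_isSubAlgebra of subalg by <:].
HB.instance Definition _ := [SubNzRing_isSubComNzRing of subalg by <:].

End Subalgebra.

(* The localization of A at the powers of f, f = 0 (hence the zero ring) being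
   allowed; lfrac a k stands for a / f^k. *)
Section Localization.
Variables (A : comNzRingType) (f : A).

Definition loc_equiv (x y : A * nat) : bool :=
  `[< exists j, f ^+ j * (x.1 * f ^+ y.2 - y.1 * f ^+ x.2) = 0 >].

Lemma loc_equiv_refl : reflexive loc_equiv.
Proof. by move=> x; apply/asboolP; exists 0%N; rewrite subrr mulr0. Qed.

Lemma loc_equiv_sym : ssrbool.symmetric loc_equiv.
Proof.
by move=> x y; apply/asboolP/asboolP => -[j e]; exists j;
  rewrite -opprB mulrN e oppr0.
Qed.

Lemma loc_equiv_trans : transitive loc_equiv.
Proof.
move=> y x z /asboolP[j e1] /asboolP[k e2]; apply/asboolP; exists (j + k + y.2)%N.
rewrite !exprD.
have -> : f ^+ j * f ^+ k * f ^+ y.2 * (x.1 * f ^+ z.2 - z.1 * f ^+ x.2) =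
  f ^+ k * f ^+ z.2 * (f ^+ j * (x.1 * f ^+ y.2 - y.1 * f ^+ x.2)) +
  f ^+ j * f ^+ x.2 * (f ^+ k * (y.1 * f ^+ z.2 - z.1 * f ^+ y.2)) by ring.
by rewrite e1 e2 !mulr0 addr0.
Qed.

Canonical loc_equivRel :=
  EquivRel loc_equiv loc_equiv_refl loc_equiv_sym loc_equiv_trans.

Definition loc := {eq_quot loc_equiv}.

HB.instance Definition _ : EqQuotient _ loc_equiv loc := EqQuotient.on loc.
HB.instance Definition _ := Choice.on loc.

Definition lfrac (a : A) (k : nat) : loc := \pi_loc (a, k).

Lemma lfracP (a b : A) k m : lfrac a k = lfrac b m <->
  exists j, f ^+ j * (a * f ^+ m - b * f ^+ k) = 0.
Proof.
by split=> [/eqmodP/asboolP//|h]; apply/eqmodP/asboolP.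
Qed.

Lemma locP (x : loc) : exists a k, x = lfrac a k.
Proof. by exists (repr x).1, (repr x).2; rewrite /lfrac -surjective_pairing reprK. Qed.

Definition loc_add (x y : loc) : loc :=
  lfrac ((repr x).1 * f ^+ (repr y).2 + (repr y).1 * f ^+ (repr x).2)
       ((repr x).2 + (repr y).2).
Definition loc_opp (x : loc) : loc := lfrac (- (repr x).1) (repr x).2.
Definition loc_mul (x y : loc) : loc :=
  lfrac ((repr x).1 * (repr y).1) ((repr x).2 + (repr y).2).

Lemma repr_frac a k : exists j,
  f ^+ j * ((repr (lfrac a k)).1 * f ^+ k - a * f ^+ (repr (lfrac a k)).2) = 0.
Proof. by apply/lfracP; rewrite /lfrac -surjective_pairing reprK. Qed.

Lemma loc_addE a b k m :
  loc_add (lfrac a k) (lfrac b m) = lfrac (a * f ^+ m + b * f ^+ k) (k + m).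
Proof.
apply/lfracP; have [i e1] := repr_frac a k; have [j e2] := repr_frac b m.
move: e1 e2; case: (repr _) => a' k'; case: (repr _) => b' m' /= e1 e2.
exists (i + j)%N; rewrite !exprD.
transitivity (f ^+ j * f ^+ m' * f ^+ m * (f ^+ i * (a' * f ^+ k - a * f ^+ k')) +
  f ^+ i * f ^+ k' * f ^+ k * (f ^+ j * (b' * f ^+ m - b * f ^+ m'))); first by ring.
by rewrite e1 e2 !mulr0 addr0.
Qed.

Lemma loc_oppE a k : loc_opp (lfrac a k) = lfrac (- a) k.
Proof.
apply/lfracP; have [i e1] := repr_frac a k.
move: e1; case: (repr _) => a' k' /= e1; exists i.
by rewrite !mulNr -opprD mulrN e1 oppr0.
Qed.

Lemma loc_mulE a b k m :
  loc_mul (lfrac a k) (lfrac b m) = lfrac (a * b) (k + m).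
Proof.
apply/lfracP; have [i e1] := repr_frac a k; have [j e2] := repr_frac b m.
move: e1 e2; case: (repr _) => a' k'; case: (repr _) => b' m' /= e1 e2.
exists (i + j)%N; rewrite !exprD.
transitivity (f ^+ j * b' * f ^+ m * (f ^+ i * (a' * f ^+ k - a * f ^+ k')) +
  f ^+ i * a * f ^+ k' * (f ^+ j * (b' * f ^+ m - b * f ^+ m'))); first by ring.
by rewrite e1 e2 !mulr0 addr0.
Qed.

Lemma frac_eq a b k m : a * f ^+ m = b * f ^+ k -> lfrac a k = lfrac b m.
Proof. by move=> e; apply/lfracP; exists 0%N; rewrite e subrr mulr0. Qed.

Fact loc_addA : associative loc_add.
Proof.
move=> x y z; have [a [k ->]] := locP x; have [b [m ->]] := locP y.
have [c [n ->]] := locP z; rewrite !loc_addE; apply: frac_eq; rewrite !exprD; ring.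
Qed.
Fact loc_addC : commutative loc_add.
Proof.
move=> x y; have [a [k ->]] := locP x; have [b [m ->]] := locP y.
rewrite !loc_addE; apply: frac_eq; rewrite !exprD; ring.
Qed.
Fact loc_add0 : left_id (lfrac 0 0) loc_add.
Proof.
move=> x; have [a [k ->]] := locP x.
rewrite !loc_addE; apply: frac_eq; rewrite ?exprD ?expr0; ring.
Qed.
Fact loc_addN : left_inverse (lfrac 0 0) loc_opp loc_add.
Proof.
move=> x; have [a [k ->]] := locP x.
rewrite loc_oppE !loc_addE; apply: frac_eq; rewrite ?exprD ?expr0; ring.
Qed.
HB.instance Definition _ :=
  GRing.isZmodule.Build loc loc_addA loc_addC loc_add0 loc_addN.

Fact loc_mulA : associative loc_mul.
Proof.
move=> x y z; have [a [k ->]] := locP x; have [b [m ->]] := locP y.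
have [c [n ->]] := locP z; rewrite !loc_mulE; apply: frac_eq; rewrite !exprD; ring.
Qed.
Fact loc_mulC : commutative loc_mul.
Proof.
move=> x y; have [a [k ->]] := locP x; have [b [m ->]] := locP y.
rewrite !loc_mulE; apply: frac_eq; rewrite !exprD; ring.
Qed.
Fact loc_mul1 : left_id (lfrac 1 0) loc_mul.
Proof.
move=> x; have [a [k ->]] := locP x.
by rewrite !loc_mulE; apply: frac_eq; rewrite mul1r.
Qed.
Fact loc_mulD : left_distributive loc_mul +%R.
Proof.
move=> x y z; have [a [k ->]] := locP x; have [b [m ->]] := locP y.
have [c [n ->]] := locP z; rewrite /GRing.add /= ?(loc_mulE,loc_addE).
apply: frac_eq; rewrite !exprD; ring.
Qed.
HB.instance Definition _ :=
  GRing.Zmodule_isComPzRing.Build loc loc_mulA loc_mulC loc_mul1 loc_mulD.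

Lemma lfracD a b k m : lfrac a k + lfrac b m = lfrac (a * f ^+ m + b * f ^+ k) (k + m).
Proof. exact: loc_addE. Qed.
Lemma lfracN a k : - lfrac a k = lfrac (- a) k.
Proof. exact: loc_oppE. Qed.
Lemma lfracM a b k m : lfrac a k * lfrac b m = lfrac (a * b) (k + m).
Proof. exact: loc_mulE. Qed.

Definition toloc (a : A) : loc := lfrac a 0.

Fact toloc_zmod_morphism : zmod_morphism toloc.
Proof. by move=> a b; rewrite /toloc lfracN lfracD; apply: frac_eq; rewrite !expr0; ring. Qed.
Fact toloc_monoid_morphism : monoid_morphism toloc.
Proof. by split=> // a b; rewrite /toloc lfracM. Qed.
HB.instance Definition _ := GRing.isZmodMorphism.Build A loc toloc toloc_zmod_morphism.
HB.instance Definition _ := GRing.isMonoidMorphism.Build A loc toloc toloc_monoid_morphism.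

End Localization.

Section Order.
Variable B : comPzRingType.
Implicit Types (F G : B -> B).

Definition comm_op F (a : B) : B -> B := fun x => F (a * x) - a * F x.

(* Grothendieck's filtration: order_lt n F says that F has order < n, i.e. all
   n-fold commutators of F with multiplication operators vanish. *)
Fixpoint order_lt (n : nat) F : Prop :=
  if n is n'.+1 then forall a, order_lt n' (comm_op F a) else forall x, F x = 0.

Lemma order_lt_eq n F G : F =1 G -> order_lt n F -> order_lt n G.
Proof. by move=> /funext ->. Qed.

Lemma order_lt_zero n : order_lt n (fun=> 0).
Proof.
elim: n => [//|n IHn a] /=; apply: order_lt_eq IHn => x.
by rewrite /comm_op mulr0 subrr.
Qed.

Lemma order_lt_add n F G : order_lt n F -> order_lt n G ->
  order_lt n (fun x => F x + G x).
Proof.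
elim: n F G => [F G hF hG x|n IHn F G hF hG a] /=; first by rewrite hF hG addr0.
apply: order_lt_eq (IHn _ _ (hF a) (hG a)) => x; rewrite /comm_op; ring.
Qed.

Lemma order_lt_mul n F (b c : B) : order_lt n F ->
  order_lt n (fun x => b * F (c * x)).
Proof.
elim: n F => [F hF x|n IHn F hF a] /=; first by rewrite hF mulr0.
apply: order_lt_eq (IHn _ (hF a)) => x.
rewrite /comm_op mulrBr; congr (b * F _ - _); ring.
Qed.

Lemma order_lt_opp n F : order_lt n F -> order_lt n (fun x => - F x).
Proof.
move=> /(order_lt_mul (-1) 1); apply: order_lt_eq => x.
by rewrite mul1r mulN1r.
Qed.

Lemma order_lt_le m n F : (m <= n)%N -> order_lt m F -> order_lt n F.
Proof.
elim: m n F => [n F _ hF|m IHm [//|n] F lemn hF a].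
  by apply: order_lt_eq (order_lt_zero n) => x; rewrite hF.
exact: (IHm _ _ lemn (hF a)).
Qed.

Lemma order_lt_comp m n F G : zmod_morphism F ->
  order_lt m F -> order_lt n G -> order_lt (m + n) (F \o G).
Proof.
have [k] := ubnP (m + n); elim: k m n F G => // k IHk m n F G lek addF hF hG.
have F0 : F 0 = 0 by have := addF 0 0; rewrite !subrr.
case: m => [|m] in lek hF *.
  by apply: order_lt_eq (order_lt_zero _) => x; rewrite /= hF.
case: n => [|n] in lek hG *.
  by apply: order_lt_eq (order_lt_zero _) => x; rewrite /= hG F0.
rewrite addSn /= => a.
have addC : zmod_morphism (comm_op F a).
  by move=> x y; rewrite /comm_op mulrBr !addF; ring.
have h1 : order_lt (m + n.+1) (F \o comm_op G a).
  by rewrite addnS -addSn; apply: IHk => //; lia.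
have h2 : order_lt (m + n.+1) (comm_op F a \o G).
  by apply: IHk => //; lia.
apply: order_lt_eq (order_lt_add h1 h2) => x.
rewrite /comm_op /= addF; ring.
Qed.

End Order.

Section Diffop.
Variables (K : fieldType) (A : comAlgType K).

Definition is_diffop (D : A -> A) : Prop := linear D /\ exists n, order_lt n D.

(* the elements of D_{A|K} *)
Record diffop := Diffop { diffop_fun :> A -> A; _ : `[< is_diffop diffop_fun >] }.
HB.instance Definition _ := [isSub for diffop_fun].
HB.instance Definition _ := [Choice of diffop by <:].

Implicit Types D E : diffop.

Lemma diffopP D E : D =1 E -> D = E.
Proof. by move=> e; apply/val_inj/funext. Qed.

Lemma diffop_order D : exists n, order_lt n D.
Proof. by case: D => D /= /asboolP[]. Qed.

Lemma diffop_linear D : linear D.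
Proof. by case: D => D /= /asboolP[]. Qed.

HB.instance Definition _ D := GRing.isLinear.Build K A A _ D (diffop_linear D).

Fact diffop_zero_subproof : `[< is_diffop (fun=> 0) >].
Proof.
apply/asboolP; split=> [c x y|]; first by rewrite scaler0 addr0.
by exists 0%N.
Qed.

Fact diffop_add_subproof D E : `[< is_diffop (fun x => D x + E x) >].
Proof.
have [m hD] := diffop_order D; have [n hE] := diffop_order E.
apply/asboolP; split=> [c x y|].
  by rewrite !linearP scalerDr addrACA.
by exists (maxn m n); apply: order_lt_add;
  [apply: order_lt_le hD | apply: order_lt_le hE]; rewrite ?leq_maxl ?leq_maxr.
Qed.

Fact diffop_opp_subproof D : `[< is_diffop (fun x => - D x) >].
Proof.
have [m hD] := diffop_order D.
apply/asboolP; split=> [c x y|]; first by rewrite linearP opprD scalerN.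
by exists m; apply: order_lt_opp.
Qed.

Fact diffop_comp_subproof D E : `[< is_diffop (D \o E) >].
Proof.
have [m hD] := diffop_order D; have [n hE] := diffop_order E.
apply/asboolP; split=> [c x y|]; first by rewrite /= !linearP.
by exists (m + n)%N; apply: order_lt_comp => //; apply: raddfB.
Qed.

Fact diffop_mul_subproof (a : A) : `[< is_diffop ( *%R a) >].
Proof.
apply/asboolP; split=> [c x y|]; first by rewrite mulrDr scalerAr.
by exists 1%N => b x; rewrite /comm_op; ring.
Qed.

Definition diffop_zero := Diffop diffop_zero_subproof.
Definition diffop_add D E := Diffop (diffop_add_subproof D E).
Definition diffop_opp D := Diffop (diffop_opp_subproof D).
Definition diffop_comp D E := Diffop (diffop_comp_subproof D E).
Definition mulop a := Diffop (diffop_mul_subproof a).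

Fact diffop_addA : associative diffop_add.
Proof. by move=> D E F; apply: diffopP => x /=; rewrite addrA. Qed.
Fact diffop_addC : commutative diffop_add.
Proof. by move=> D E; apply: diffopP => x /=; rewrite addrC. Qed.
Fact diffop_add0 : left_id diffop_zero diffop_add.
Proof. by move=> D; apply: diffopP => x /=; rewrite add0r. Qed.
Fact diffop_addN : left_inverse diffop_zero diffop_opp diffop_add.
Proof. by move=> D; apply: diffopP => x /=; rewrite addNr. Qed.
HB.instance Definition _ :=
  GRing.isZmodule.Build diffop diffop_addA diffop_addC diffop_add0 diffop_addN.

Fact diffop_compA : associative diffop_comp.
Proof. by move=> D E F; apply: diffopP. Qed.
Fact diffop_comp1l : left_id (mulop 1) diffop_comp.
Proof. by move=> D; apply: diffopP => x /=; rewrite mul1r. Qed.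
Fact diffop_comp1r : right_id (mulop 1) diffop_comp.
Proof. by move=> D; apply: diffopP => x /=; rewrite mul1r. Qed.
Fact diffop_compDl : left_distributive diffop_comp +%R.
Proof. by move=> D E F; apply: diffopP. Qed.
Fact diffop_compDr : right_distributive diffop_comp +%R.
Proof. by move=> D E F; apply: diffopP => x /=; rewrite raddfD. Qed.
Fact diffop_one_neq0 : mulop 1 != 0.
Proof.
apply/eqP => /(congr1 (fun D : diffop => D 1)) /=.
by rewrite mulr1; apply/eqP/oner_neq0.
Qed.
HB.instance Definition _ := GRing.Zmodule_isNzRing.Build diffop
  diffop_compA diffop_comp1l diffop_comp1r diffop_compDl diffop_compDr
  diffop_one_neq0.

Lemma diffopDE D E x : (D + E) x = D x + E x. Proof. by []. Qed.
Lemma diffopNE D x : (- D) x = - D x. Proof. by []. Qed.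
Lemma diffop0E x : (0 : diffop) x = 0. Proof. by []. Qed.
Lemma diffopME D E x : (D * E) x = D (E x). Proof. by []. Qed.
Lemma diffop1E x : (1 : diffop) x = x. Proof. exact: mul1r. Qed.

Definition ad (a : A) D : diffop := D * mulop a - mulop a * D.

Lemma adE a D : ad a D =1 comm_op D a.
Proof. by []. Qed.

End Diffop.

Section Extension.
Variables (K : fieldType) (A : comAlgType K) (f : A).
Local Notation L := (loc f).
Implicit Types (D E : diffop A) (F G : L -> L).

Definition locinv : L := lfrac f 1 1.

Lemma locinvK : toloc f f * locinv = 1.
Proof. by rewrite lfracM; apply: frac_eq; rewrite expr0 !mulr1 mul1r. Qed.

Lemma frac_locinv a m : lfrac f a m = toloc f a * locinv ^+ m.
Proof.
elim: m => [|m IHm]; first by rewrite mulr1.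
by rewrite exprSr mulrA -IHm lfracM mulr1 addn1.
Qed.

Lemma fracSK a m : toloc f f * lfrac f a m.+1 = lfrac f a m.
Proof.
by rewrite lfracM; apply: frac_eq; rewrite add0n exprS mulrCA mulrA.
Qed.

(* D(a/f^(m+1)) = (D(a/f^m) - [D,f](a/f^(m+1)))/f, by induction on the order. *)
Fixpoint ext_rec (n : nat) : diffop A -> A -> nat -> L :=
  if n is n'.+1 then
    fix aux D a m :=
      if m is m'.+1 then locinv * (aux D a m' - ext_rec n' (ad f D) a m)
      else toloc f (D a)
  else fun _ _ _ => 0.

Lemma ext_recS n D a m : ext_rec n.+1 D a m.+1 =
  locinv * (ext_rec n.+1 D a m - ext_rec n (ad f D) a m.+1).
Proof. by []. Qed.

Lemma ext_rec0 n D a : order_lt n D -> ext_rec n D a 0 = toloc f (D a).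
Proof. by case: n => //= ->; rewrite raddf0. Qed.

Lemma ad_order n (a : A) D : order_lt n.+1 D -> order_lt n (ad a D).
Proof. by move=> /(_ a). Qed.

Lemma ext_rec_shift n D a m : order_lt n D ->
  ext_rec n D (f * a) m.+1 = ext_rec n D a m.
Proof.
elim: n D a m => // n IHn D a m hD.
have hDf := @ad_order n f D hD.
elim: m => [|m IHm]; last first.
  by rewrite ext_recS IHm (IHn _ _ _ hDf) -ext_recS.
rewrite ext_recS IHn // [ext_rec n _ _ _]ext_rec0 // ext_rec0 // -raddfB adE /comm_op.
by rewrite /= opprB addrC subrK rmorphM mulrA [locinv * _]mulrC locinvK mul1r.
Qed.

Lemma ext_rec_shiftn n D a m j : order_lt n D ->
  ext_rec n D (f ^+ j * a) (m + j) = ext_rec n D a m.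
Proof.
move=> hD; elim: j => [|j IHj]; first by rewrite mul1r addn0.
by rewrite exprS -mulrA addnS ext_rec_shift.
Qed.

Lemma ext_recB n D a b m : order_lt n D ->
  ext_rec n D (a - b) m = ext_rec n D a m - ext_rec n D b m.
Proof.
elim: n D m => [|n IHn] D m hD; first by rewrite subr0.
elim: m => [|m IHm]; first by rewrite /= !raddfB.
by rewrite !ext_recS IHm IHn; [ring | exact: ad_order].
Qed.

Lemma ext_rec_wd n D a b k m : order_lt n D ->
  lfrac f a k = lfrac f b m -> ext_rec n D a k = ext_rec n D b m.
Proof.
move=> hD /lfracP[j e].
rewrite -(ext_rec_shiftn a k (j + m) hD) -(ext_rec_shiftn b m (j + k) hD).
congr ext_rec; last by lia.
by apply/eqP; rewrite -subr_eq0 -e !exprD; apply/eqP; ring.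
Qed.

Lemma ext_rec_comm n D b a m : order_lt n.+1 D ->
  ext_rec n.+1 D (b * a) m - toloc f b * ext_rec n.+1 D a m =
  ext_rec n (ad b D) a m.
Proof.
elim: n D b a m => [|n IHn] D b a m hD.
  elim: m => [|m IHm]; last first.
    rewrite !ext_recS /= !subr0 mulrCA -mulrBr.
    by move: IHm => /= ->; rewrite mulr0.
  by rewrite /= -rmorphM -raddfB; have /= := hD b a; rewrite /comm_op => ->; rewrite raddf0.
elim: m => [|m IHm]; first by rewrite /= -rmorphM -raddfB.
rewrite !ext_recS -IHm.
have -> : ad f (ad b D) = ad b (ad f D).
  by apply: diffopP => x; rewrite !adE /comm_op !adE /comm_op mulrCA; ring.
rewrite -(IHn (ad f D) b a m.+1); last exact: ad_order.
rewrite !ext_recS; ring.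
Qed.

Definition ext_fun n D (x : L) : L := ext_rec n D (repr x).1 (repr x).2.

Lemma ext_funE n D a m : order_lt n D -> ext_fun n D (lfrac f a m) = ext_rec n D a m.
Proof.
by move=> hD; apply: ext_rec_wd => //; rewrite /lfrac -surjective_pairing reprK.
Qed.

Lemma frac_common (x y : L) : exists a b m, x = lfrac f a m /\ y = lfrac f b m.
Proof.
have [a [k ->]] := locP x; have [b [m ->]] := locP y.
exists (a * f ^+ m), (b * f ^+ k), (k + m)%N.
by split; apply: frac_eq; rewrite exprD; ring.
Qed.

Lemma lfracB a b m : lfrac f a m - lfrac f b m = lfrac f (a - b) m.
Proof. by rewrite !frac_locinv raddfB mulrBl. Qed.

Lemma ext_funB n D : order_lt n D -> zmod_morphism (ext_fun n D).
Proof.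
move=> hD x y; have [a [b [m [-> ->]]]] := frac_common x y.
by rewrite lfracB !ext_funE // ext_recB.
Qed.

Lemma toloc_frac b a m : toloc f b * lfrac f a m = lfrac f (b * a) m.
Proof. by rewrite !frac_locinv rmorphM mulrA. Qed.

Lemma ext_fun_comm n D b x : order_lt n.+1 D ->
  ext_fun n.+1 D (toloc f b * x) - toloc f b * ext_fun n.+1 D x =
  ext_fun n (ad b D) x.
Proof.
move=> hD; have [a [m ->]] := locP x.
by rewrite toloc_frac !ext_funE ?ext_rec_comm //; apply: ad_order.
Qed.

Lemma ext_fun_order n D : order_lt n D -> order_lt n (ext_fun n D).
Proof.
elim: n D => [|n IHn] D hD //= x.
have [a [k ->]] := locP x.
have h1 := order_lt_mul 1 (locinv ^+ k) (IHn _ (ad_order a hD)).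
have h2 := order_lt_mul (- lfrac f a k) (locinv ^+ k) (IHn _ (ad_order (f ^+ k) hD)).
apply: order_lt_eq (order_lt_add h1 h2) => y.
rewrite -!ext_fun_comm // /comm_op [toloc f a * (_ * y)]mulrA -frac_locinv.
have e : toloc f (f ^+ k) * locinv ^+ k = 1.
  by rewrite rmorphXn -exprMn locinvK expr1n.
rewrite [toloc f (f ^+ k) * (_ * y)]mulrA e [1 * y]mul1r.
transitivity (ext_fun n.+1 D (lfrac f a k * y) -
  toloc f a * ext_fun n.+1 D (locinv ^+ k * y) - lfrac f a k * ext_fun n.+1 D y +
  lfrac f a k * toloc f (f ^+ k) * ext_fun n.+1 D (locinv ^+ k * y)); first by ring.
by rewrite frac_locinv -[toloc f a * _ * toloc f _]mulrA
  [locinv ^+ k * toloc f _]mulrC e mulr1; ring.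
Qed.

Lemma ext_unique n F G : order_lt n F -> order_lt n G ->
  (forall a, F (toloc f a) = G (toloc f a)) -> F =1 G.
Proof.
elim: n F G => [F G hF hG _ x|n IHn F G hF hG e x]; first by rewrite hF hG.
have eC y : comm_op F (toloc f f) y = comm_op G (toloc f f) y.
  apply: IHn y => // a; rewrite /comm_op -!rmorphM /= !e //.
have [a [m ->]] := locP x; elim: m => [|m IHm]; first exact: e.
have := eC (lfrac f a m.+1); rewrite /comm_op fracSK IHm => /addrI/oppr_inj.
by move=> /(congr1 ( *%R locinv)); rewrite !mulrA [locinv * _]mulrC locinvK !mul1r.
Qed.

Lemma ext_exists D : exists F, [/\ zmod_morphism F, exists n, order_lt n F &
  forall a, F (toloc f a) = toloc f (D a)].
Proof.
have [n hD] := diffop_order D; exists (ext_fun n D); split.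
- exact: ext_funB.
- by exists n; apply: ext_fun_order.
- by move=> a; rewrite ext_funE // ext_rec0.
Qed.

(* the extension of D to a differential operator of the localization; it is unique
   by ext_unique, and it is automatically K-linear *)
Definition loc_ext D : L -> L := sval (cid (ext_exists D)).

Lemma loc_extB D : zmod_morphism (loc_ext D).
Proof. by rewrite /loc_ext; case: cid => F []. Qed.

Lemma loc_ext_order D : exists n, order_lt n (loc_ext D).
Proof. by rewrite /loc_ext; case: cid => F []. Qed.

Lemma loc_ext_toloc D a : loc_ext D (toloc f a) = toloc f (D a).
Proof. by rewrite /loc_ext; case: cid => F []. Qed.

Lemma loc_ext_unique D F : (exists n, order_lt n F) ->
  (forall a, F (toloc f a) = toloc f (D a)) -> F =1 loc_ext D.
Proof.
move=> [m hF] e; have [n hn] := loc_ext_order D.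
apply: (@ext_unique (maxn m n)).
- by apply: order_lt_le hF; rewrite leq_maxl.
- by apply: order_lt_le hn; rewrite leq_maxr.
- by move=> a; rewrite e loc_ext_toloc.
Qed.

Fact loc_extA D E x : loc_ext D (loc_ext E x) = loc_ext (D * E) x.
Proof.
apply: (@loc_ext_unique _ (loc_ext D \o loc_ext E)) => [|a].
  have [m hm] := loc_ext_order D; have [n hn] := loc_ext_order E.
  by exists (m + n)%N; apply: order_lt_comp hm hn; apply: loc_extB.
by rewrite /= !loc_ext_toloc.
Qed.

Lemma loc_ext_mulop a x : loc_ext (mulop a) x = toloc f a * x.
Proof.
apply/esym; apply: (@loc_ext_unique _ ( *%R (toloc f a))) => [|b].
  by exists 1%N => b y; rewrite /comm_op; ring.
by rewrite /= rmorphM.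
Qed.

Fact loc_ext1 : left_id 1 loc_ext.
Proof. by move=> x; rewrite loc_ext_mulop rmorph1 mul1r. Qed.

Fact loc_extDr : right_distributive loc_ext +%R.
Proof.
move=> D x y; have e0 : loc_ext D 0 = 0 by have := loc_extB D 0 0; rewrite !subrr.
have eN z : loc_ext D (- z) = - loc_ext D z by rewrite -[- z]sub0r loc_extB e0 sub0r.
by rewrite -{1}[y]opprK loc_extB eN opprK.
Qed.

Fact loc_extDl x : {morph loc_ext^~ x : D E / D + E}.
Proof.
move=> D E; apply/esym.
apply: (@loc_ext_unique _ (fun x => loc_ext D x + loc_ext E x)) => [|a].
  have [m hm] := loc_ext_order D; have [n hn] := loc_ext_order E.
  exists (maxn m n); apply: order_lt_add;
  [apply: order_lt_le hm | apply: order_lt_le hn]; rewrite ?leq_maxl ?leq_maxr //.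
by rewrite /= !loc_ext_toloc -raddfD.
Qed.

(* the D_{A|K}-module structure of the localization *)
HB.instance Definition _ := GRing.Zmodule_isLmodule.Build (diffop A) L
  loc_extA loc_ext1 loc_extDr loc_extDl.

Lemma scale_toloc D a : D *: toloc f a = toloc f (D a).
Proof. exact: loc_ext_toloc. Qed.

Lemma scale_mulop a (x : L) : mulop a *: x = toloc f a * x.
Proof. exact: loc_ext_mulop. Qed.

End Extension.

Section Vanish.
Variables (R : idomainType) (R0 : forall k, k.+1%:R != 0 :> R).

Lemma horner_muni l (p : {mpoly R[l.+1]}) (t : 'I_l -> R) (x : R) :
  ((muni p).[x%:MP]).@[t] = p.@[fun i => oapp t x (unlift ord_max i)].
Proof.
rewrite muniE horner_sum raddf_sum /= mevalE; apply: eq_bigr => m _.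
rewrite !hornerZ hornerXn -mul_mpolyC !mevalM mevalC mevalX -!mulrA.
congr (_ * _); rewrite big_ord_recr /= unlift_none /=; congr (_ * _); last first.
  by rewrite rmorphXn /= mevalC.
apply: eq_bigr => i _; rewrite mnmE; congr (_ ^+ m _).
have -> : widen_ord (leqnSn l) i = lift ord_max i.
  by apply/val_inj; rewrite /= /bump leqNgt ltn_ord.
by rewrite liftK.
Qed.

Lemma muni_inj0 l (p : {mpoly R[l.+1]}) : muni p = 0 -> p = 0.
Proof.
move=> p0; apply/mpolyP => m; rewrite mcoeff0.
pose w m : 'X_{1..l} := [multinom m (widen_ord (leqnSn l) i) | i < l].
have := congr1 (fun q : {poly {mpoly R[l]}} => (q`_(m ord_max))@_(w m)) p0.
rewrite coef0 mcoeff0 muniE coef_sum raddf_sum /= => e.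
rewrite [p]mpolyE raddf_sum /= -[RHS]e; apply: eq_bigr => m' _.
rewrite mcoeffZ mcoeffX !coefZ coefXn mulr_natr mcoeffMn mcoeffZ mcoeffX.
have -> : (m' == m) = (w m' == w m) && (m ord_max == m' ord_max).
  apply/eqP/andP => [->//|[/eqP e1 /eqP e2]]; apply/mnmP => i.
  case: (unliftP ord_max i) => [j|] ->; last by rewrite e2.
  have -> : lift ord_max j = widen_ord (leqnSn l) j.
    by apply/val_inj; rewrite /= /bump leqNgt ltn_ord.
  by have := congr1 (fun v : 'X_{1..l} => v j) e1; rewrite !mnmE.
by case: (_ == w m); case: (_ == _); rewrite ?mulr0 ?mulr1 ?mulr0n ?mulr1n.
Qed.

Lemma mpoly_vanish l (p : {mpoly R[l]}) :
  (forall t : 'I_l -> int, p.@[fun i => (t i)%:~R] = 0) -> p = 0.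
Proof.
elim: l p => [|l IHl] p p0.
  by have := p0 (fun=> 0); rewrite [p]nvar0_mpolyC mevalC => ->.
apply: muni_inj0; apply/eqP/negPn/negP => nz.
have inj : injective (fun k : nat => (k%:R)%:MP : {mpoly R[l]}).
  move=> i j /(congr1 (mcoeff 0%MM)); rewrite !mcoeffC eqxx !mulr1; wlog le : i j / (i <= j)%N => [hw|].
    by case: (leqP i j) => [|/ltnW] le e; [|apply/esym]; apply: hw.
  move=> /eqP; rewrite eq_sym -subr_eq0 -natrB //.
  case e: (j - i)%N => [|d]; last by rewrite (negPf (R0 d)).
  by move=> _; lia.
pose rs : seq {mpoly R[l]} := [seq (k%:R)%:MP | k <- iota 0 (size (muni p))].
have := @max_poly_roots _ (muni p) rs nz.
rewrite size_map size_iota ltnn => h; suff : false by []; apply: h; last first.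
  by rewrite map_inj_uniq ?iota_uniq.
apply/allP => _ /mapP[k _ ->]; apply/rootP; apply: IHl => t.
rewrite horner_muni.
rewrite -[RHS](p0 (fun i => oapp t k%:Z (unlift ord_max i))).
by apply: meval_eq => i; case: unlift.
Qed.
End Vanish.

Section Powers.
Variables (B : comNzRingType) (l : nat) (f : 'I_l -> B).

(* f_1^(c_1) ... f_l^(c_l) in the localization at f_1 ... f_l, for integers c_i *)
Definition zpow1 (i : 'I_l) (c : int) : loc (\prod_i f i) :=
  match c with
  | Posz k => toloc _ (f i) ^+ k
  | Negz k => lfrac _ (\prod_(j | j != i) f j) 1 ^+ k.+1
  end.

Definition zpow (c : 'I_l -> int) : loc (\prod_i f i) := \prod_i zpow1 i (c i).

Lemma zpow1V i : toloc (\prod_i f i) (f i) * zpow1 i (-1) = 1.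
Proof.
rewrite /= expr1 lfracM add0n; apply: frac_eq.
by rewrite expr0 expr1 mulr1 mul1r [RHS](bigD1 i).
Qed.

Lemma zpow1S i c : zpow1 i (c + 1) = toloc _ (f i) * zpow1 i c.
Proof.
case: c => k; first by rewrite -PoszD addn1 /= exprS.
rewrite NegzE; case: k => [|k].
  by rewrite addNr zpow1V.
have -> : - (k.+2%:Z) + 1 = - (k.+1%:Z) by lia.
have := zpow1V i; rewrite -!NegzE /= expr1 => tP.
by rewrite [in RHS]exprS mulrA tP mul1r.
Qed.

Lemma zpow1D i c d : zpow1 i (c + d) = zpow1 i c * zpow1 i d.
Proof.
have tV := zpow1V i.
have tI (x y : loc (\prod_i f i)) :
    toloc _ (f i) * x = toloc _ (f i) * y -> x = y.
  by move=> /(congr1 ( *%R (zpow1 i (-1)))); rewrite !mulrA [_ * toloc _ _]mulrC tV !mul1r.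
elim/int_rect: c => [|k IHk|k IHk]; first by rewrite add0r mul1r.
  by rewrite -addn1 PoszD addrAC !zpow1S IHk mulrA.
apply: tI; rewrite -zpow1S mulrA -zpow1S.
have -> : - k.+1%:Z + 1 = - k%:Z by rewrite -addn1 PoszD; ring.
rewrite -IHk; congr zpow1; rewrite -addn1 PoszD; ring.
Qed.

Lemma zpow1_inv i c : zpow1 i c * zpow1 i (- c) = 1.
Proof. by rewrite -zpow1D subrr. Qed.

Lemma zpow_inv c : zpow c * zpow (fun i => - c i) = 1.
Proof. by rewrite -big_split; apply: big1 => i _; apply: zpow1_inv. Qed.

End Powers.

Arguments zpow1 : simpl never.

Section Specialization.
Variables (K : fieldType) (A : comAlgType K) (l : nat) (f : 'I_l -> A).
Implicit Types (t : 'I_l -> int).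

Definition polyfam (i : 'I_l) : {mpoly A[l]} := (f i)%:MP.

(* A_{f_1...f_l}[s_1, ..., s_l], built as the localization of A[s_1, ..., s_l]
   rather than as polynomials over the localization: the latter is the zero ring
   when some f_i is 0, and {mpoly _[_]} requires a nonzero coefficient ring. *)
Definition sloc := loc (\prod_i polyfam i).
HB.instance Definition _ := GRing.ComPzRing.on sloc.

Definition intpt t : 'I_l -> A := fun i => (t i)%:~R.

Lemma meval_polyfam t : (\prod_i polyfam i).@[intpt t] = \prod_i f i.
Proof. by rewrite rmorph_prod /=; apply: eq_bigr => i _; rewrite mevalC. Qed.

(* h(t), computed on a representative: see spec_lfrac *)
Definition spec t (h : sloc) : loc (\prod_i f i) :=
  lfrac _ (repr h).1.@[intpt t] (repr h).2.

Lemma spec_lfrac t p m : spec t (lfrac _ p m) = lfrac _ p.@[intpt t] m.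
Proof.
apply/lfracP; have [j e] := repr_frac (\prod_i polyfam i) p m; exists j.
have := congr1 (meval (intpt t)) e.
by rewrite mevalM mevalB !mevalM !rmorphXn /= !meval_polyfam meval0.
Qed.

Fact spec_zmod_morphism t : zmod_morphism (spec t).
Proof.
move=> x y; have [p [k ->]] := locP x; have [q [m ->]] := locP y.
rewrite lfracN lfracD !spec_lfrac lfracN lfracD.
by rewrite mevalD !mevalM !rmorphXn /= !meval_polyfam mevalN.
Qed.

Fact spec_monoid_morphism t : monoid_morphism (spec t).
Proof.
split=> [|x y]; first by rewrite spec_lfrac meval1.
have [p [k ->]] := locP x; have [q [m ->]] := locP y.
by rewrite lfracM !spec_lfrac lfracM mevalM.
Qed.

HB.instance Definition _ t :=
  GRing.isZmodMorphism.Build sloc (loc (\prod_i f i)) (spec t) (spec_zmod_morphism t).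
HB.instance Definition _ t :=
  GRing.isMonoidMorphism.Build sloc (loc (\prod_i f i)) (spec t) (spec_monoid_morphism t).

Lemma spec_toloc t p : spec t (toloc _ p) = toloc _ p.@[intpt t].
Proof. exact: spec_lfrac. Qed.

Lemma spec_zpow1 t i c : spec t (zpow1 polyfam i c) = zpow1 f i c.
Proof.
case: c => k; rewrite /zpow1 rmorphXn /=; first by rewrite spec_toloc mevalC.
rewrite spec_lfrac rmorph_prod /=; congr (lfrac _ _ _ ^+ _).
by apply: eq_bigr => j _; rewrite mevalC.
Qed.

(* phi t h is the image of h f_1^{s_1}...f_l^{s_l} under s = t *)
Definition phi t (h : sloc) : loc (\prod_i f i) := spec t h * zpow f t.

(* binomial coefficient (s_i choose m) *)
Definition sbinom (i : 'I_l) (m : nat) : {mpoly A[l]} :=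
  (m`!%:R^-1 : K)%:A *: \prod_(u < m) ('X_i - u%:R).

End Specialization.

Lemma prod_intr (T : nzRingType) l (t : 'I_l -> int) (u : 'X_{1..l}) :
  \prod_i (t i)%:~R ^+ u i = (\prod_i t i ^+ u i)%:~R :> T.
Proof. by rewrite rmorph_prod; apply: eq_bigr => i _; rewrite rmorphXn. Qed.

Section Existence.
Variables (K : fieldType) (A : comAlgType K) (l : nat) (f : 'I_l -> A).
Hypothesis charK : [pchar K] =i pred0.
Implicit Types (t : 'I_l -> int) (D : diffop A).
Local Notation Af := (loc (\prod_i f i)).
Local Notation S := (sloc f).

Lemma natK k : k.+1%:R != 0 :> K.
Proof. by rewrite ((pcharf0P _).1 charK). Qed.

Definition binK (x : K) (m : nat) : K := m`!%:R^-1 * \prod_(u < m) (x - u%:R).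

Lemma binK0 x : binK x 0 = 1.
Proof. by rewrite /binK big_ord0 mulr1 fact0 invr1. Qed.

Lemma binK0S m : binK 0 m.+1 = 0.
Proof. by rewrite /binK big_ord_recl subr0 mul0r mulr0. Qed.

Lemma binKS x m : binK (x + 1) m.+1 = binK x m.+1 + binK x m.
Proof.
rewrite /binK [in LHS]big_ord_recl [in X in _ = X + _]big_ord_recr /=.
have -> : \prod_(i < m) (x + 1 - (bump 0 i)%:R) = \prod_(i < m) (x - i%:R).
  by apply: eq_bigr => i _; rewrite /bump /= add1n -natr1; ring.
have fm : m`!%:R != 0 :> K.
  by rewrite ((pcharf0P _).1 charK) -lt0n fact_gt0.
rewrite subr0 factS natrM; have := natK m; rewrite -natr1 => ?; field.
by apply/andP.
Qed.

Lemma meval_sbinom t i m :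
  (sbinom A i m).@[intpt A t] = (binK (t i)%:~R m)%:A.
Proof.
rewrite mevalZ rmorph_prod /binK -[RHS]scalerA -[RHS]mulr_algl; congr (_ * _).
rewrite -in_algE rmorph_prod /=; apply: eq_bigr => u _.
rewrite mevalB mevalXU /intpt rmorph_nat -in_algE rmorphB rmorph_nat.
by rewrite [in RHS]rmorph_int.
Qed.

Lemma scale_ad (a : A) D (x : Af) :
  ad a D *: x = D *: (toloc _ a * x) - toloc _ a * (D *: x).
Proof. by rewrite scalerBl -!scalerA !scale_mulop. Qed.

Lemma exists_base D (v : S) : exists w : S, forall t, spec t w = D *: spec t v.
Proof.
have [n hD] := diffop_order D; elim: n D hD v => [|n IHn] D hD v.
  exists 0 => t; rewrite rmorph0.
  by have -> : D = 0 by [apply: diffopP => x; rewrite hD]; rewrite scale0r.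
have [p [m ->]] := locP v; elim: m => [|m [w hw]].
  exists (toloc _ (\sum_(u <- msupp p) D p@_u *: 'X_[u])) => t.
  rewrite spec_toloc spec_lfrac [RHS]scale_toloc; congr toloc.
  rewrite raddf_sum [in RHS]mevalE raddf_sum /=; apply: eq_bigr => u _.
  by rewrite mevalZ mevalX /intpt prod_intr !mulrzr raddfMz.
have [w' hw'] := IHn _ (@ad_order _ _ n (\prod_i f i) D hD) (lfrac _ p m.+1).
exists (lfrac _ 1 1 * (w - w')) => t.
rewrite rmorphM rmorphB /= hw hw' (spec_lfrac f t 1 1) meval1 -[lfrac _ 1 1]/(locinv (\prod_i f i)) scale_ad.
rewrite !spec_lfrac fracSK opprB addrC subrK mulrA [_ * toloc _ _]mulrC.
by rewrite locinvK mul1r.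
Qed.

Definition beta (c : int) (m : nat) : Af := toloc _ ((binK c%:~R m)%:A).

Lemma scale_zpow1 D n i (c : int) (y : Af) : order_lt n D ->
  D *: (zpow1 f i c * y) =
  \sum_(j < n) beta c j * zpow1 f i (c - j%:Z) * (iter j (ad (f i)) D *: y).
Proof.
elim: n D c => [|n IHn] D c hD.
  have -> : D = 0 by apply: diffopP => x; rewrite hD.
  by rewrite scale0r big_ord0.
set S := fun c : int =>
  \sum_(j < n.+1) beta c j * zpow1 f i (c - j%:Z) * (iter j (ad (f i)) D *: y).
have S0 : S 0 = D *: y.
  rewrite /S big_ord_recl [X in _ + X]big1 => [|j _].
    by rewrite /beta binK0 scale1r rmorph1 subr0 !mul1r addr0.
  by rewrite /beta binK0S scale0r rmorph0 !mul0r.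
have SS d : S (d + 1) = toloc _ (f i) * S d + ad (f i) D *: (zpow1 f i d * y).
  rewrite (IHn _ _ (ad_order (f i) hD)) /S !big_ord_recl /= mulrDr -[RHS]addrA.
  congr (_ + _).
        by rewrite /beta !binK0 !subr0 scale1r rmorph1 zpow1S !mul1r mulrA.
  rewrite mulr_sumr -big_split /=; apply: eq_bigr => j _.
  have e1 : (d + 1 - (bump 0 j)%:Z) = d - j%:Z by rewrite /bump add1n -addn1 PoszD; ring.
  have e2 : d - j%:Z = (d - (bump 0 j)%:Z) + 1 by rewrite /bump add1n -addn1 PoszD; ring.
  rewrite e1 -iterSr /= /beta /bump add1n rmorphD binKS scalerDl rmorphD /=.
  by rewrite e2 zpow1S /bump add1n; ring.
have tI (x z : Af) : toloc _ (f i) * x = toloc _ (f i) * z -> x = z.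
  move=> /(congr1 ( *%R (zpow1 f i (-1)))); rewrite !mulrA.
  by rewrite [_ * toloc _ _]mulrC zpow1V !mul1r.
have step d : D *: (zpow1 f i (d + 1) * y) =
    toloc _ (f i) * (D *: (zpow1 f i d * y)) + ad (f i) D *: (zpow1 f i d * y).
  by rewrite scale_ad zpow1S -mulrA addrC subrK.
rewrite -/(S c); elim/int_rect: c => [|k IHk|k IHk].
- by rewrite S0 mul1r.
- by rewrite -addn1 PoszD step IHk -SS.
- have e : - k%:Z = - k.+1%:Z + 1 by rewrite -addn1 PoszD; ring.
  by apply: tI; move: IHk; rewrite e step SS => /addIr.
Qed.

Lemma exists_twist (r : seq 'I_l) D (v : S) : exists w : S, forall t,
  spec t w * \prod_(i <- r) zpow1 f i (t i) =
  D *: (spec t v * \prod_(i <- r) zpow1 f i (t i)).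
Proof.
elim: r D v => [|i r IHr] D v.
  have [w hw] := exists_base D v; exists w => t.
  by rewrite big_nil !mulr1 hw.
have [n hD] := diffop_order D.
have [w hw] := choice (fun j => IHr (iter j (ad (f i)) D) v).
exists (\sum_(j < n) toloc _ (sbinom A i j) * zpow1 (polyfam f) i (- j%:Z) * w j).
move=> t; rewrite big_cons [X in _ *: X]mulrCA (scale_zpow1 _ _ _ hD).
rewrite rmorph_sum mulr_suml /=; apply: eq_bigr => j _.
rewrite -hw !rmorphM /= spec_zpow1 spec_toloc meval_sbinom zpow1D /beta.
ring.
Qed.

Lemma exists_act (D : {mpoly (diffop A)[l]}) (v : S) :
  exists w : S, forall t, phi t w = D.@[fun i => (t i)%:~R] *: phi t v.
Proof.
have [w hw] := choice (fun u => exists_twist (index_enum 'I_l) D@_u v).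
exists (\sum_(u <- msupp D) toloc _ 'X_[u] * w u) => t.
rewrite /phi rmorph_sum mulr_suml mevalE scaler_suml /=; apply: eq_bigr => u _.
rewrite rmorphM /= -mulrA [spec t (w u) * _]hw spec_toloc mevalX /intpt.
rewrite !prod_intr mulrzr rmorph_int mulrzl.
by rewrite -scalerMzl.
Qed.

Variables (R : idomainType) (iota : {rmorphism A -> R}) (iotaI : injective iota).

Lemma natR k : k.+1%:R != 0 :> R.
Proof.
by rewrite -(rmorph_nat (iota \o in_alg A)) fmorph_eq0 natK.
Qed.

Lemma phi_inj (v w : S) : (forall t, phi t v = phi t w) -> v = w.
Proof.
move=> e; apply/eqP; rewrite -subr_eq0; apply/eqP.
have e0 t : spec t (v - w) = 0.
  have := congr1 ( *%R^~ (zpow f (fun i => - t i))) (e t).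
  by rewrite /phi -!mulrA zpow_inv !mulr1 rmorphB /= => ->; rewrite subrr.
move: (v - w) e0 => x; have [p [m ->]] := locP x => e0.
apply/lfracP; rewrite mul0r subr0 expr0 mulr1.
have [F0|nzF] := eqVneq (\prod_i f i) 0.
  exists 1%N; have -> : \prod_i polyfam f i = (\prod_i f i)%:MP_[l].
    by rewrite rmorph_prod.
  by rewrite F0 mpolyC0 expr1 mul0r.
exists 0%N; rewrite mul1r.
suff p0 : map_mpoly iota p = 0.
  apply/mpolyP => u; apply: iotaI.
  by rewrite mcoeff0 rmorph0 -mcoeff_map_mpoly p0 mcoeff0.
apply: (mpoly_vanish natR) => t.
have := e0 t; rewrite spec_lfrac => /lfracP[j].
rewrite mul0r subr0 expr0 mulr1 => /(congr1 iota).
rewrite rmorphM rmorphXn rmorph0 => /eqP; rewrite mulf_eq0 expf_eq0.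
rewrite -(rmorph0 iota) (inj_eq iotaI) (negPf nzF) andbF /= (rmorph0 iota) => /eqP <-.
rewrite /map_mpoly /mmap [LHS]raddf_sum /= mevalE raddf_sum /=.
apply: eq_bigr => u _; rewrite mmap1_id mevalM mevalC mevalX rmorphM.
by rewrite /intpt !prod_intr rmorph_int.
Qed.

End Existence.

Lemma meval_int_central (T : nzRingType) l (t : 'I_l -> int) (p q : {mpoly T[l]}) :
  (p * q).@[fun i => (t i)%:~R] =
  p.@[fun i => (t i)%:~R] * q.@[fun i => (t i)%:~R].
Proof.
have h : multiplicative (mmap (@idfun T) (fun i => (t i)%:~R)).
  apply: commr_mmap_is_multiplicative => [i x|x m m'] /=;
    rewrite /mmap1 ?prod_intr; exact: commr_int.
exact: (h.1 p q).
Qed.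

Section FsModule.
Variables (K : fieldType) (charK : [pchar K] =i pred0).
Variables (n : nat) (A : subalgClosed {mpoly K[n]}).
Variables (l : nat) (f : 'I_l -> subalg A).
Implicit Types (t : 'I_l -> int) (D E : {mpoly (diffop (subalg A))[l]}).

(* M^A[f^s] = A_{f_1...f_l}[s] f_1^{s_1}...f_l^{s_l}, with h f_1^{s_1}...f_l^{s_l}
   (written fs h) represented by h.  The characteristic zero hypothesis is a
   parameter because the D_{A|K}[s]-module structure depends on it. *)
Definition fsmod_of of [pchar K] =i pred0 : Type := sloc f.
Local Notation fsmod := (fsmod_of charK).
HB.instance Definition _ := GRing.Zmodule.copy fsmod (sloc f).

Definition fs (h : sloc f) : fsmod := h.

(* By exists_act and phi_inj, fs_act D v is the only element of fsmod with
   phi t (fs_act D v) = D(t) *: phi t v for all integer vectors t. *)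
Definition fs_act D (v : fsmod) : fsmod := sval (cid (exists_act charK D v)).

Lemma phi_fs_act t D (v : fsmod) :
  phi t (fs_act D v) = D.@[fun i => (t i)%:~R] *: phi t v.
Proof. by rewrite /fs_act; case: cid => w /=. Qed.

Lemma phi_fsmod_inj (v w : fsmod) : (forall t, phi t v = phi t w) -> v = w.
Proof.
move=> h; pose i : {rmorphism subalg A -> {mpoly K[n]}} := \val.
have iI : injective i by exact: val_inj.
exact: (phi_inj charK iI h).
Qed.

Lemma phiD t (v w : fsmod) : phi t (v + w) = phi t v + phi t w.
Proof. by rewrite /phi rmorphD mulrDl. Qed.

Fact fs_actA D E v : fs_act D (fs_act E v) = fs_act (D * E) v.
Proof.
apply: phi_fsmod_inj => t.
by rewrite !phi_fs_act scalerA meval_int_central.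
Qed.

Fact fs_act1 : left_id 1 fs_act.
Proof. by move=> v; apply: phi_fsmod_inj => t; rewrite phi_fs_act meval1 scale1r. Qed.

Fact fs_actDr : right_distributive fs_act +%R.
Proof.
move=> D v w; apply: phi_fsmod_inj => t.
by rewrite phi_fs_act !phiD scalerDr !phi_fs_act.
Qed.

Fact fs_actDl v : {morph fs_act^~ v : D E / D + E}.
Proof.
move=> D E; apply: phi_fsmod_inj => t.
by rewrite phi_fs_act !phiD mevalD scalerDl !phi_fs_act.
Qed.

HB.instance Definition _ :=
  GRing.Zmodule_isLmodule.Build {mpoly (diffop (subalg A))[l]} fsmod
    fs_actA fs_act1 fs_actDr fs_actDl.

Lemma phi_scale t D (v : fsmod) :
  phi t (D *: v) = D.@[fun i => (t i)%:~R] *: phi t v.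
Proof. exact: phi_fs_act. Qed.

Lemma fs_act_unique (act : {mpoly (diffop (subalg A))[l]} -> fsmod -> fsmod) :
  (forall t D v, phi t (act D v) = D.@[fun i => (t i)%:~R] *: phi t v) ->
  forall D v, act D v = D *: v.
Proof. by move=> h D v; apply: phi_fsmod_inj => t; rewrite h phi_scale. Qed.

End FsModule.

Section Statement.
Variables (K : fieldType) (n : nat) (A : subalgClosed {mpoly K[n]}).

Definition fin_gen_subalg : Prop :=
  exists (m : nat) (x : m.-tuple {mpoly K[n]}),
    forall a, a \in A <-> exists p : {mpoly K[m]}, a = p \mPo x.

(* {mpoly K[n]} = A (+) N as A-modules, for some A-submodule N *)
Definition direct_summand : Prop :=
  exists N : {pred {mpoly K[n]}},
    [/\ GRing.zmod_closed N,
        {in A & N, forall a u, a * u \in N},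
        forall x, exists2 a, a \in A & exists2 u, u \in N & x = a + u &
        forall x, x \in A -> x \in N -> x = 0].

End Statement.

(* x lies in the S-submodule generated by the elements satisfying G *)
Definition submod_gen (S : pzRingType) (M : lmodType S) (G : M -> Prop) (x : M) :
  Prop :=
  forall N : {pred M}, GRing.submod_closed N -> (forall v, G v -> v \in N) -> x \in N.

(* b(s_1 + ... + s_l) *)
Definition rat_poly_sum (K : fieldType) (A : comAlgType K) (l : nat)
    (b : {poly rat}) : {mpoly A[l]} :=
  (map_poly (fun q : rat => ((ratr q : K)%:A)%:MP_[l]) b).[\sum_i 'X_i].

(* the coefficient of f_1^{s_1}...f_l^{s_l} in the generator attached to c *)
Definition fs_gen (K : fieldType) (A : comAlgType K) (l : nat)
    (f : 'I_l -> A) (g : A) (c : 'I_l -> int) : sloc f :=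
  toloc _ (\prod_(i | c i < 0) sbinom A i `|c i|%N) * zpow (polyfam f) c *
  toloc _ g%:MP_[l].

(* Main.v *)
(* Mustata's trick reduces several polynomials to one: put h = sum_i f_i y_i in
   R[y].  An equation P(s) g h^(s+1) = b(s) g h^s with P a differential operator in
   x and y gives, on comparing the coefficients of y^c with |c| = s = m for natural
   m, an equation for b(c_1 + ... + c_l) g f^c whose right-hand side involves the
   products of binomials and powers f^(c+e) with |e| = 1 of the statement, and only
   nonnegative exponents.  Applying the A-linear retraction R -> A, which turns
   differential operators of R into differential operators of A, and using that an
   element of A_f[s] f^s is determined by its values at large natural s, descends
   the equation to A.

   For one polynomial, P and b exist over K by Bernstein's dimension count: all
   quotients of the chain D[s] g h^(s+k) are isomorphic up to a shift of s, and
   their ranks over K[s] are squeezed between Bernstein's inequality and the growth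
   of g h^s.  A minimal b has rational multiples because every derivation delta of K
   kills it: otherwise b has an irreducible factor pi with delta(pi) nonzero; after
   localizing K[s] at pi the chain takes only finitely many values, so pi^a maps its
   union into its intersection for some a, both are stable under delta, and the
   commutator of delta with pi^a lowers a to 0, so that pi was not needed in b.
   Hence the coefficients of b are algebraic over Q, since any transcendental
   element of K has nonzero derivative under some derivation.

   The module A_f[s] f^s over D[s] is replaced by germs at infinity of sequences
   m |-> w_m, with s acting as multiplication by m. *)
Require Import Defs.
From HB Require Import structures.
From mathcomp Require Import all_boot all_order all_algebra.
From mathcomp Require Import boolp zify ring.
From mathcomp Require classical_sets.
From mathcomp.multinomials Require Import ssrcomplements mpoly.

Set Implicit Arguments.
Unset Strict Implicit.
Unset Printing Implicit Defensive.

Import GRing.Theory.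
Local Open Scope ring_scope.

(** * Derivations of fields *)

Lemma leibniz_exp (S : comNzRingType) (D : S -> S) :
  (forall x y, D (x * y) = D x * y + x * D y) ->
  forall x a, D (x ^+ a.+1) = x ^+ a * D x *+ a.+1.
Proof.
move=> DM x; elim=> [|a IHa]; first by rewrite expr1 expr0 mul1r.
by rewrite exprS DM IHa mulrnAr mulrA -exprS [D x * _]mulrC -mulrS.
Qed.

Lemma fact_neq0 (K : fieldType) : [pchar K] =i pred0 -> forall k, k`!%:R != 0 :> K.
Proof. by move=> charK k; rewrite ((pcharf0P _).1 charK) -lt0n fact_gt0. Qed.

Definition is_derivation (K : nzRingType) (d : K -> K) : Prop :=
  (forall x y, d (x + y) = d x + d y) /\
  (forall x y, d (x * y) = d x * y + x * d y).

(* dual numbers: (a, b) stands for a + b eps with eps^2 = 0 *)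
Section Dual.
Variable K : comNzRingType.

Definition dual : Type := (K * K)%type.
HB.instance Definition _ := GRing.Zmodule.on dual.

Definition dual_mul (x y : dual) : dual := (x.1 * y.1, x.1 * y.2 + x.2 * y.1).

Fact dual_mulA : associative dual_mul.
Proof. by move=> x y z; congr pair; rewrite /=; ring. Qed.
Fact dual_mulC : commutative dual_mul.
Proof. by move=> x y; congr pair; rewrite /=; ring. Qed.
Fact dual_mul1 : left_id ((1, 0) : dual) dual_mul.
Proof. by move=> [a b]; congr pair; rewrite /=; ring. Qed.
Fact dual_mulD : left_distributive dual_mul +%R.
Proof. by move=> x y z; congr pair; rewrite /=; ring. Qed.
Fact dual_1_neq0 : ((1, 0) : dual) != 0.
Proof. by apply/eqP => -[/eqP]; rewrite oner_eq0. Qed.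
HB.instance Definition _ := GRing.Zmodule_isComNzRing.Build dual
  dual_mulA dual_mulC dual_mul1 dual_mulD dual_1_neq0.

Definition dfst (x : dual) : K := x.1.

Fact dfst_zmod_morphism : zmod_morphism dfst. Proof. by []. Qed.
Fact dfst_monoid_morphism : monoid_morphism dfst. Proof. by []. Qed.
HB.instance Definition _ := GRing.isZmodMorphism.Build dual K dfst dfst_zmod_morphism.
HB.instance Definition _ := GRing.isMonoidMorphism.Build dual K dfst dfst_monoid_morphism.

(** First-order Taylor expansion at [x + y eps]: because [eps^2 = 0], the increment only sees the
    derivative of the reduction of [P] modulo [eps]. *)
Lemma horner_dual (P : {poly dual}) (x y : K) :
  P.[(x, y)] = P.[(x, 0)] + (0, y * (map_poly dfst P)^`().[x]).
Proof.
elim/poly_ind: P => [|P c IHP].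
  by rewrite !horner0 rmorph0 deriv0 horner0 mulr0 addr0.
rewrite !hornerMXaddC IHP rmorphD rmorphM /= map_polyX map_polyC.
rewrite derivD derivM derivC derivX addr0 mulr1 !hornerE.
have e : (map_poly dfst P).[x] = P.[(x, 0)].1 by rewrite -[RHS]/(dfst _) -horner_map.
rewrite e; case: (P.[_]) => a b; case: c => c c'; congr pair; rewrite /=; ring.
Qed.

End Dual.

(** * Extension of a derivation from a subring to the whole field *)

Section DerivationExtension.
Import classical_sets.
Variable K : fieldType.
Hypothesis charK : [pchar K] =i pred0.
Local Notation dual := (dual K).
Implicit Types (G : set dual) (x y : K).

(* the graph of a derivation from a subring of K to K *)
Definition deriv_graph G : Prop :=
  [/\ G 1, forall u v, G u -> G v -> G (u - v),
      forall u v, G u -> G v -> G (u * v) & forall y, G (0, y) -> y = 0].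

Lemma natr_neq0 k : k.+1%:R != 0 :> K.
Proof. by rewrite ((pcharf0P _).1 charK). Qed.

Section Extend.
Variables (G : set dual) (graphG : deriv_graph G).

Definition gpoly (P : {poly dual}) : Prop := forall i, G P`_i.

Lemma graph0 : G 0.
Proof. by case: graphG => G1 GB _ _; rewrite -(subrr 1); apply: GB. Qed.

Lemma graphN u : G u -> G (- u).
Proof. by case: graphG => G1 GB _ _ Gu; rewrite -sub0r; apply: GB => //; apply: graph0. Qed.

Lemma graphD u v : G u -> G v -> G (u + v).
Proof.
by case: graphG => _ GB _ _ Gu Gv; rewrite -[v]opprK; apply: GB => //; apply: graphN.
Qed.

Lemma graph_sum (I : Type) (r : seq I) (F : I -> dual) :
  (forall i, G (F i)) -> G (\sum_(i <- r) F i).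
Proof. by move=> GF; elim/big_ind: _ => [|u v|i _] //; [apply: graph0|apply: graphD]. Qed.

Lemma gpolyC u : G u -> gpoly u%:P.
Proof. by move=> Gu i; rewrite coefC; case: eqP => // _; apply: graph0. Qed.

Lemma gpolyX : gpoly 'X.
Proof. by move=> i; rewrite coefX; case: eqP => _; [case: graphG|apply: graph0]. Qed.

Lemma gpolyB P Q : gpoly P -> gpoly Q -> gpoly (P - Q).
Proof. by case: graphG => _ GB _ _ gP gQ i; rewrite coefB; apply: GB. Qed.

Lemma gpolyM P Q : gpoly P -> gpoly Q -> gpoly (P * Q).
Proof.
case: graphG => _ _ GM _ gP gQ i; rewrite coefM.
by apply: graph_sum => j; apply: GM.
Qed.

Lemma gpolyXn k : gpoly 'X^k.
Proof.
by move=> i; rewrite coefXn; case: eqP => _; [case: graphG|apply: graph0].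
Qed.

Lemma gpoly_deriv P : gpoly P -> gpoly P^`().
Proof.
move=> gP i; rewrite coef_deriv; move: P`_i.+1 (gP i.+1) => u Gu.
by elim: i.+1 => [|k IHk]; [exact: graph0 | rewrite mulrS; apply: graphD].
Qed.

Lemma graph_eq0 u : G u -> dfst u = 0 -> u = 0.
Proof.
by case: graphG => _ _ _ Gv; case: u => a b Gu /= a0; move: Gu; rewrite /dfst /= in a0 *;
  rewrite a0 => /Gv ->.
Qed.

(** These are the relations that [x] satisfies over the domain of the derivation, each coefficient
    being paired with its derivative. *)
Definition gvanish x P := gpoly P /\ (map_poly (@dfst K) P).[x] = 0.

(** A relation [P0] of least degree forces the value [y], since characteristic zero makes its
    derivative nonzero at [x]; all other relations follow from [P0] by pseudo-division. If [x]
    satisfies no relation, any [y] will do. *)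
Lemma vanish_extend x : exists y, forall P, gvanish x P -> P.[(x, y)] = 0.
Proof.
have [[P1 [vP1 nz1]]|none] := pselect (exists P, gvanish x P /\ P != 0); last first.
  exists 0 => P vP; suff -> : P = 0 by rewrite horner0.
  by apply/eqP/negPn/negP => nz; apply: none; exists P.
pose Q k := `[< exists P, [/\ gvanish x P, P != 0 & size P = k] >].
have exQ : exists k, Q k by exists (size P1); apply/asboolP; exists P1.
case: (ex_minnP exQ) => k /asboolP[P0 [[gP0 vP0] nz0 sz0]] kmin.
have minP P : gvanish x P -> P != 0 -> (k <= size P)%N.
  by move=> vP nz; apply: kmin; apply/asboolP; exists P.
set p0 := map_poly (@dfst K) P0 in vP0.
have lc0 : dfst (lead_coef P0) != 0.
  apply: contra nz0 => /eqP /graph_eq0 e; rewrite -lead_coef_eq0; apply/eqP/e.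
  exact: gP0.
have k1 : (1 < k)%N.
  rewrite ltnNge -sz0; apply/negP => /size1_polyC e.
  have e0 : P0`_0 = 0.
    apply: graph_eq0; first exact: gP0.
    by move: vP0; rewrite /p0 e map_polyC hornerC -e.
  by move: nz0; rewrite e e0 eqxx.
(* Otherwise the derivative of [P0] would be a relation of smaller size, nonzero in characteristic
   zero. *)
have d0 : p0^`().[x] != 0.
  apply/eqP => e; have szd := lt_size_deriv nz0.
  have: (k <= size P0^`())%N.
    apply: minP; first by split; [apply: gpoly_deriv | rewrite -deriv_map].
    apply/eqP => /(congr1 (fun P : {poly dual} => dfst P`_(k.-2))).
    rewrite coef_deriv coef0 raddf0 raddfMn /= => /eqP.
    have -> : P0`_(k.-2).+1 = lead_coef P0 by rewrite lead_coefE sz0; congr _`_ _; lia.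
    by rewrite -mulr_natr mulf_eq0 (negPf lc0) (negPf (natr_neq0 _)).
  by rewrite leqNgt -sz0 szd.
(* The solution of [P0.[(x, y)] = 0], an affine equation in [y] by [horner_dual]. *)
exists (- (P0.[(x, 0)].2) / p0^`().[x]).
set y := _ / _; have P0y : P0.[(x, y)] = 0.
  rewrite horner_dual -/p0 /y divfK //.
  have: dfst P0.[(x, 0)] = 0 by rewrite -horner_map.
  by case: (P0.[_]) => a b /= ->; congr pair; rewrite /=; ring.
suff H m (P : {poly dual}) : (size P <= m)%N -> gvanish x P -> P.[(x, y)] = 0 by move=> P; apply: H.
elim: m P => [|m IHm] P szP [gP vP].
  by move: szP; rewrite leqn0 size_poly_eq0 => /eqP ->; rewrite horner0.
have [->|nzP] := eqVneq P 0; first by rewrite horner0.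
have kP := minP _ (conj gP vP) nzP.
(* One step of pseudo-division: leading coefficients are cross-multiplied, as the coefficients only
   form a ring. *)
pose S := (lead_coef P0)%:P * P - (lead_coef P)%:P * 'X^(size P - k) * P0.
have gS : gpoly S.
  apply: gpolyB; first by apply: gpolyM => //; apply: gpolyC; apply: gP0.
  apply: gpolyM => //; apply: gpolyM; last exact: gpolyXn.
  by apply: gpolyC; apply: gP.
have vS : (map_poly (@dfst K) S).[x] = 0.
  by rewrite rmorphB !rmorphM /= !hornerE -/p0 vP vP0 !mulr0 subr0.
have szS : (size S <= m)%N.
  apply/leq_sizeP => j mj; rewrite coefB -mulrA !coefCM.
  rewrite coefXnM; case: ltnP => [jlt|jge].
    lia.
  have [jP|jP] := leqP (size P) j.
    rewrite [P`_j]nth_default // mulr0 sub0r nth_default ?mulr0 ?oppr0 // sz0; lia.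
  have -> : j = (size P).-1 by lia.
  have -> : ((size P).-1 - (size P - k))%N = (size P0).-1 by rewrite sz0; lia.
  by rewrite -!lead_coefE mulrC subrr.
(* [lead_coef P0] has nonzero first component, so it is not a zero divisor among the dual
   numbers. *)
have := IHm S szS (conj gS vS).
rewrite !hornerE P0y mulr0 subr0; move: lc0; case: (lead_coef P0) => c c' /=.
case: (P.[_]) => a b; rewrite /dfst /= => nzc [/eqP].
rewrite mulf_eq0 (negPf nzc) /= => /eqP -> /eqP.
by rewrite mulr0 addr0 mulf_eq0 (negPf nzc) => /eqP ->.
Qed.

(** The new graph is the ring generated by [G] and [(x, y)]. It stays single-valued: an element
    [(0, z)] is the value at [(x, y)] of a relation, hence zero. *)
Lemma graph_extend x : exists G',
  [/\ deriv_graph G', (G `<=` G')%classic & exists y, G' (x, y)].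
Proof.
have [y hy] := vanish_extend x.
exists [set u | exists2 P, gpoly P & u = P.[(x, y)]]%classic; split.
- split.
  + by exists 1; [rewrite -polyC1; apply: gpolyC; case: graphG | rewrite hornerC].
  + move=> _ _ [P gP ->] [Q gQ ->]; exists (P - Q); first exact: gpolyB.
    by rewrite hornerD hornerN.
  + by move=> _ _ [P gP ->] [Q gQ ->]; exists (P * Q); [exact: gpolyM|rewrite hornerM].
  + move=> z [P gP e]; have Pxy0 : P.[(x, y)] = 0.
      by apply: hy; split=> //; rewrite -[x]/(dfst (x, y)) horner_map -e.
    by move: e; rewrite Pxy0 => -[].
- by move=> u Gu; exists u%:P; [exact: gpolyC|rewrite hornerC].
- by exists y, 'X; [exact: gpolyX|rewrite hornerX].
Qed.

End Extend.

Lemma graph_bigcup (F : set (set dual)) :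
  (F !=set0)%classic -> (F `<=` deriv_graph)%classic -> total_on F subset ->
  deriv_graph (\bigcup_(X in F) X)%classic.
Proof.
move=> [X0 FX0] sF tF.
have dir u v : (\bigcup_(X in F) X)%classic u -> (\bigcup_(X in F) X)%classic v ->
    exists X, [/\ F X, X u & X v].
  move=> [X FX Xu] [Y FY Yv].
  by have [XY|YX] := tF _ _ FX FY; [exists Y | exists X]; split => //; [apply: XY|apply: YX].
split.
- by exists X0 => //; case: (sF _ FX0).
- by move=> u v hu hv; have [X [FX Xu Xv]] := dir u v hu hv; exists X => //;
    case: (sF _ FX) => _ h _ _; apply: h.
- by move=> u v hu hv; have [X [FX Xu Xv]] := dir u v hu hv; exists X => //;
    case: (sF _ FX) => _ _ h _; apply: h.
- by move=> y [X FX Xy]; case: (sF _ FX) => _ _ _; apply.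
Qed.

Lemma derivation_extend (G0 : set dual) : deriv_graph G0 ->
  exists2 d, is_derivation d & forall x y, G0 (x, y) -> d x = y.
Proof.
move=> g0.
pose ok (G : set dual) := G = set0 \/ (deriv_graph G /\ (G0 `<=` G)%classic).
have [F sF tF|G [okG maxG]] := @Zorn_bigcup dual ok.
  have [[X [FX Xn0]]|all0] := pselect (exists X, F X /\ X <> set0); last first.
    left; apply: bigcup0 => X FX; apply: contrapT => n0; apply: all0; by exists X.
  right; pose F' := (F `&` [set X | X <> set0])%classic.
  have -> : (\bigcup_(X in F) X = \bigcup_(X in F') X)%classic.
    apply/seteqP; split=> u [Y FY Yu]; exists Y => //; last by case: FY.
    by split=> // Y0; rewrite Y0 in Yu.
  have gF' Y : F' Y -> deriv_graph Y /\ (G0 `<=` Y)%classic.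
    by move=> [FY Yn0]; case: (sF _ FY).
  split; last by move=> u G0u; exists X; [split|case: (gF' X) => // _; apply].
  apply: graph_bigcup; first by exists X.
    by move=> Y /gF'[].
  by move=> Y Z [FY _] [FZ _]; apply: tF.
have [gG sG] : deriv_graph G /\ (G0 `<=` G)%classic.
  case: okG => // Ge; exfalso; apply: (maxG G0); last by right; split.
  rewrite Ge; split=> // h.
  by have : (set0 : set dual) 1 by apply: h; case: g0.
have ext x : exists y, G (x, y).
  have [G' [gG' sGG' [y G'y]]] := graph_extend gG x.
  exists y; apply: contrapT => nG; apply: (maxG G'); last first.
    by right; split=> //; apply: subset_trans sGG'.
  by split=> // h; apply: nG; apply: h.
have [d hd] := choice ext.
have uniq x y z : G (x, y) -> G (x, z) -> y = z.
  case: (gG) => _ GB _ Gv Gy Gz; apply/eqP; rewrite -subr_eq0; apply/eqP/Gv.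
  by have := GB _ _ Gy Gz; congr G; congr pair; rewrite /= subrr.
exists d; last by move=> x y /sG Gy; apply: uniq (hd x) Gy.
split=> x y; apply: uniq (hd _) _; first exact: (graphD gG (hd x) (hd y)).
case: (gG) => _ _ GM _; have := GM _ _ (hd x) (hd y).
by congr G; congr pair; rewrite /= addrC.
Qed.

(** Evaluating integer polynomials at [x + eps] gives the graph of [d/dx] on the subring generated
    by [x]; it is single-valued as [x] is transcendental. *)
Lemma transcendental_derivation (x : K) :
  (forall p : {poly int}, p != 0 -> (map_poly intr p).[x] != 0) ->
  exists2 d, is_derivation d & d x = 1.
Proof.
move=> trx; pose ev (p : {poly int}) : dual := (map_poly intr p : {poly dual}).[(x, 1)].
have [|d dd hd] := @derivation_extend [set u | exists p, u = ev p]%classic.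
  split.
  - by exists 1; rewrite /ev rmorph1 -polyC1 hornerC.
  - by move=> _ _ [p ->] [q ->]; exists (p - q); rewrite /ev rmorphB hornerD hornerN.
  - by move=> _ _ [p ->] [q ->]; exists (p * q); rewrite /ev rmorphM hornerM.
  - move=> y [p e]; have [p0|/trx] := eqVneq p 0.
      by move: e; rewrite p0 /ev rmorph0 horner0 => -[].
    have : dfst (ev p) = 0 by rewrite -e.
    rewrite /ev -horner_map -map_poly_comp /=.
    have -> : map_poly (@dfst K \o intr) p = map_poly intr p.
      by apply: eq_map_poly => i /=; rewrite rmorph_int.
    by move=> ->; rewrite eqxx.
by exists d => //; apply: hd; exists 'X; rewrite /ev map_polyX hornerX.
Qed.

End DerivationExtension.

(** * Polynomials with algebraic coefficients *)

Section RationalMultiple.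
Import Num.Theory.
Variable K : fieldType.
Hypothesis charK : [pchar K] =i pred0.

Lemma intr_neq0 (z : int) : z != 0 -> z%:~R != 0 :> K.
Proof.
have nz k : k.+1%:R != 0 :> K by rewrite ((pcharf0P _).1 charK).
by case: z => [[|k]|k] // _; [apply: nz | rewrite NegzE mulrNz oppr_eq0; apply: nz].
Qed.

(** Any fraction representing [x] computes [ratr x], not only the reduced one, since denominators
    stay nonzero in characteristic zero. *)
Lemma ratr_frac (x : rat) (n d : int) :
  d != 0 -> x * d%:~R = n%:~R -> ratr x = n%:~R / d%:~R :> K.
Proof.
move=> nzd e; have nzd' := intr_neq0 nzd.
have nzx := intr_neq0 (denq_neq0 x).
apply/eqP; rewrite /ratr eqr_div // -!intrM; apply/eqP; congr _%:~R.
apply: (@intr_inj rat); rewrite !intrM -e numqE; ring.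
Qed.

Lemma ratr_char0_zmod_morphism : zmod_morphism (ratr : rat -> K).
Proof.
move=> x y; have nx := intr_neq0 (denq_neq0 x); have ny := intr_neq0 (denq_neq0 y).
rewrite (@ratr_frac (x - y) (numq x * denq y - numq y * denq x) (denq x * denq y)).
- by rewrite /ratr !(intrB, intrM); field; apply/andP.
- by rewrite mulf_neq0 ?denq_neq0.
- by rewrite !(intrB, intrM) !numqE; ring.
Qed.

Lemma ratr_char0_monoid_morphism : monoid_morphism (ratr : rat -> K).
Proof.
split=> [|x y]; first by rewrite (ratr_int _ 1).
have nx := intr_neq0 (denq_neq0 x); have ny := intr_neq0 (denq_neq0 y).
rewrite (@ratr_frac (x * y) (numq x * numq y) (denq x * denq y)).
- by rewrite /ratr !intrM; field; apply/andP.
- by rewrite mulf_neq0 ?denq_neq0.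
- by rewrite !intrM !numqE; ring.
Qed.

(** Since its coefficients are algebraic over the rationals, [b] is integral over the rational
    polynomials. The constant term of an integral equation of [b], once powers of the unknown are
    divided out, is a nonzero multiple of [b]. *)
Lemma dvdp_rat_multiple (b : {poly K}) : b != 0 ->
    (forall i, exists2 p : {poly int}, p != 0 & (map_poly intr p).[b`_i] = 0) ->
  exists2 c : {poly rat}, c != 0 & b %| map_poly ratr c.
Proof.
move=> nzb algb.
pose rM := GRing.isMonoidMorphism.Build _ _ _ ratr_char0_monoid_morphism.
pose rA := GRing.isZmodMorphism.Build _ _ _ ratr_char0_zmod_morphism.
pose r : {rmorphism rat -> K} := HB.pack (ratr : rat -> K) rM rA.
have intb i : integralOver r b`_i.
  apply/integral_algebraic; have [p nzp pb] := algb i.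
  exists (map_poly intr p); last first.
    rewrite -map_poly_comp (@eq_map_poly _ _ _ intr) => [|z /=]; last exact: ratr_int.
    by apply/eqP.
  by rewrite map_poly_eq0_id0 // intr_eq0 lead_coef_eq0.
have [R RE] : exists R : {rmorphism {poly rat} -> {poly K}}, forall p, R p = map_poly r p.
  by exists (map_poly r).
have intB : integralOver R b.
  rewrite -[b]coefK poly_def; elim/big_ind: _ => [||i _].
  - exact: integral0.
  - exact: integral_add.
  rewrite -mul_polyC; apply: integral_mul.
    have [p monp pb] := intb i; exists (map_poly polyC p); first exact: monic_map.
    rewrite -map_poly_comp (@eq_map_poly _ _ _ (polyC \o r)) => [|z /=]; last first.
      by rewrite RE (map_polyC r z).
    by rewrite map_poly_comp; move/rootP: pb => pb; apply/rootP; rewrite horner_map pb.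
  have -> : 'X^i = R 'X^i by rewrite RE (map_polyXn r).
  exact: integral_id.
have [P monP Pb] := intB.
have nzP : P != 0 by rewrite monic_neq0.
have [m [Q nQ eP]] := multiplicity_XsubC P 0.
move: nQ; rewrite nzP /= rootE horner_coef0 => nQ; exists Q`_0 => //.
move: Pb; rewrite eP rmorphM rmorphXn /= rmorphB /= map_polyX map_polyC /= rootM.
rewrite rmorph0; have -> : root (('X - 0%:P) ^+ m) b = false.
  case: m {eP} => [|m]; first by apply/negbTE; rewrite expr0 root1.
  by rewrite root_exp_XsubC; apply/negbTE.
rewrite orbF => /rootP Qb.
have : root (map_poly R Q - (R Q`_0)%:P) 0.
  by rewrite rootE hornerD hornerN hornerC horner_coef0 coef_map subrr.
move=> /factor_theorem[q]; rewrite subr0 => /(congr1 (horner^~ b)).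
rewrite !hornerE Qb sub0r => e; rewrite -[map_poly _ _]RE; apply/dvdpP; exists (- q.[b]).
by rewrite mulNr -e opprK.
Qed.

End RationalMultiple.

(** * Linear dependence over a domain *)

Section LinearDependence.
Variables (k : idomainType) (I J : finType).

(** Gaussian elimination without division: a nonzero entry [M j1 i0] is the pivot that removes the
    row [j1] and the column [i0]. *)
Lemma dependent (M : J -> I -> k) (A : {set J}) (B : {set I}) :
  (#|B| < #|A|)%N -> exists a : J -> k,
    [/\ exists2 j, j \in A & a j != 0, forall j, j \notin A -> a j = 0 &
        forall i, i \in B -> \sum_j a j * M j i = 0].
Proof.
have [n] := ubnP #|B|; elim: n M A B => // n IHn M A B leB ltBA.
have [j0 Aj0] : exists j, j \in A by apply/set0Pn; rewrite -card_gt0; lia.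
have [->|/set0Pn[i0 Bi0]] := eqVneq B set0.
  exists (fun j => (j == j0)%:R); split=> [|j|i]; last by rewrite inE.
    by exists j0; rewrite ?eqxx ?oner_eq0.
  by case: eqP => // ->; rewrite Aj0.
have cB : #|B :\ i0| = #|B|.-1 by rewrite (cardsD1 i0 B) Bi0.
have cB0 : (0 < #|B|)%N by rewrite card_gt0; apply/set0Pn; exists i0.
have [[j1 [Aj1 nz1]]|all0] := pselect (exists j, j \in A /\ M j i0 != 0); last first.
  have [||a [nza a0 aM]] := IHn M A (B :\ i0); [lia|lia|].
  exists a; split=> // i Bi; have [->|ni] := eqVneq i i0; last first.
    by apply: aM; rewrite !inE ni.
  apply: big1 => j _; have [Aj|nAj] := boolP (j \in A); last by rewrite a0 ?mul0r.
  have [->|nz] := eqVneq (M j i0) 0; first by rewrite mulr0.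
  by case: all0; exists j.
pose M' j i := M j1 i0 * M j i - M j i0 * M j1 i.
have cA : #|A :\ j1| = #|A|.-1 by rewrite (cardsD1 j1 A) Aj1.
have [||a [[j Aj nzj] a0 aM]] := IHn M' (A :\ j1) (B :\ i0); [lia|lia|].
have a1 : a j1 = 0 by apply: a0; rewrite !inE eqxx.
pose s := \sum_j a j * M j i0.
(* The coefficient of [j1] is chosen to cancel the column [i0]; the others are multiplied by the
   pivot. *)
exists (fun j => M j1 i0 * a j - (j == j1)%:R * s); split.
- move: Aj; rewrite !inE => /andP[/negPf nj Aj]; exists j => //.
  by rewrite nj mul0r subr0 mulf_neq0.
- move=> j' nA; rewrite a0 ?inE ?(negPf nA) ?andbF //.
  by have [e|_] := eqVneq j' j1; [rewrite -e (negPf nA) in Aj1|rewrite mulr0 mul0r subr0].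
move=> i Bi.
transitivity (\sum_j a j * M' j i).
  rewrite /M'; under eq_bigr do rewrite mulrBl.
  rewrite sumrB [X in _ - X](bigD1 j1) //= eqxx mul1r [X in _ - (_ + X)]big1 => [|j' /negPf ->].
    rewrite addr0 [RHS](eq_bigr (fun j => M j1 i0 * a j * M j i - a j * M j i0 * M j1 i)).
      by rewrite sumrB /s mulr_suml.
    by move=> j' _; ring.
  by rewrite !mul0r.
have [->|ni] := eqVneq i i0; last by apply: aM; rewrite !inE ni.
by apply: big1 => j' _; rewrite /M'; ring.
Qed.

End LinearDependence.

(** * Differential operators and their symbols *)

Lemma mnm_neq0P n (m : 'X_{1..n}) : m != 0%MM -> exists i, (0 < m i)%N.
Proof.
move=> nz; apply/existsP; apply: contraNT nz; rewrite negb_exists => /forallP h.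
by apply/eqP/mnmP => i; rewrite mnm0E; apply/eqP; have := h i; rewrite -eqn0Ngt.
Qed.

Lemma mnm_ind n (P : 'X_{1..n} -> Prop) :
  P 0%MM -> (forall m i, P m -> P (m + U_(i))%MM) -> forall m, P m.
Proof.
move=> P0 PS m; have [k] := ubnP (mdeg m); elim: k m => // k IHk m ltm.
have [->//|/mnm_neq0P[i mi]] := eqVneq m 0%MM.
have Um : (U_(i) <= m)%MM by rewrite lep1mP -lt0n.
rewrite -(submK Um); apply: PS; apply: IHk.
by move: ltm; rewrite -{1}(submK Um) mdegD mdeg1 addn1.
Qed.

Section Operators.
Variables (K : fieldType) (n : nat).
Local Notation R := {mpoly K[n]}.
Local Notation symb := {mpoly {poly K}[n + n]}.
Implicit Types (p q : R) (M : 'X_{1..n + n}) (lam : symb).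

Lemma mderivm_mulX i (b : 'X_{1..n}) p :
  ('X_i * p)^`M[b] = 'X_i * p^`M[b] + p^`M[b - U_(i)] *+ b i.
Proof.
elim/mnm_ind: b => [|b j IHb]; first by rewrite !mderivm0m mnm0E addr0.
rewrite !mderivmDm !mderivmU1m IHb mderivD mderivM mderivMn mderivX mnm1E.
have [->|nij] := eqVneq j i.
  have -> : (b + U_(i) - U_(i) = b)%MM by rewrite addmK.
  have -> : (U_(i) - U_(i) = 0 :> 'X_{1..n})%MM.
    by apply/mnmP => k; rewrite mnmBE mnm0E subnn.
  rewrite mpolyX0 scale1r mul1r mnmDE mnm1E eqxx mulrnDr addrAC addrC.
  congr (_ + _); rewrite addrC; congr (_ + _).
  have [->|bi] := eqVneq (b i) 0%N; first by rewrite !mulr0n.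
  by rewrite -mderivmU1m -mderivmDm submK // lep1mP.
rewrite scale0r mul0r add0r mnmDE mnm1E (negPf nij) addn0; congr (_ + _ *+ _).
rewrite -mderivmU1m -mderivmDm; congr mderivm.
apply/mnmP => k; rewrite !(mnmDE, mnmBE, mnm1E).
by have [<-|_] := eqVneq j k; [rewrite eq_sym (negPf nij); lia | lia].
Qed.

(* a monomial in 2n variables is the symbol of an operator x^a d^b *)
Definition xpart M : 'X_{1..n} := [multinom M (lshift n i) | i < n].
Definition dpart M : 'X_{1..n} := [multinom M (rshift n i) | i < n].
Definition opm M p : R := 'X_[xpart M] * p^`M[dpart M].

(** The normally ordered operator with symbol [lam], with [s] set to [m]. Commutative symbols stand
    in for elements of the Weyl algebra over [K[s]]; degrees are total degrees in [x] and [d]. *)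
Definition op lam (m : nat) p : R :=
  \sum_(M <- msupp lam) (lam@_M).[m%:R] *: opm M p.

(** A summation range independent of the symbol, so that symbols can be added. *)
Lemma opwE k lam m p : (msize lam <= k)%N ->
  op lam m p = \sum_(M : bmultinom (n + n) k) (lam@_M).[m%:R] *: opm M p.
Proof.
pose I : subFinType _ := bmultinom (n + n) k.
move=> lek; rewrite /op (big_mksub I) /=; first last.
- by move=> x /msize_mdeg_lt/leq_trans/(_ lek).
- by rewrite msupp_uniq.
rewrite big_rmcond //= => j /memN_msupp_eq0 ->.
by rewrite horner0 scale0r.
Qed.

Lemma opD lam mu m p : op (lam + mu) m p = op lam m p + op mu m p.
Proof.
pose k := maxn (msize lam) (msize mu).
rewrite !(@opwE k) ?leq_maxl ?leq_maxr ?msizeD_le // -big_split /=.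
by apply: eq_bigr => M _; rewrite mcoeffD hornerD scalerDl.
Qed.

Lemma opZ c lam m p : op (c *: lam) m p = c.[m%:R] *: op lam m p.
Proof.
rewrite !(@opwE (msize lam)) ?msizeZ_le // scaler_sumr.
by apply: eq_bigr => M _; rewrite mcoeffZ hornerM scalerA.
Qed.

Lemma op0 m p : op 0 m p = 0.
Proof. by rewrite /op msupp0 big_nil. Qed.

Lemma op_sum (I : Type) (r : seq I) (F : I -> symb) m p :
  op (\sum_(i <- r) F i) m p = \sum_(i <- r) op (F i) m p.
Proof. by elim/big_rec2: _ => [|i x y _ <-]; rewrite ?op0 ?opD. Qed.

Lemma opX M m p : op 'X_[M] m p = opm M p.
Proof. by rewrite /op msuppX big_seq1 mcoeffX eqxx hornerC scale1r. Qed.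

Lemma opC c m p : op c%:MP m p = c.[m%:R] *: p.
Proof.
rewrite -[c%:MP]mulr1 -[1]mpolyX0 mul_mpolyC opZ opX /opm.
have -> : xpart 0 = 0%MM by apply/mnmP => i; rewrite mnmE !mnm0E.
have -> : dpart 0 = 0%MM by apply/mnmP => i; rewrite mnmE !mnm0E.
by rewrite mpolyX0 mderivm0m mul1r.
Qed.

Lemma symb_ind (P : symb -> Prop) : P 0 ->
  (forall c lam, P lam -> P (c *: lam)) -> (forall lam mu, P lam -> P mu -> P (lam + mu)) ->
  (forall M, P 'X_[M]) -> forall lam, P lam.
Proof.
move=> P0 PZ PD PX lam; rewrite [lam]mpolyE.
by elim/big_ind: _ => // M _; apply: PZ.
Qed.

Lemma opmZ M (c : K) p : opm M (c *: p) = c *: opm M p.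
Proof. by rewrite /opm mderivmZ scalerAr. Qed.

Lemma op_p0 lam m : op lam m 0 = 0.
Proof. by apply: big1 => M _; rewrite /opm raddf0 mulr0 scaler0. Qed.

Lemma op_pD lam m p q : op lam m (p + q) = op lam m p + op lam m q.
Proof.
by rewrite /op -big_split; apply: eq_bigr => M _; rewrite /= /opm raddfD mulrDr scalerDr.
Qed.

Lemma op_pZ lam m (c : K) p : op lam m (c *: p) = c *: op lam m p.
Proof.
by rewrite /op scaler_sumr; apply: eq_bigr => M _; rewrite opmZ !scalerA mulrC.
Qed.

Lemma op_pB lam m p q : op lam m (p - q) = op lam m p - op lam m q.
Proof. by rewrite op_pD -scaleN1r op_pZ scaleN1r. Qed.

Lemma op_p_sum (I : Type) (r : seq I) (P : pred I) (F : I -> R) lam m :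
  op lam m (\sum_(i <- r | P i) F i) = \sum_(i <- r | P i) op lam m (F i).
Proof. by elim/big_rec2: _ => [|i x y _ <-]; rewrite ?op_p0 ?op_pD. Qed.

Lemma xpartD M M' : xpart (M + M') = (xpart M + xpart M')%MM.
Proof. by apply/mnmP => i; rewrite !(mnmE, mnmDE). Qed.
Lemma dpartD M M' : dpart (M + M') = (dpart M + dpart M')%MM.
Proof. by apply/mnmP => i; rewrite !(mnmE, mnmDE). Qed.
Lemma xpartB M M' : xpart (M - M') = (xpart M - xpart M')%MM.
Proof. by apply/mnmP => i; rewrite !(mnmE, mnmBE). Qed.
Lemma dpartB M M' : dpart (M - M') = (dpart M - dpart M')%MM.
Proof. by apply/mnmP => i; rewrite !(mnmE, mnmBE). Qed.
Lemma xpartUl i : xpart U_(lshift n i) = U_(i)%MM.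
Proof. by apply/mnmP => j; rewrite mnmE !mnm1E eq_lshift. Qed.
Lemma xpartUr i : xpart U_(rshift n i) = 0%MM.
Proof. by apply/mnmP => j; rewrite mnmE mnm1E mnm0E eq_rlshift. Qed.
Lemma dpartUr i : dpart U_(rshift n i) = U_(i)%MM.
Proof. by apply/mnmP => j; rewrite mnmE !mnm1E eq_rshift. Qed.
Lemma dpartUl i : dpart U_(lshift n i) = 0%MM.
Proof. by apply/mnmP => j; rewrite mnmE mnm1E mnm0E eq_lrshift. Qed.

Lemma mdeg_parts M : mdeg M = (mdeg (xpart M) + mdeg (dpart M))%N.
Proof.
by rewrite !mdegE big_split_ord /=; congr addn; apply: eq_bigr => i _; rewrite mnmE.
Qed.

Lemma mulX_op i lam m p : 'X_i * op lam m p = op ('X_(lshift n i) * lam) m p.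
Proof.
elim/symb_ind: lam => [|c lam IH|lam mu IH1 IH2|M].
- by rewrite mulr0 op0 mulr0.
- by rewrite -scalerAr !opZ -IH scalerAr.
- by rewrite mulrDr !opD -IH1 -IH2 mulrDr.
by rewrite -mpolyXD !opX /opm xpartD dpartD xpartUl dpartUl add0m mpolyXD mulrA.
Qed.

Lemma op_deriv i lam m p : op lam m p^`M(i) = op ('X_(rshift n i) * lam) m p.
Proof.
elim/symb_ind: lam => [|c lam IH|lam mu IH1 IH2|M].
- by rewrite mulr0 !op0.
- by rewrite -scalerAr !opZ -IH.
- by rewrite mulrDr !opD -IH1 -IH2.
by rewrite -mpolyXD !opX /opm xpartD dpartD xpartUr dpartUr add0m mderivmDm mderivmU1m.
Qed.

(** The commutator with [d_i] is differentiation of the symbol in [x_i], and dually in [op_mulX].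
    Such commutators lower the degree. *)
Lemma deriv_op i lam m p :
  (op lam m p)^`M(i) = op lam m p^`M(i) + op lam^`M(lshift n i) m p.
Proof.
elim/symb_ind: lam => [|c lam IH|lam mu IH1 IH2|M].
- by rewrite mderiv0 !op0 mderiv0 addr0.
- by rewrite mderivZ !opZ mderivZ IH scalerDr.
- by rewrite mderivD !opD mderivD IH1 IH2 addrACA.
rewrite mderivX opZ !opX hornerMn hornerC /opm mderivM mderivX addrC.
rewrite -!mderivmU1m -!mderivmDm addmC xpartB dpartB xpartUl dpartUl mnmE subm0.
by rewrite -scalerAl.
Qed.

Lemma op_mulX i lam m p :
  op lam m ('X_i * p) = 'X_i * op lam m p + op lam^`M(rshift n i) m p.
Proof.
elim/symb_ind: lam => [|c lam IH|lam mu IH1 IH2|M].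
- by rewrite mderiv0 !op0 mulr0 addr0.
- by rewrite mderivZ !opZ IH scalerDr scalerAr.
- by rewrite mderivD !opD IH1 IH2 mulrDr addrACA.
rewrite mderivX opZ !opX hornerMn hornerC /opm mderivm_mulX.
rewrite xpartB dpartB xpartUr dpartUr mnmE subm0 mulrDr mulrCA scaler_nat.
by rewrite mulrnAr.
Qed.

Lemma msize_deriv_le (S : nzRingType) k i (q : {mpoly S[k]}) : (msize q^`M(i) <= (msize q).-1)%N.
Proof.
rewrite msizeE; apply/bigmax_leqP_seq => M; rewrite mcoeff_msupp mcoeff_deriv => nz _.
have : (M + U_(i))%MM \in msupp q.
  by rewrite mcoeff_msupp; apply: contraNneq nz => ->; rewrite mul0rn.
by move=> /msize_mdeg_lt; rewrite mdegD mdeg1; lia.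
Qed.

Lemma msizeM_leq (S : idomainType) k (q r : {mpoly S[k]}) :
  (msize (q * r) <= (msize q + msize r).-1)%N.
Proof.
have [->|nzq] := eqVneq q 0; first by rewrite mul0r msize0.
have [->|nzr] := eqVneq r 0; first by rewrite mulr0 msize0.
by rewrite msizeM.
Qed.

Lemma msize_mulX_le (S : idomainType) k i (q : {mpoly S[k]}) :
  (msize ('X_i * q) <= (msize q).+1)%N.
Proof. by apply: leq_trans (msizeM_leq _ _) _; rewrite msizeX mdeg1. Qed.

(** Composition respects the Bernstein filtration, since moving a derivative past [x_i] only
    produces terms of lower degree. *)
Lemma opm_op M lam : exists2 mu : symb, (msize mu <= msize lam + mdeg M)%N &
  forall m p, opm M (op lam m p) = op mu m p.
Proof.
suff derivs (b : 'X_{1..n}) (nu : symb) : exists2 mu : symb, (msize mu <= msize nu + mdeg b)%N &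
    forall m p, (op nu m p)^`M[b] = op mu m p.
  have xs (a : 'X_{1..n}) (nu : symb) : exists2 mu : symb, (msize mu <= msize nu + mdeg a)%N &
      forall m p, 'X_[a] * op nu m p = op mu m p.
    elim/mnm_ind: a => [|a i [mu szmu mu_op]].
      by exists nu => [|m p]; rewrite ?mdeg0 ?addn0 // mpolyX0 mul1r.
    exists ('X_(lshift n i) * mu) => [|m p].
      by apply: leq_trans (msize_mulX_le _ _) _; rewrite mdegD mdeg1 addn1 addnS ltnS.
    by rewrite -mulX_op -mu_op mpolyXD mulrCA mulrA.
  have [mu szmu mu_op] := derivs (dpart M) lam.
  have [mu' szmu' mu_op'] := xs (xpart M) mu.
  exists mu' => [|m p]; last by rewrite /opm mu_op mu_op'.
  by rewrite mdeg_parts; lia.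
elim/mnm_ind: b => [|b i [mu szmu mu_op]].
  by exists nu => [|m p]; rewrite ?mdeg0 ?addn0 // mderivm0m.
exists ('X_(rshift n i) * mu + mu^`M(lshift n i)) => [|m p].
  apply: leq_trans (msizeD_le _ _) _; rewrite geq_max mdegD mdeg1 addn1 addnS.
  apply/andP; split; first by apply: leq_trans (msize_mulX_le _ _) _.
  by apply: leq_trans (msize_deriv_le _ _) _; lia.
by rewrite mderivmDm mderivmU1m mu_op deriv_op opD op_deriv.
Qed.

End Operators.

(** * Modules of germs of sequences *)

Section Gen.
Variables (K : fieldType) (n : nat).
Local Notation R := {mpoly K[n]}.
Local Notation symb := {mpoly {poly K}[n + n]}.
Implicit Types (u v w : nat -> R) (c : {poly K}) (j : int).

(* The D[s]-submodule generated by u in the module of germs at infinity of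
   sequences in R, where s acts as multiplication by the index. *)
Inductive gen u : (nat -> R) -> Prop :=
| gen_base : gen u u
| gen_ev w w' N : gen u w -> (forall m, (N <= m)%N -> w m = w' m) -> gen u w'
| gen_add w w' : gen u w -> gen u w' -> gen u (fun m => w m + w' m)
| gen_scale c w : gen u w -> gen u (fun m => c.[m%:R] *: w m)
| gen_mulX i w : gen u w -> gen u (fun m => 'X_i * w m)
| gen_deriv i w : gen u w -> gen u (fun m => (w m)^`M(i)).

Lemma gen_eq u w w' : gen u w -> w =1 w' -> gen u w'.
Proof. by move=> gw e; apply: (gen_ev (N := 0) gw) => m _. Qed.

Lemma gen_trans u v w : gen u v -> gen v w -> gen u w.
Proof.
move=> uv; elim=> {w} [//|w w' N _ uw e|w w' _ ? _ ?|c w _ ?|i w _ ?|i w _ ?].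
- exact: gen_ev uw e.
- exact: gen_add.
- exact: gen_scale.
- exact: gen_mulX.
- exact: gen_deriv.
Qed.

Lemma gen_zero u : gen u (fun=> 0).
Proof. by apply: gen_eq (gen_scale 0 (gen_base u)) _ => m; rewrite horner0 scale0r. Qed.

Lemma gen_scaleK u (a : K) w : gen u w -> gen u (fun m => a *: w m).
Proof. by move=> /(gen_scale a%:P) gw; apply: gen_eq gw _ => m; rewrite hornerC. Qed.

Lemma gen_opp u w : gen u w -> gen u (fun m => - w m).
Proof. by move=> /(gen_scaleK (-1)) gw; apply: gen_eq gw _ => m; rewrite scaleN1r. Qed.

Lemma gen_sum u (I : Type) (r : seq I) (P : pred I) (F : I -> nat -> R) :
  (forall i, P i -> gen u (F i)) -> gen u (fun m => \sum_(i <- r | P i) F i m).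
Proof.
move=> gF; elim: r => [|i r IHr].
  by apply: gen_eq (gen_zero u) _ => m; rewrite big_nil.
have [Pi|nPi] := boolP (P i); last first.
  by apply: gen_eq IHr _ => m; rewrite big_cons (negPf nPi).
by apply: gen_eq (gen_add (gF i Pi) IHr) _ => m; rewrite big_cons Pi.
Qed.

Lemma gen_mulp u (p : R) w : gen u w -> gen u (fun m => p * w m).
Proof.
move=> gw; have mX (a : 'X_{1..n}) : gen u (fun m => 'X_[a] * w m).
  elim/mnm_ind: a => [|a i IHa].
    by apply: gen_eq gw _ => m; rewrite mpolyX0 mul1r.
  by apply: gen_eq (gen_mulX i IHa) _ => m; rewrite mpolyXD mulrCA mulrA.
apply: (@gen_eq _ (fun m => \sum_(a <- msupp p) p@_a *: ('X_[a] * w m))).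
  by apply: gen_sum => a _; apply: gen_scaleK.
by move=> m; rewrite [in RHS](mpolyE p) mulr_suml; apply: eq_bigr => a _; rewrite scalerAl.
Qed.

Lemma gen_derivm u (b : 'X_{1..n}) w : gen u w -> gen u (fun m => (w m)^`M[b]).
Proof.
move=> gw; elim/mnm_ind: b => [|b i IHb].
  by apply: gen_eq gw _ => m; rewrite mderivm0m.
by apply: gen_eq (gen_deriv i IHb) _ => m; rewrite mderivmDm mderivmU1m.
Qed.

Lemma gen_opm u M w : gen u w -> gen u (fun m => opm M (w m)).
Proof. by move=> gw; apply/gen_mulp/gen_derivm. Qed.

Lemma gen_op u (lam : symb) w : gen u w -> gen u (fun m => op lam m (w m)).
Proof. by move=> gw; apply: gen_sum => M _; apply/gen_scale/gen_opm. Qed.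

(** The substitution of [s + j] for [s]. Indices with [m + j < 0] give junk values, which germs at
    infinity ignore. *)
Definition shift j w : nat -> R := fun m => w `|(m%:Z + j)%R|%N.

(** Shifting commutes with the operators in [x] and turns a coefficient [c(s)] into [c(s + j)], so
    it carries submodules to submodules. *)
Lemma gen_shift j u w : gen u w -> gen (shift j u) (shift j w).
Proof.
rewrite /shift; elim=> {w} [|w w' N _ IH e|w w' _ IH _ IH'|c w _ IH|i w _ IH|i w _ IH].
- exact: gen_base.
- by apply: (gen_ev (N := (N + `|j|)%N) IH) => m lem; apply: e; lia.
- exact: gen_add.
- apply: (gen_ev (N := `|j|%N) (gen_scale (c \Po ('X + (j%:~R)%:P)) IH)) => m lem.
  rewrite horner_comp !hornerE; congr (_.[_] *: _).
  have e : `|(m%:Z + j)%R|%N%:Z = m%:Z + j by lia.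
  by rewrite !pmulrn e intrD.
- exact: gen_mulX.
- exact: gen_deriv.
Qed.

(** Membership in the submodule after extending scalars from [K[s]] to [K(s)]. *)
Definition sat u w := exists2 c, c != 0 & gen u (fun m => c.[m%:R] *: w m).

Section Sat.
Variable u : nat -> R.

Lemma sat_gen w : gen u w -> sat u w.
Proof.
by exists 1; rewrite ?oner_eq0 //; apply: gen_eq H _ => m; rewrite hornerC scale1r.
Qed.

Lemma sat_ev w w' N : sat u w -> (forall m, (N <= m)%N -> w m = w' m) -> sat u w'.
Proof.
by move=> [c nzc gw] e; exists c => //; apply: (gen_ev (N := N) gw) => m /e ->.
Qed.

Lemma sat_eq w w' : sat u w -> w =1 w' -> sat u w'.
Proof. by move=> sw e; apply: (sat_ev (N := 0) sw) => m _. Qed.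

Lemma sat_add w w' : sat u w -> sat u w' -> sat u (fun m => w m + w' m).
Proof.
move=> [c nzc gw] [c' nzc' gw']; exists (c * c'); first by rewrite mulf_neq0.
apply: gen_eq (gen_add (gen_scale c' gw) (gen_scale c gw')) _ => m.
by rewrite hornerM scalerDr !scalerA [c'.[_] * _]mulrC.
Qed.

Lemma sat_scale c w : sat u w -> sat u (fun m => c.[m%:R] *: w m).
Proof.
move=> [c' nzc gw]; exists c' => //; apply: gen_eq (gen_scale c gw) _ => m.
by rewrite !scalerA mulrC.
Qed.

Lemma sat_div c w : c != 0 -> sat u (fun m => c.[m%:R] *: w m) -> sat u w.
Proof.
move=> nzc [c' nzc' gw]; exists (c' * c); first by rewrite mulf_neq0.
by apply: gen_eq gw _ => m; rewrite hornerM scalerA.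
Qed.

Lemma sat_deriv i w : sat u w -> sat u (fun m => (w m)^`M(i)).
Proof.
move=> [c nzc gw]; exists c => //; apply: gen_eq (gen_deriv i gw) _ => m.
by rewrite mderivZ.
Qed.

Lemma sat_mulX i w : sat u w -> sat u (fun m => 'X_i * w m).
Proof.
move=> [c nzc gw]; exists c => //; apply: gen_eq (gen_mulX i gw) _ => m.
by rewrite scalerAr.
Qed.

Lemma sat_op (lam : symb) w : sat u w -> sat u (fun m => op lam m (w m)).
Proof.
move=> [c nzc gw]; exists c => //; apply: gen_eq (gen_op lam gw) _ => m.
by rewrite op_pZ.
Qed.

Lemma sat_zero : sat u (fun=> 0).
Proof. exact/sat_gen/gen_zero. Qed.

Lemma sat_opp w : sat u w -> sat u (fun m => - w m).
Proof.
by move=> /(sat_scale (-1)%:P) gw; apply: sat_eq gw _ => m; rewrite hornerC scaleN1r.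
Qed.

Lemma sat_sub w w' : sat u w -> sat u w' -> sat u (fun m => w m - w' m).
Proof. by move=> sw /sat_opp; apply: sat_add. Qed.

Lemma sat_sum (I : Type) (r : seq I) (P : pred I) (F : I -> nat -> R) :
  (forall i, P i -> sat u (F i)) -> sat u (fun m => \sum_(i <- r | P i) F i m).
Proof.
move=> gF; elim: r => [|i r IHr].
  by apply: sat_eq sat_zero _ => m; rewrite big_nil.
have [Pi|nPi] := boolP (P i); last first.
  by apply: sat_eq IHr _ => m; rewrite big_cons (negPf nPi).
by apply: sat_eq (sat_add (gF i Pi) IHr) _ => m; rewrite big_cons Pi.
Qed.

End Sat.

End Gen.

(* Bernstein's inequality for the module generated by v modulo sat u, after Joseph:
   if an operator kills a filtered piece, then its commutators with the x_i and d_i,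
   of smaller degree, kill the previous piece; hence operators of degree < d inject
   into the linear maps from the d-th piece to the 2d-th. *)
Section Bernstein.
Variables (K : fieldType) (charK : [pchar K] =i pred0) (n : nat).
Local Notation R := {mpoly K[n]}.
Local Notation symb := {mpoly {poly K}[n + n]}.
Local Notation bm k := (bmultinom (n + n) k).
Variables u v : nat -> R.
Hypothesis nv : ~ sat u v.

(** With [spanning], this describes bases over [K(s)] of the piece of degree less than [k] of the
    module generated by [v] modulo [sat u]; denominators are cleared so that only [K[s]] occurs. *)
Definition indep k (S : {set bm k}) : Prop := forall a : bm k -> {poly K},
  sat u (fun m => \sum_(M in S) (a M).[m%:R] *: opm M (v m)) ->
  forall M, M \in S -> a M = 0.

Definition spanning k (S : {set bm k}) : Prop :=
  exists2 c : {poly K}, c != 0 & forall M : bm k, exists a : bm k -> {poly K},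
  sat u (fun m => c.[m%:R] *: opm M (v m) - \sum_(M' in S) (a M').[m%:R] *: opm M' (v m)).

Lemma basis_exists k : exists2 S : {set bm k}, indep S & spanning S.
Proof.
have [S /maxsetP[/asboolP indS maxS] _] : {S : {set bm k} |
    maxset (fun S => `[< indep S >]) S & set0 \subset S}.
  by apply: maxset_exists; apply/asboolP => a _ M; rewrite inE.
exists S => //.
have dep (M : bm k) : exists2 c : {poly K}, c != 0 & exists a : bm k -> {poly K},
    sat u (fun m => c.[m%:R] *: opm M (v m) -
                    \sum_(M' in S) (a M').[m%:R] *: opm M' (v m)).
  have [MS|nMS] := boolP (M \in S).
    exists 1; first exact: oner_neq0.
    exists (fun M' => (M' == M)%:R); apply: sat_eq (sat_zero u) _ => m.
    rewrite (bigD1 M) //= eqxx hornerC scale1r big1 ?addr0 ?subrr // => M' /andP[_ /negPf ->].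
    by rewrite horner0 scale0r.
  have nind : ~ indep (M |: S).
    move=> ind; move: nMS; rewrite -(maxS (M |: S)) ?subsetUr //; last exact/asboolP.
    by rewrite setU11.
  have [a [sa [M' [M'S nza]]]] : exists a : bm k -> {poly K},
      sat u (fun m => \sum_(M' in M |: S) (a M').[m%:R] *: opm M' (v m)) /\
      exists M', M' \in M |: S /\ a M' != 0.
    apply: contrapT => h; apply: nind => a sa M' M'S; apply/eqP/negPn/negP => nz.
    by apply: h; exists a; split=> //; exists M'.
  exists (a M); last first.
    exists (fun M' => - a M'); apply: sat_eq sa _ => m; rewrite big_setU1 //= -sumrN.
    by congr (_ + _); apply: eq_bigr => M'' _; rewrite hornerN scaleNr opprK.
  apply: contraNneq nza => aM0.
  move: M'S; rewrite !inE => /orP[/eqP ->|M'S]; first by rewrite aM0.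
  apply/eqP; apply: indS M'S; apply: sat_eq sa _ => m.
  by rewrite big_setU1 //= aM0 horner0 scale0r add0r.
have [c hc] := choice (fun M => let: ex_intro2 c nz h := dep M in ex_intro _ c (conj nz h)).
exists (\prod_M c M) => [|M].
  by apply/prodf_neq0 => M _; case: (hc M).
have [nzc [a sa]] := hc M.
exists (fun M' => (\prod_(M0 | M0 != M) c M0) * a M').
apply: sat_eq (sat_scale (\prod_(M0 | M0 != M) c M0) sa) _ => m.
rewrite [in RHS](bigD1 M) //= [c M * _]mulrC scalerBr scalerA -hornerM; congr (_ - _).
by rewrite scaler_sumr; apply: eq_bigr => M' _; rewrite hornerM scalerA.
Qed.

Lemma spanning_op k (S : {set bm k}) : spanning S ->
  exists2 c : {poly K}, c != 0 & forall mu : symb, (msize mu <= k)%N ->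
    exists a : bm k -> {poly K},
    sat u (fun m => c.[m%:R] *: op mu m (v m) -
                    \sum_(M in S) (a M).[m%:R] *: opm M (v m)).
Proof.
move=> [c nzc /choice[a sa]]; exists c => // mu szmu.
exists (fun M' => \sum_(M : bm k) mu@_M * a M M').
have ss : sat u (fun m => \sum_(M : bm k) (mu@_M).[m%:R] *:
    (c.[m%:R] *: opm M (v m) - \sum_(M' in S) (a M M').[m%:R] *: opm M' (v m))).
  by apply: sat_sum => M _; apply: sat_scale.
apply: sat_eq ss _ => m.
rewrite (opwE _ _ szmu) scaler_sumr.
under eq_bigr do rewrite scalerBr; rewrite sumrB; congr (_ - _).
  by apply: eq_bigr => M _; rewrite !scalerA mulrC.
under eq_bigr do rewrite scaler_sumr; rewrite exchange_big /=.
apply: eq_bigr => M' _; rewrite horner_sum scaler_suml.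
by apply: eq_bigr => M _; rewrite hornerM scalerA.
Qed.

Lemma mpoly_const_or_deriv (S : idomainType) (k : nat) (q : {mpoly S[k]}) :
  (forall i, i.+1%:R != 0 :> S) -> (1 < msize q)%N -> exists i, q^`M(i) != 0.
Proof.
move=> charS szq; have nzq : q != 0 by apply: contraTneq szq => ->; rewrite msize0.
have : mlead q != 0%MM.
  by rewrite -mdeg_eq0; rewrite -mlead_deg // in szq; lia.
move=> /mnm_neq0P[i mi]; exists i; apply/eqP => /(congr1 (mcoeff (mlead q - U_(i))%MM)).
rewrite mcoeff_deriv mcoeff0 submK ?lep1mP -?lt0n // => /eqP.
by rewrite -mulr_natr mulf_eq0 mleadc_eq0 (negPf nzq) (negPf (charS _)).
Qed.

Lemma natpK_neq0 i : i.+1%:R != 0 :> {poly K}.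
Proof.
by rewrite -polyC_natr polyC_eq0 ((pcharf0P _).1 charK).
Qed.

Lemma no_annihilator k (lam : symb) : lam != 0 -> (msize lam <= k)%N ->
  ~ (forall mu : symb, (msize mu <= k)%N -> sat u (fun m => op lam m (op mu m (v m)))).
Proof.
elim: k lam => [|k IHk] lam nzl szl ann; first by rewrite leqn0 msize_poly_eq0 (negPf nzl) in szl.
have [le1|gt1] := leqP (msize lam) 1.
  (* A nonzero constant that annihilates [v] puts [v] in [sat u]. *)
  have e := msize1_polyC le1; have nzc : lam@_0 != 0.
    by apply: contra nzl => /eqP e0; rewrite e e0.
  apply: nv; apply: (sat_div nzc).
  have sz1 : (msize (1%:MP : symb) <= k.+1)%N by rewrite msizeC oner_eq0.
  by apply: sat_eq (ann _ sz1) _ => m; rewrite opC hornerC scale1r e opC mcoeffC eqxx mulr1.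
have [i nzi] := mpoly_const_or_deriv natpK_neq0 gt1.
have szi : (msize lam^`M(i) <= k)%N by have := msize_deriv_le i lam; lia.
apply: IHk nzi szi _ => mu szmu; rewrite -[i]splitK.
have [j _|j _] := splitP i; rewrite /unsplit.
  (* This is the symbol of [d_j] composed with [mu]; comparing [d_j lam mu] with [lam d_j mu] leaves
     the derivative of [lam] in [x_j], applied to [mu]. *)
  have sz' : (msize ('X_(rshift n j) * mu + mu^`M(lshift n j))%R <= k.+1)%N.
    apply: leq_trans (msizeD_le _ _) _; rewrite geq_max.
    rewrite (leq_trans (msize_mulX_le _ _)) //=.
    by have := msize_deriv_le (lshift n j) mu; lia.
  have sz1 := leq_trans szmu (leqnSn k).
  apply: sat_eq (sat_sub (sat_deriv j (ann _ sz1)) (ann _ sz')) _ => m.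
  by rewrite deriv_op opD -op_deriv [op lam m (_ + _)]op_pD deriv_op op_pD addrC addKr.
have sz' : (msize ('X_(lshift n j) * mu)%R <= k.+1)%N.
  by rewrite (leq_trans (msize_mulX_le _ _)).
have sz1 := leq_trans szmu (leqnSn k).
apply: sat_eq (sat_sub (ann _ sz') (sat_mulX j (ann _ sz1))) _ => m.
by rewrite -mulX_op op_mulX addrC addKr.
Qed.

Lemma bernstein_inequality d (S : {set bm d}) (S' : {set bm (d + d)}) :
  spanning S -> spanning S' -> (#|{: bm d}| <= #|S| * #|S'|)%N.
Proof.
move=> spS /spanning_op[c' nzc' spS']; rewrite leqNgt -cardsX -cardsT; apply/negP => ltc.
have hA (Ts : bm d * bm d) : exists a : bm (d + d) -> {poly K},
    sat u (fun m => c'.[m%:R] *: opm Ts.1 (opm Ts.2 (v m)) -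
                    \sum_(M in S') (a M).[m%:R] *: opm M (v m)).
  have [mu szmu mu_op] := opm_op Ts.1 ('X_[Ts.2] : symb).
  have [|a sa] := spS' mu.
    apply: leq_trans szmu _; rewrite msizeX.
    by have := bmdeg Ts.1; have := bmdeg Ts.2; lia.
  by exists a; apply: sat_eq sa _ => m; rewrite -mu_op opX.
have [A sA] := choice hA.
(* There are more monomials [T] than matrix entries indexed by [S] and [S'], so some nonzero
   combination [lam] sends every element of [S] to zero modulo [sat u]. *)
have [l [[T0 _ nzT0] _ lA]] :=
  dependent (fun (T : bm d) (sM : bm d * bm (d + d)) => A (T, sM.1) sM.2) ltc.
pose lam : symb := \sum_(T : bm d) l T *: 'X_[T].
have lamE T : lam@_(T : bm d) = l T.
  rewrite /lam raddf_sum /= (bigD1 T) //= mcoeffZ mcoeffX eqxx mulr1 big1 ?addr0 // => T' nT.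
  by rewrite mcoeffZ mcoeffX -bmeqP (negPf nT) mulr0.
have nzlam : lam != 0.
  by apply: contra nzT0 => /eqP lam0; rewrite -lamE lam0 mcoeff0.
have szlam : (msize lam <= d)%N.
  apply: leq_trans (msize_sum _ _ _) _; apply/bigmax_leqP => T _.
  by apply: leq_trans (msizeZ_le _ _) _; rewrite msizeX bmdeg.
have lam_op m p : op lam m p = \sum_(T : bm d) (l T).[m%:R] *: opm T p.
  by rewrite /lam op_sum; apply: eq_bigr => T _; rewrite opZ opX.
have annS (s : bm d) : s \in S -> sat u (fun m => op lam m (opm s (v m))).
  move=> Ss; apply: (sat_div nzc').
  have sT : sat u (fun m => \sum_(T : bm d) (l T).[m%:R] *:
      (c'.[m%:R] *: opm T (opm s (v m)) -
       \sum_(M in S') (A (T, s) M).[m%:R] *: opm M (v m))).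
    by apply: sat_sum => T _; apply: sat_scale; exact: (sA (T, s)).
  apply: sat_eq sT _ => m.
  under eq_bigr do rewrite scalerBr; rewrite sumrB [X in _ - X](_ : _ = 0) ?subr0.
    by rewrite lam_op scaler_sumr; apply: eq_bigr => T _; rewrite !scalerA mulrC.
  under eq_bigr do rewrite scaler_sumr; rewrite exchange_big /= big1 // => M MS'.
  have := lA (s, M); rewrite inE /= Ss MS' => /(_ isT) e0.
  transitivity ((\sum_T l T * A (T, s) M).[m%:R] *: opm M (v m)).
    rewrite horner_sum scaler_suml; apply: eq_bigr => T _.
    by rewrite hornerM scalerA.
  by rewrite e0 horner0 scale0r.
have [c nzc spS2] := spanning_op spS.
(* Up to the factor [c], [S] spans the whole piece, so [lam] kills it. *)
apply: (no_annihilator nzlam szlam) => mu szmu; apply: (sat_div nzc).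
have [a sa] := spS2 mu szmu.
have s1 := sat_op lam sa.
have s2 : sat u (fun m => \sum_(M in S) (a M).[m%:R] *: op lam m (opm M (v m))).
  by apply: sat_sum => M MS; apply/sat_scale/annS.
apply: sat_eq (sat_add s1 s2) _ => m.
rewrite op_pB op_pZ -addrA -[RHS]addr0; congr (_ + _).
rewrite addrC; apply/eqP; rewrite subr_eq0 op_p_sum; apply/eqP; apply: eq_bigr => M _.
by rewrite op_pZ.
Qed.

End Bernstein.

(** * Existence of the Bernstein polynomial *)

Lemma card_bmultinom_le n k : (#|{: bmultinom n k}| <= k ^ n)%N.
Proof.
case: k => [|k]; first by rewrite eq_card0 // => m; have := bmdeg m.
have -> : (k.+1 ^ n = #|{: {ffun 'I_n -> 'I_k.+1}}|)%N by rewrite card_ffun !card_ord.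
have ltk (m : bmultinom n k.+1) i : (m i < k.+1)%N.
  by apply: leq_ltn_trans (bmdeg m); rewrite mdegE (bigD1 i) //= leq_addr.
pose F (m : bmultinom n k.+1) : {ffun 'I_n -> 'I_k.+1} := [ffun i => inord (m i)].
suff injF : injective F by exact: leq_card injF.
move=> m m' e; apply/val_inj/mnmP => i.
have := congr1 (fun f : {ffun 'I_n -> 'I_k.+1} => val (f i)) e.
by rewrite !ffunE /= !inordK.
Qed.

(** The monomials with all exponents less than [k] already number [k ^ n]. *)
Lemma card_bmultinom_ge n k d : (0 < k -> n.+1 * k <= d -> k ^ n <= #|{: bmultinom n d}|)%N.
Proof.
move=> k0 led.
have -> : (k ^ n = #|{: {ffun 'I_n -> 'I_k}}|)%N by rewrite card_ffun !card_ord.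
have ltd (f : {ffun 'I_n -> 'I_k}) : (mdeg [multinom (f i : nat) | i < n] < d)%N.
  apply: leq_trans led; rewrite mdegE mulSn -[X in (_ < _ + X)%N]card_ord.
  apply: leq_ltn_trans (_ : n * k < _)%N; last by rewrite card_ord; lia.
  rewrite -[X in (_ <= X * _)%N]card_ord -sum_nat_const; apply: leq_sum => i _.
  by rewrite mnmE ltnW.
pose F (f : {ffun 'I_n -> 'I_k}) : bmultinom n d := BMultinom (ltd f).
suff injF : injective F by exact: leq_card injF.
move=> f f' e; apply/ffunP => i; apply/val_inj.
by have := congr1 (fun m : bmultinom n d => m i) e; rewrite /= !mnmE.
Qed.

Section BernsteinPolynomial.
Variables (K : fieldType) (n : nat).
Local Notation R := {mpoly K[n]}.
Local Notation Rs := {mpoly {poly K}[n]}.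
Variables g h : R.
Implicit Types (q : Rs) (w : nat -> R).

(* g h^(s+k); the absolute value only matters for the finitely many m < -k *)
Definition gh (k : int) : nat -> R := fun m => g * h ^+ `|(m%:Z + k)%R|%N.

Lemma gen_gh_shift k j w : gen (gh k) w -> gen (gh (k + j)) (shift j w).
Proof.
move=> /(gen_shift j); apply: gen_trans.
apply: (gen_ev (N := `|j|%N) (gen_base _)) => m lem.
by rewrite /gh /shift; congr (_ * _ ^+ _); lia.
Qed.

Lemma gen_gh_succ k : gen (gh k) (gh (k + 1)).
Proof.
apply: (gen_ev (N := `|k|%N) (gen_mulp h (gen_base _))) => m lem; rewrite /gh.
have -> : `|(m%:Z + (k + 1))%R|%N = `|(m%:Z + k)%R|%N.+1 by lia.
by rewrite exprS mulrCA.
Qed.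

Lemma gen_gh_add k (j : nat) : gen (gh k) (gh (k + j%:Z)).
Proof.
elim: j => [|j IHj]; first by rewrite addr0; apply: gen_base.
by apply: gen_trans IHj _; rewrite -addn1 PoszD addrA; apply: gen_gh_succ.
Qed.

Lemma gen_gh_le k k' : (k <= k')%R -> gen (gh k) (gh k').
Proof.
move=> lek; have -> : k' = k + `|(k' - k)%R|%N%:Z by lia.
exact: gen_gh_add.
Qed.

Definition evs (m : nat) q : R := map_mpoly (horner_eval (m%:R : K)) q.

Lemma evs_deriv m q i : (evs m q)^`M(i) = evs m q^`M(i).
Proof.
by apply/mpolyP => a; rewrite !(mcoeff_map_mpoly, mcoeff_deriv) /= raddfMn.
Qed.

Lemma evsZ m (c : {poly K}) q : evs m (c *: q) = c.[m%:R] *: evs m q.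
Proof. exact: map_mpolyZ. Qed.

Lemma evsM m q r : evs m (q * r) = evs m q * evs m r.
Proof. exact: rmorphM. Qed.

Lemma evsD m q r : evs m (q + r) = evs m q + evs m r.
Proof. exact: raddfD. Qed.

Lemma evs_sum m (I : Type) (r : seq I) (F : I -> Rs) :
  evs m (\sum_(i <- r) F i) = \sum_(i <- r) evs m (F i).
Proof. exact: raddf_sum. Qed.

Lemma evs0 m : evs m 0 = 0.
Proof. exact: raddf0. Qed.

Definition cst (p : R) : Rs := map_mpoly polyC p.

Lemma msize_cst p : (msize (cst p) <= msize p)%N.
Proof.
rewrite [leqLHS]msizeE; apply/bigmax_leqP_seq => M; rewrite mcoeff_msupp mcoeff_map_mpoly => nz _.
by apply: msize_mdeg_lt; rewrite mcoeff_msupp; apply: contraNneq nz => ->; rewrite raddf0.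
Qed.

Lemma evs_cst m p : evs m (cst p) = p.
Proof.
by apply/mpolyP => a; rewrite !mcoeff_map_mpoly /= /horner_eval hornerC.
Qed.

(** The germ is [q h^(s - c)] with [q] over [K[s]] of degree less than [D] in [x]. Only the degree
    in [x] is bounded, as ranks are taken over [K[s]]. *)
Definition adm (c D : nat) w : Prop :=
  exists2 q, (msize q <= D)%N & forall m, (c <= m)%N -> w m = evs m q * h ^+ (m - c).

Lemma adm_le c D D' w : (D <= D')%N -> adm c D w -> adm c D' w.
Proof. by move=> le [q szq hq]; exists q => //; apply: leq_trans le. Qed.

Lemma adm_h c D w : adm c D w -> adm c.+1 (D + msize h) w.
Proof.
move=> [q szq hq]; exists (q * cst h).
  apply: leq_trans (msizeM_leq _ _) _.
  exact: leq_trans (leq_pred _) (leq_add szq (msize_cst h)).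
move=> m lem; rewrite hq ?(ltnW lem) // evsM evs_cst -mulrA -exprS.
by congr (_ * _ ^+ _); lia.
Qed.

Lemma adm_X i c D w : adm c D w -> adm c D.+1 (fun m => 'X_i * w m).
Proof.
move=> [q szq hq]; exists ('X_i * q).
  by apply: leq_trans (msize_mulX_le _ _) _.
by move=> m lem; rewrite hq // evsM [evs m 'X_i]map_mpolyX mulrA.
Qed.

Lemma adm_deriv i c D w : adm c D w -> adm c.+1 (D + msize h) (fun m => (w m)^`M(i)).
Proof.
move=> [q szq hq].
exists (q^`M(i) * cst h + ('X - c%:R%:P) *: (q * (cst h)^`M(i))).
  have szh := msize_cst h.
  apply: leq_trans (msizeD_le _ _) _; rewrite geq_max; apply/andP; split.
    apply: leq_trans (msizeM_leq _ _) _; apply: leq_trans (leq_pred _) _.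
    apply: leq_add szh; apply: leq_trans (msize_deriv_le _ _) _.
    exact: leq_trans (leq_pred _) szq.
  apply: leq_trans (msizeZ_le _ _) _; apply: leq_trans (msizeM_leq _ _) _.
  apply: leq_trans (leq_pred _) (leq_add szq _).
  apply: leq_trans (msize_deriv_le _ _) _; exact: leq_trans (leq_pred _) szh.
move=> m lem; rewrite hq ?(ltnW lem) //.
have -> : (m - c = (m - c.+1).+1)%N by lia.
rewrite mderivM (leibniz_exp (mderivM i)) evs_deriv evsD evsM evs_cst evsZ evsM.
rewrite -[evs m (cst h)^`M(i)]evs_deriv evs_cst.
rewrite !hornerE -natrB ?(ltnW lem) // mulrDl exprS mulrA; congr (_ + _).
have -> : (m - c = (m - c.+1).+1)%N by lia.
by rewrite scaler_nat mulrnAr mulrnAl mulrA mulrAC.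
Qed.

Lemma adm_opm k M c D w : (mdeg M <= k)%N -> adm c D w ->
  adm (c + k) (D + k * (msize h).+1) (fun m => opm M (w m)).
Proof.
move=> lek aw.
have ad (b : 'X_{1..n}) : adm (c + mdeg b) (D + mdeg b * msize h) (fun m => (w m)^`M[b]).
  elim/mnm_ind: b => [|b i IHb].
    rewrite mdeg0 !addn0; case: aw => q szq hq; exists q => // m lem.
    by rewrite mderivm0m hq.
  rewrite mdegD mdeg1 addn1 addnS mulSn [(msize h + _)%N]addnC addnA.
  case: (adm_deriv i IHb) => q szq hq; exists q => // m lem.
  by rewrite mderivmDm mderivmU1m hq.
have ax (a : 'X_{1..n}) c' D' w' : adm c' D' w' -> adm c' (D' + mdeg a) (fun m => 'X_[a] * w' m).
  move=> aw'; elim/mnm_ind: a => [|a i IHa].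
    rewrite mdeg0 addn0; case: aw' => q szq hq; exists q => // m lem.
    by rewrite mpolyX0 mul1r hq.
  rewrite mdegD mdeg1 addn1 addnS.
  case: (adm_X i IHa) => q szq hq; exists q => // m lem.
  by rewrite mpolyXD -hq // mulrCA mulrA.
(* Extra factors [h] bring all operators of degree at most [k] to the same denominator
   [h^(c + k)]. *)
have ah j c' D' w' : adm c' D' w' -> adm (c' + j) (D' + j * msize h) w'.
  move=> aw'; elim: j => [|j IHj]; first by rewrite !addn0.
  by rewrite addnS mulSn [(msize h + _)%N]addnC addnA; apply: adm_h.
move: lek; rewrite mdeg_parts => lek.
have := ah (k - mdeg (dpart M))%N _ _ _ (ax (xpart M) _ _ _ (ad (dpart M))).
have -> : (c + mdeg (dpart M) + (k - mdeg (dpart M)) = c + k)%N by lia.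
apply: adm_le; rewrite mulnS mulnBl -addnA -addnA leq_add2l.
have : (mdeg (dpart M) * msize h <= k * msize h)%N by rewrite leq_mul2r; lia.
by lia.
Qed.

Lemma adm_gh (j : nat) : adm 0 (msize g + j * msize h) (gh j%:Z).
Proof.
exists (cst (g * h ^+ j)) => [|m _]; last first.
  rewrite evs_cst /gh subn0 -mulrA -exprD; congr (_ * _ ^+ _); lia.
apply: leq_trans (msize_cst _) _.
have szX : (msize (h ^+ j) <= (j * msize h).+1)%N.
  elim: j => [|j IHj]; first by rewrite expr0 msize1.
  rewrite exprS; apply: leq_trans (msizeM_leq _ _) _; apply: leq_trans (leq_pred _) _.
  by apply: leq_trans (leq_add (leqnn _) IHj) _; rewrite addnS mulSn.
apply: leq_trans (msizeM_leq _ _) _; rewrite -subn1 leq_subLR add1n -addnS.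
exact: leq_add.
Qed.

Local Notation bm k := (bmultinom (n + n) k).

(** The [p * #|S|] germs [M (g h^(s + j))], with [j < p] and [M] in [S], are independent over
    [K[s]], because each step of the chain is a shift of the first one. All are [q h^(s - k)] with
    [q] of degree less than [D], and there are at most [D ^ n] monomials of such degree. *)
Lemma indep_card_le k p (S : {set bm k}) : indep (gh 1) (gh 0) S ->
  (p * #|S| <= (msize g + (p + k) * (msize h).+1) ^ n)%N.
Proof.
move=> indS; set D := (msize g + _)%N; apply: leq_trans (card_bmultinom_le n D).
rewrite leqNgt; apply/negP => ltc.
have admE (jM : 'I_p * bm k) : adm k D (fun m => opm jM.2 (gh (jM.1 : nat)%:Z m)).
  have := adm_opm (ltnW (bmdeg jM.2)) (adm_gh jM.1); rewrite add0n; apply: adm_le.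
  rewrite /D mulnDl addnA leq_add2r leq_add2l.
  by have := ltn_ord jM.1; rewrite mulnS => lt; have := leq_mul (ltnW lt) (leqnn (msize h)); lia.
have [q hq] := choice (fun jM => let: ex_intro2 q sz e := admE jM in ex_intro _ q (conj sz e)).
have : (#|[set: bmultinom n D]| < #|setX [set: 'I_p] S|)%N.
  by rewrite cardsX !cardsT card_ord.
move=> /(dependent (fun jM (m : bmultinom n D) => (q jM)@_m))[a [[j0 j0S nz] a0 aq]].
have qa0 : \sum_jM a jM *: q jM = 0.
  apply/mpolyP => m; rewrite mcoeff0 raddf_sum /=.
  have [ltm|gem] := ltnP (mdeg m) D.
    have := aq (BMultinom ltm); rewrite inE => /(_ isT) e0; rewrite -[RHS]e0.
    by apply: eq_bigr => jM _; rewrite mcoeffZ.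
  apply: big1 => jM _; rewrite mcoeffZ memN_msupp_eq0 ?mulr0 //.
  by apply: msize_mdeg_ge; apply: leq_trans gem; case: (hq jM).
have sum0 m : (k <= m)%N ->
    \sum_j \sum_(M in S) (a (j, M)).[m%:R] *: opm M (gh (j : nat)%:Z m) = 0.
  move=> lem; have := congr1 (evs m) qa0; rewrite evs_sum evs0 => e.
  transitivity ((\sum_jM evs m (a jM *: q jM)) * h ^+ (m - k)); last by rewrite e mul0r.
  rewrite mulr_suml pair_big_dep /= [RHS](bigID (fun jM => jM.2 \in S)) /=.
  rewrite [X in _ + X]big1 ?addr0 => [|jM nS].
    apply: eq_big => [[j M] //|[j M] _ /=]; rewrite evsZ -scalerAl.
    by have [_ /(_ m lem) /= ->] := hq (j, M).
  by rewrite a0 ?scale0r ?evs0 ?mul0r // inE /= (negPf nS) andbF.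
have all0 (j : 'I_p) M : M \in S -> a (j, M) = 0.
  (* Coefficients at indices below [j] vanish by induction, and terms above [j] lie in the submodule
     of [gh (j + 1)]. What remains, shifted by [-j], is a relation that the independence of [S]
     forces to be trivial. *)
  have [i] := ubnP j; elim: i j M => // i IHi j M ltj MS.
  pose b M' := a (j, M') \Po ('X - (j : nat)%:R%:P).
  suff /(congr1 (fun c => c \Po ('X + (j : nat)%:R%:P))) : b M = 0.
    rewrite /b -comp_polyA comp_polyB comp_polyX comp_polyC addrK comp_polyXr.
    by rewrite comp_poly0.
  apply: indS MS; apply: sat_gen.
  have gj : gen (gh (j%:Z + 1)) (fun m => \sum_(M' in S) (a (j, M')).[m%:R] *: opm M' (gh j%:Z m)).
    have grest : gen (gh (j%:Z + 1)) (fun m => - \sum_(j' : 'I_p | (j < j')%N)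
        \sum_(M' in S) (a (j', M')).[m%:R] *: opm M' (gh j'%:Z m)).
      apply/gen_opp/gen_sum => j' ltj'; apply: gen_sum => M' _; apply: gen_scale.
      by apply: gen_opm; apply: gen_gh_le; lia.
    apply: (gen_ev (N := k) grest) => m /sum0.
    rewrite (bigD1 j) //= (bigID (fun j' : 'I_p => (j < j')%N)) /= => e.
    apply/eqP; rewrite eq_sym -addr_eq0 -[X in _ == X]e; apply/eqP; congr (_ + _).
    rewrite [X in _ = _ + X]big1 ?addr0 => [|j' /andP[nj gj]].
      by apply: eq_bigl => j'; rewrite -val_eqE /=; lia.
    apply: big1 => M' M'S; rewrite IHi ?horner0 ?scale0r //.
    by move: nj gj; rewrite -val_eqE /=; lia.
  have := gen_gh_shift (- j%:Z) gj; rewrite addrAC subrr add0r => gs.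
  apply: (gen_ev (N := j) gs) => m lem; rewrite /shift /b; apply: eq_bigr => M' _.
  rewrite horner_comp !hornerE; congr (_.[_] *: opm _ _).
    have e : `|(m%:Z - j%:Z)%R|%N = (m - j)%N by lia.
    by rewrite e natrB.
  by rewrite /gh; congr (_ * _ ^+ _); lia.
move: nz; case: j0 j0S => j M; rewrite inE /= => /andP[_ MS].
by rewrite all0 ?eqxx.
Qed.

Lemma bernstein_polynomial_exists : [pchar K] =i pred0 -> sat (gh 1) (gh 0).
Proof.
move=> charK; apply: contrapT => nsat.
(* [C] makes [msize g + (d + 2d) (msize h + 1)] at most [C d]. The product of the two upper bounds
   then gives [d^2 (Z+1)^(2n) <= (C d)^(2n)], and the right side is [Z (Z+1)^(2n)] by the choice of
   [Z] and [d]; but [d > Z]. *)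
pose C := (msize g + 3 * (msize h).+1)%N.
pose Z := (C ^ (n + n) * (n + n).+1 ^ (n + n))%N.
pose d := ((n + n).+1 * Z.+1)%N.
have d0 : (0 < d)%N by rewrite muln_gt0.
have [S indS spS] := basis_exists (gh 1) (gh 0) d.
have [S' indS' spS'] := basis_exists (gh 1) (gh 0) (d + d).
have lower := leq_trans (card_bmultinom_ge (ltn0Sn Z) (leqnn d))
  (bernstein_inequality charK nsat spS spS').
have mono x y : (x <= y -> x ^ n <= y ^ n)%N.
  by move=> le; have [->|n0] := posnP n; rewrite ?expn0 // leq_exp2r.
have up1 : (d * #|S| <= (C * d) ^ n)%N.
  apply: leq_trans (indep_card_le d indS) _; apply: mono.
  rewrite /C; move: (msize g) (msize h).+1 d0 => x y; nia.
have up2 : (d * #|S'| <= (C * d) ^ n)%N.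
  apply: leq_trans (indep_card_le d indS') _; apply: mono.
  rewrite /C; move: (msize g) (msize h).+1 d0 => x y; nia.
have := leq_trans (leq_mul (leqnn (d * d)%N) lower) (leq_trans _ (leq_mul up1 up2)).
rewrite mulnACA leqnn => /(_ isT); rewrite -expnD /d -/d !expnMn mulnA -/Z.
rewrite leq_mul2r expn_eq0 /= leqNgt.
have ltZ : (Z < d)%N by rewrite /d leq_pmull.
by rewrite (leq_trans ltZ) ?leq_pmulr.
Qed.

End BernsteinPolynomial.

(** * Rationality of the Bernstein polynomial *)

Section PrimePolynomial.
Variables (K : fieldType) (pi : {poly K}).
Hypothesis pi_gt1 : (1 < size pi)%N.
Hypothesis pi_prime : forall x y : {poly K}, pi %| x * y -> pi %| x \/ pi %| y.
Implicit Types (x y : {poly K}) (B : {poly {poly K}}).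

Lemma prime_ndvdM x y : ~~ (pi %| x) -> ~~ (pi %| y) -> ~~ (pi %| x * y).
Proof. by move=> /negP nx /negP ny; apply/negP => /pi_prime[]. Qed.

Lemma prime_ndvdC (c : K) : c != 0 -> ~~ (pi %| c%:P).
Proof.
move=> nzc; apply/negP => /dvdp_leq; rewrite polyC_eq0 size_polyC nzc => /(_ isT).
by rewrite leqNgt pi_gt1.
Qed.

Lemma prime_factor x : x != 0 -> exists a y, x = pi ^+ a * y /\ ~~ (pi %| y).
Proof.
have [k] := ubnP (size x); elim: k x => // k IHk x ltx nzx.
have [/dvdpP[y e]|nd] := boolP (pi %| x); last by exists 0%N, x; rewrite mul1r.
have nzy : y != 0 by apply: contraNneq nzx => y0; rewrite e y0 mul0r.
have nzpi : pi != 0 by rewrite -size_poly_gt0; lia.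
have [||a [z [ez nz]]] := IHk y => //.
  move: ltx; rewrite e size_mul //; have := pi_gt1; case: (size pi) => [|[|s]] // _.
  by rewrite !addnS /= !ltnS; apply: leq_ltn_trans; apply: leq_addr.
by exists a.+1, z; rewrite e ez exprS; split=> //; ring.
Qed.

(** Modulo [pi], [B] is a nonzero polynomial over a domain, so only finitely many of the distinct
    constants [z k] are roots; each root is split off as a linear factor. *)
Lemma eventually_ndvd B (z : nat -> K) : injective z ->
    (exists i, ~~ (pi %| B`_i)) ->
  exists k0, forall k, (k0 <= k)%N -> ~~ (pi %| B.[(z k)%:P]).
Proof.
move=> zI; have [m] := ubnP (size B); elim: m B => // m IHm B ltB [i0 ni0].
have [none|] := pselect (forall k, ~~ (pi %| B.[(z k)%:P])).
  by exists 0%N => k _; apply: none.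
move=> /asboolPn/asboolP/existsNP[k1 /negP]; rewrite negbK => dk1.
set C := B.[_] in dk1.
have [Q eQ] : exists Q, B - C%:P = Q * ('X - (z k1)%:P%:P).
  by apply/factor_theorem; rewrite rootE hornerD hornerN hornerC subrr.
have eB : B = Q * ('X - (z k1)%:P%:P) + C%:P by rewrite -eQ subrK.
have [Q0|nzQ] := eqVneq Q 0.
  move: ni0; rewrite eB Q0 mul0r add0r coefC; case: eqP => _; last by rewrite dvdp0.
  by rewrite dk1.
have ltQ : (size Q < size B)%N.
  have szB : size (B - C%:P) = (size Q).+1.
    by rewrite eQ size_Mmonic ?monicXsubC // size_XsubC addn2.
  have : (size (B - C%:P)%R <= maxn (size B) (size C%:P))%N.
    by rewrite -(size_polyN C%:P) size_polyD.
  rewrite szB size_polyC leq_max => /orP[//|]; have := nzQ; rewrite -size_poly_gt0.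
  by case: (size Q) => // s _; case: (C != 0).
have [||k2 hk2] := IHm Q; first exact: leq_trans ltQ ltB.
  apply: contrapT => nQ; move: ni0; apply/negP; rewrite negbK.
  have dQ i : pi %| Q`_i by apply/negPn/negP => ni; apply: nQ; exists i.
  rewrite eB mulrBr coefD coefB coefMX coefMC coefC.
  rewrite dvdp_add ?dvdp_sub //; [|exact: dvdp_mulr|].
    by case: eqP => // _; rewrite dvdp0.
  by case: eqP => // _; rewrite dvdp0.
exists (maxn k1.+1 k2) => k; rewrite geq_max => /andP[k1k /hk2 ndk].
rewrite eB !hornerE dvdp_addl //; apply: prime_ndvdM => //.
rewrite -polyCB; apply: prime_ndvdC; rewrite subr_eq0.
by apply/eqP => /zI e; move: k1k; rewrite e ltnn.
Qed.

(** Taylor expansion makes [b(s + T)] a polynomial in [T] whose leading coefficient is the nonzero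
    constant [lead_coef b]. *)
Lemma eventually_ndvd_shift (b : {poly K}) (z : nat -> K) : injective z ->
  b != 0 -> exists k0, forall k, (k0 <= k)%N -> ~~ (pi %| b \Po ('X + (z k)%:P)).
Proof.
move=> zI nzb; pose B := \poly_(i < size b) b^`N(i).
have [|k0 hk0] := @eventually_ndvd B z zI.
  exists (size b).-1; rewrite coef_poly prednK ?size_poly_gt0 // leqnn.
  have -> : b^`N((size b).-1) = (lead_coef b)%:P.
    apply/polyP => i; rewrite coef_nderivn coefC; case: eqP => [->|ni].
      by rewrite addn0 binn -lead_coefE.
    case: i ni => // i _; rewrite nth_default ?mul0rn //.
    by rewrite addnS -addSn prednK ?size_poly_gt0 // leq_addr.
  by apply: prime_ndvdC; rewrite lead_coef_eq0.
exists k0 => k /hk0; congr (~~ (_ %| _)).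
rewrite /comp_poly nderiv_taylor ?size_map_polyC; last exact: mulrC.
rewrite horner_poly; apply: eq_bigr => i _; rewrite nderivn_map.
by rewrite -[_.['X]]/(_ \Po 'X) comp_polyXr.
Qed.

End PrimePolynomial.

(** * Derivations of the field acting on coefficients *)

Section DerivationOnPolynomials.
Variables (K : fieldType) (d : {additive K -> K}).
Hypothesis dM : forall x y, d (x * y) = d x * y + x * d y.

Lemma deriv1 : d 1 = 0.
Proof. by apply: (@addIr _ (d 1)); rewrite add0r -{3}[1]mulr1 dM mulr1 mul1r. Qed.

Lemma deriv_nat m : d m%:R = 0.
Proof. by rewrite raddfMn deriv1 mul0rn. Qed.

Definition pderiv (c : {poly K}) : {poly K} := map_poly d c.

Lemma pderivD c c' : pderiv (c + c') = pderiv c + pderiv c'.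
Proof. exact: raddfD. Qed.

Lemma pderivX : pderiv 'X = 0.
Proof. by apply/polyP => i; rewrite coef_map coefX coef0 deriv_nat. Qed.

Lemma pderivM c c' : pderiv (c * c') = pderiv c * c' + c * pderiv c'.
Proof.
apply/polyP => i; rewrite coef_map coefD !coefM raddf_sum -big_split.
by apply: eq_bigr => j _; rewrite !coef_map dM.
Qed.

Lemma pderiv_horner c m : d c.[m%:R] = (pderiv c).[m%:R].
Proof.
elim/poly_ind: c => [|c a IHc]; first by rewrite /pderiv raddf0 !horner0 raddf0.
rewrite pderivD pderivM pderivX mulr0 addr0 !hornerMXaddC raddfD dM deriv_nat mulr0 addr0.
by rewrite !hornerE IHc /pderiv map_polyC hornerC.
Qed.

End DerivationOnPolynomials.

Lemma addn_pred_leq (x y : nat) : (0 < x -> 0 < y -> (x + y).-1 <= x -> y = 1)%N.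
Proof. by lia. Qed.

Section PrimeFactor.
Variables (K : fieldType) (d : {additive K -> K}).
Hypothesis dM : forall x y, d (x * y) = d x * y + x * d y.

(* A monic factor of least degree among those with nonzero derivative is prime. *)
Lemma nonconstant_prime_factor (b : {poly K}) : b \is monic -> pderiv d b != 0 ->
  exists pi : {poly K}, [/\ pi \is monic, pi %| b, pderiv d pi != 0, (1 < size pi)%N &
    forall x y : {poly K}, pi %| x * y -> pi %| x \/ pi %| y].
Proof.
move=> monb nzb.
pose P k := `[< exists pi : {poly K},
  [/\ pi \is monic, pi %| b, pderiv d pi != 0 & size pi = k] >].
have exP : exists k, P k by exists (size b); apply/asboolP; exists b.
case: (ex_minnP exP) => k /asboolP[pi [monpi dpi nzpi szpi]] kmin.
have gt1 : (1 < size pi)%N.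
  rewrite ltnNge; apply: contra nzpi => le1; move: (size1_polyC le1) monpi => ->.
  rewrite monicE lead_coefC => /eqP ->.
  by rewrite /pderiv map_polyC /= (deriv1 dM).
exists pi; split=> // x y dxy.
have [|nx] := boolP (pi %| x); [by left|right].
suff cop : coprimep pi x by rewrite Gauss_dvdpr in dxy.
(* By the Leibniz rule, the monic gcd [t] of [pi] and [x] or its cofactor [s] has nonzero
   derivative; by minimality that factor has the degree of [pi]. *)
pose t0 := gcdp pi x; have nzt0 : t0 != 0.
  by rewrite gcdp_eq0 negb_and monic_neq0.
pose t := (lead_coef t0)^-1 *: t0.
have tt0 : t %= t0 by rewrite eqp_scale // invr_eq0 lead_coef_eq0.
have mont : t \is monic by rewrite monicE lead_coefZ mulVf // lead_coef_eq0.
have dvdt : t %| pi by rewrite (eqp_dvdl _ tt0) dvdp_gcdl.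
have /dvdpP[s es] := dvdt.
have mons : s \is monic by move: monpi; rewrite es monicMr.
have szst : (size pi = (size s + size t).-1)%N by rewrite es size_Mmonic // monic_neq0.
have szs0 : (0 < size s)%N by rewrite size_poly_gt0 monic_neq0.
have szt0 : (0 < size t)%N by rewrite size_poly_gt0 monic_neq0.
have [dt0|ndt] := eqVneq (pderiv d t) 0.
  have ds : pderiv d s != 0.
    by apply: contraNneq nzpi => ds0; rewrite es (pderivM dM) ds0 dt0 mul0r mulr0 addr0.
  have : (k <= size s)%N.
    apply: kmin; apply/asboolP; exists s; split=> //.
    by apply: dvdp_trans dpi; rewrite es dvdp_mulr.
  rewrite -szpi szst => les.
  by rewrite coprimep_def -(eqp_size tt0); apply/eqP; apply: addn_pred_leq les.
have : (k <= size t)%N.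
  by apply: kmin; apply/asboolP; exists t; split=> //; apply: dvdp_trans dpi.
rewrite -szpi => letsz; case/negP: nx.
have : t %= pi by rewrite -(dvdp_size_eqp dvdt) eqn_leq letsz dvdp_leq ?monic_neq0.
move=> /eqp_dvdl <-; rewrite (eqp_dvdl _ tt0); exact: dvdp_gcdr.
Qed.

End PrimeFactor.

Section DerivationOnSequences.
Variables (K : fieldType) (n : nat) (d : {additive K -> K}).
Hypothesis dM : forall x y, d (x * y) = d x * y + x * d y.
Local Notation R := {mpoly K[n]}.
Implicit Types (p q : R) (u v w : nat -> R).

Definition mderivation p : R := map_mpoly d p.

Lemma mderivationD p q : mderivation (p + q) = mderivation p + mderivation q.
Proof. exact: raddfD. Qed.

Lemma mderivationM p q : mderivation (p * q) = mderivation p * q + p * mderivation q.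
Proof.
apply/mpolyP => a; rewrite mcoeffD mcoeff_map_mpoly !mcoeffM raddf_sum -big_split.
by apply: eq_bigr => k _; rewrite !mcoeff_map_mpoly dM.
Qed.

Lemma mderivationZ (c : K) p : mderivation (c *: p) = d c *: p + c *: mderivation p.
Proof.
by apply/mpolyP => a; rewrite mcoeffD !mcoeffZ !mcoeff_map_mpoly !mcoeffZ dM.
Qed.

Lemma mderivationX i : mderivation 'X_i = 0.
Proof. by apply/mpolyP => a; rewrite mcoeff_map_mpoly mcoeffX mcoeff0 (deriv_nat dM). Qed.

Lemma mderivation_deriv i p : mderivation p^`M(i) = (mderivation p)^`M(i).
Proof.
by apply/mpolyP => a; rewrite !(mcoeff_map_mpoly, mcoeff_deriv) raddfMn.
Qed.

(** Applied to coefficients, [d] commutes with each [x_i] and each partial derivative and obeys the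
    Leibniz rule on [K[s]], so only the generator has to be checked. *)
Lemma gen_mderivation u v w : gen v u -> gen v (mderivation \o u) -> gen u w ->
  gen v (mderivation \o w).
Proof.
move=> vu vdu; elim=> {w} [//|w w' N _ IH e|w w' _ IH _ IH'|c w uw IH|i w uw IH|i w uw IH].
- by apply: (gen_ev (N := N) IH) => m /e /= ->.
- by apply: gen_eq (gen_add IH IH') _ => m; rewrite /= mderivationD.
- apply: gen_eq (gen_add (gen_scale (pderiv d c) (gen_trans vu uw)) (gen_scale c IH)) _ => m.
  by rewrite /= mderivationZ (pderiv_horner dM).
- by apply: gen_eq (gen_mulX i IH) _ => m; rewrite /= mderivationM mderivationX mul0r add0r.
- by apply: gen_eq (gen_deriv i IH) _ => m; rewrite /= mderivation_deriv.
Qed.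

End DerivationOnSequences.

(** * Localization of the chain at a prime factor of the Bernstein polynomial *)

Section RationalBernstein.
Variables (K : fieldType) (charK : [pchar K] =i pred0) (n : nat).
Local Notation R := {mpoly K[n]}.
Variable h : R.

Lemma nat_injK : injective (fun k : nat => k%:R : K).
Proof.
move=> i j /eqP; wlog le : i j / (i <= j)%N => [hw|].
  by case/orP: (leq_total i j) => le e; [|symmetry]; apply: hw => //; rewrite eq_sym.
rewrite eq_sym -subr_eq0 -natrB // ((pcharf0P _).1 charK) subn_eq0 => le'.
by apply/eqP; rewrite eqn_leq le.
Qed.

Lemma gen_gh_deriv (g : R) i k : gen (gh g h (k - 1)) (gh g^`M(i) h k).
Proof.
have g1 : gen (gh g h (k - 1)) (gh g h k).
  by have := gen_gh_succ g h (k - 1); rewrite subrK.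
(* With [c = s + k], the wanted germ is the derivative of [g h^(s+k)] minus [c] times the derivative
   of [h] times [g h^(s+k-1)]. *)
pose c : {poly K} := 'X + (k%:~R)%:P.
have g2 := gen_mulp h^`M(i) (gen_scale c (gen_base (gh g h (k - 1)))).
apply: (gen_ev (N := `|k|.+1) (gen_add (gen_deriv i g1) (gen_opp g2))) => m lem.
rewrite /gh; have -> : `|(m%:Z + k)%R|%N = `|(m%:Z + (k - 1))%R|%N.+1 by lia.
have -> : c.[m%:R] = (`|(m%:Z + (k - 1))%R|%N.+1)%:R :> K.
  have e : `|(m%:Z + (k - 1))%R|%N.+1%:Z = m%:Z + k by lia.
  by rewrite /c hornerD hornerX hornerC [RHS]pmulrn e intrD -pmulrn.
move: `|_|%N => a.
rewrite mderivM (leibniz_exp (mderivM i)) scaler_nat !mulrnAr -[RHS]addr0 -addrA.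
congr (_ + _).
by rewrite -mulrnBl (_ : _ - _ = 0) ?mul0rn //; ring.
Qed.

(* R_h is a simple D-module: some iterated derivative of g is a nonzero constant *)
Lemma gen_gh_one (g : R) : g != 0 -> exists r : nat, forall k,
  gen (gh g h (k - r%:Z)) (gh 1 h k).
Proof.
have [s] := ubnP (msize g); elim: s g => // s IHs g lts nzg.
have [le1|gt1] := leqP (msize g) 1.
  exists 0%N => k; rewrite subr0; have e := msize1_polyC le1.
  have nzc : g@_0 != 0 by apply: contra nzg => /eqP e0; rewrite e e0.
  apply: gen_eq (gen_scaleK (g@_0)^-1 (gen_base _)) _ => m.
  rewrite /gh e mul_mpolyC scalerA mcoeffC eqxx mulr1 mulVf // scale1r.
  by rewrite mul1r.
have charS i : i.+1%:R != 0 :> K by rewrite ((pcharf0P _).1 charK).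
have [i nzi] := mpoly_const_or_deriv charS gt1.
have [||r hr] := IHs g^`M(i) => //.
  by apply: leq_ltn_trans (msize_deriv_le _ _) _; move: lts; case: (msize g) gt1.
exists r.+1 => k; apply: gen_trans (hr k).
have -> : k - r.+1%:Z = k - r%:Z - 1 by rewrite -addn1 PoszD; ring.
exact: gen_gh_deriv.
Qed.

Section ConstantCoefficients.
Variables (d : {additive K -> K}).
Hypothesis dM : forall x y, d (x * y) = d x * y + x * d y.
Variables (g : R) (nzg : g != 0).
Local Notation M k := (gh g h k).

(** The derivation sends [g h^(s+k)] to [d(g) h^(s+k) + (s+k) g d(h) h^(s+k-1)]. The first term,
    where [g] is lost, is reached from a lower index through [gen_gh_one]. *)
Lemma gen_mderivation_gh : exists r : nat, forall k w, gen (M k) w ->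
  gen (M (k - r%:Z)) (mderivation d \o w).
Proof.
have [r hr] := gen_gh_one nzg; exists r.+1 => k w; apply: gen_mderivation => //.
  by apply: gen_gh_le; lia.
pose c : {poly K} := 'X + (k%:~R)%:P.
have g1 : gen (M (k - r.+1%:Z)) (fun m => mderivation d g * gh 1 h k m).
  by apply: gen_mulp; apply: gen_trans (hr k); apply: gen_gh_le; lia.
have g2 : gen (M (k - r.+1%:Z))
    (fun m => mderivation d h * (c.[m%:R] *: gh g h (k - 1) m)).
  by apply: gen_mulp; apply: gen_scale; apply: gen_gh_le; lia.
apply: (gen_ev (N := `|k|.+1) (gen_add g1 g2)) => m lem /=.
rewrite /gh; have -> : `|(m%:Z + k)%R|%N = `|(m%:Z + (k - 1))%R|%N.+1 by lia.
have -> : c.[m%:R] = (`|(m%:Z + (k - 1))%R|%N.+1)%:R :> K.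
  have e : `|(m%:Z + (k - 1))%R|%N.+1%:Z = m%:Z + k by lia.
  by rewrite /c hornerD hornerX hornerC [RHS]pmulrn e intrD -pmulrn.
move: `|_|%N => a.
rewrite (mderivationM dM) (leibniz_exp (mderivationM dM)) mul1r scaler_nat; congr (_ + _).
by rewrite !mulrnAr mulrC -mulrA.
Qed.

Lemma gen_scale_mono u v w (c : {poly K}) : gen v (fun m => c.[m%:R] *: u m) ->
  gen u w -> gen v (fun m => c.[m%:R] *: (w m : R)).
Proof.
move=> vu; elim=> {w} [//|w w' N _ IH e|w w' _ IH _ IH'|c' w _ IH|i w _ IH|i w _ IH].
- by apply: (gen_ev (N := N) IH) => m /e ->.
- by apply: gen_eq (gen_add IH IH') _ => m; rewrite scalerDr.
- by apply: gen_eq (gen_scale c' IH) _ => m; rewrite !scalerA mulrC.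
- by apply: gen_eq (gen_mulX i IH) _ => m; rewrite scalerAr.
- by apply: gen_eq (gen_deriv i IH) _ => m; rewrite mderivZ.
Qed.

Lemma gen_factor_shift (b : {poly K}) (k : int) :
  gen (M 1) (fun m => b.[m%:R] *: M 0 m) ->
  gen (M (k + 1)) (fun m => (b \Po ('X + (k%:~R)%:P)).[m%:R] *: M k m).
Proof.
move=> /(gen_gh_shift k); rewrite [1 + k]addrC => gs.
apply: (gen_ev (N := `|k|%N) gs) => m lem; rewrite /shift /gh.
rewrite horner_comp !hornerE; congr (_.[_] *: _).
have e : `|(m%:Z + k)%R|%N%:Z = m%:Z + k by lia.
by rewrite !pmulrn e intrD.
Qed.

Section Localization.
Variable pi : {poly K}.
Hypothesis pi_gt1 : (1 < size pi)%N.
Hypothesis pi_prime : forall x y : {poly K}, pi %| x * y -> pi %| x \/ pi %| y.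

(* membership in the localization at pi of the submodule generated by g h^(s+k) *)
Definition inloc k w := exists2 c : {poly K}, ~~ (pi %| c) &
  gen (M k) (fun m => c.[m%:R] *: w m).

Lemma inloc_gen k w : gen (M k) w -> inloc k w.
Proof.
move=> gw; exists 1; first by rewrite -polyC1; apply: prime_ndvdC => //; apply: oner_neq0.
by apply: gen_eq gw _ => m; rewrite hornerC scale1r.
Qed.

Lemma inloc_eq k w w' : inloc k w -> w =1 w' -> inloc k w'.
Proof. by move=> [c nc gw] e; exists c => //; apply: gen_eq gw _ => m; rewrite e. Qed.

Lemma inloc_sub k w w' : inloc k w -> inloc k w' -> inloc k (fun m => w m - w' m).
Proof.
move=> [c nc gw] [c' nc' gw']; exists (c * c'); first exact: prime_ndvdM.
apply: gen_eq (gen_add (gen_scale c' gw) (gen_opp (gen_scale c gw'))) _ => m.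
by rewrite hornerM scalerBr !scalerA [c'.[_] * _]mulrC.
Qed.

Lemma inloc_scale k w (c : {poly K}) : inloc k w -> inloc k (fun m => c.[m%:R] *: w m).
Proof.
move=> [c' nc gw]; exists c' => //; apply: gen_eq (gen_scale c gw) _ => m.
by rewrite !scalerA mulrC.
Qed.

Lemma inloc_div k w (c : {poly K}) : ~~ (pi %| c) ->
  inloc k (fun m => c.[m%:R] *: w m) -> inloc k w.
Proof.
move=> nc [c' nc' gw]; exists (c' * c); first exact: prime_ndvdM.
by apply: gen_eq gw _ => m; rewrite hornerM scalerA.
Qed.

Lemma inloc_mono k k' w (e : {poly K}) : inloc k' (fun m => e.[m%:R] *: M k m) ->
  gen (M k) w -> inloc k' (fun m => e.[m%:R] *: w m).
Proof.
move=> [c nc gw] kw; exists c => //.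
have g1 : gen (M k') (fun m => (c * e).[m%:R] *: M k m).
  by apply: gen_eq gw _ => m; rewrite hornerM scalerA.
by apply: gen_eq (gen_scale_mono g1 kw) _ => m; rewrite hornerM scalerA.
Qed.

Lemma inloc_trans k k' w (e : {poly K}) : inloc k (fun m => e.[m%:R] *: w m) ->
  inloc k' (M k) -> inloc k' (fun m => e.[m%:R] *: w m).
Proof.
move=> [c nc gw] [c' nc' gk]; apply: (inloc_div nc); exists c' => //.
exact: gen_scale_mono gk gw.
Qed.

Lemma inloc_trans1 k k' w : inloc k w -> inloc k' (M k) -> inloc k' w.
Proof.
move=> iw ik; have iw1 : inloc k (fun m => (1 : {poly K}).[m%:R] *: w m).
  by apply: inloc_eq iw _ => m; rewrite hornerC scale1r.
by apply: inloc_eq (inloc_trans iw1 ik) _ => m; rewrite hornerC scale1r.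
Qed.

Variables (b : {poly K}) (nzb : b != 0).
Hypothesis gen_b : gen (M 1) (fun m => b.[m%:R] *: M 0 m).

(** [b(s + k)] is not divisible by [pi] once [k] is large in absolute value, so the localized chain
    is constant near both ends. A product of shifts of [b] bridges the finite middle part, and
    [pi ^+ a] is the exact power of [pi] in that product. *)
Lemma inloc_bounded_power : exists a, forall k k',
  inloc k' (fun m => (pi ^+ a).[m%:R] *: M k m).
Proof.
have gb k := gen_factor_shift k gen_b.
have [kp hkp] := eventually_ndvd_shift pi_gt1 pi_prime nat_injK nzb.
have negI : injective (fun k : nat => - k%:R : K) by move=> i j /oppr_inj/nat_injK.
have [kn hkn] := eventually_ndvd_shift pi_gt1 pi_prime negI nzb.
pose k1 := maxn kp kn.
have up j : inloc (k1 + j)%N%:Z (M k1%:Z).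
  elim: j => [|j IHj]; first by rewrite addn0; apply/inloc_gen/gen_base.
  apply: inloc_trans1 IHj _; exists (b \Po ('X + ((k1 + j)%N%:R)%:P)).
    by apply: hkp; rewrite /k1; lia.
  by have := gb (k1 + j)%N%:Z; rewrite addnS -addn1 PoszD.
have down j : inloc (- k1%:Z) (M (- (k1 + j)%N%:Z)).
  elim: j => [|j IHj]; first by rewrite addn0; apply/inloc_gen/gen_base.
  apply: inloc_trans1 IHj; exists (b \Po ('X + (- (k1 + j.+1)%N%:R)%:P)).
    by apply: hkn; rewrite /k1; lia.
  have := gb (- (k1 + j.+1)%N%:Z); rewrite mulrNz.
  by have -> : - (k1 + j.+1)%N%:Z + 1 = - (k1 + j)%N%:Z by lia.
have mid j : exists2 B : {poly K}, B != 0 &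
    gen (M (- k1%:Z + j%:Z)) (fun m => B.[m%:R] *: M (- k1%:Z) m).
  elim: j => [|j [B nzB gB]].
    exists 1; first exact: oner_neq0.
    by rewrite addr0; apply: gen_eq (gen_base _) _ => m; rewrite hornerC scale1r.
  exists ((b \Po ('X + ((- k1%:Z + j%:Z)%:~R)%:P)) * B).
    rewrite mulf_neq0 // comp_poly2_eq0 //; last by rewrite size_XaddC.
  have := gb (- k1%:Z + j%:Z); rewrite -addrA -PoszD addn1 => gbj.
  by apply: gen_eq (gen_scale_mono gbj gB) _ => m; rewrite hornerM scalerA.
have [B nzB gB] := mid (k1 + k1)%N.
have [a [c [eB nc]]] := prime_factor pi_gt1 nzB.
have e1 : - k1%:Z + (k1 + k1)%N%:Z = k1%:Z by lia.
have loc1 : inloc k1%:Z (fun m => (pi ^+ a).[m%:R] *: M (- k1%:Z) m).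
  rewrite e1 in gB; exists c => //; apply: gen_eq gB _ => m.
  by rewrite eB hornerM scalerA mulrC.
(* [j] is large enough for both [k] and [k'] to lie between [-(k1 + j)] and [k1 + j]. *)
exists a => k k'; pose j := (k1 + `|k| + `|k'|)%N.
have [c1 nc1 gc1] := down j.
apply: (inloc_div nc1).
have h2 : inloc k1%:Z (fun m => (pi ^+ a).[m%:R] *: (c1.[m%:R] *: M (- (k1 + j)%N%:Z) m)).
  exact: inloc_mono loc1 gc1.
have h3 : inloc k' (fun m => (pi ^+ a).[m%:R] *: (c1.[m%:R] *: M (- (k1 + j)%N%:Z) m)).
  apply: inloc_trans h2 _; have [c2 nc2 gc2] := up j; exists c2 => //.
  by apply: gen_trans gc2; apply: gen_gh_le; rewrite /j; lia.
have kk : gen (M (- (k1 + j)%N%:Z)) (M k) by apply: gen_gh_le; rewrite /j; lia.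
have h4 : inloc k' (fun m => (pi ^+ a * c1).[m%:R] *: M (- (k1 + j)%N%:Z) m).
  by apply: inloc_eq h3 _ => m; rewrite hornerM scalerA.
apply: inloc_eq (inloc_mono h4 kk) _ => m.
by rewrite hornerM scalerA mulrC.
Qed.

Hypotheses (monpi : pi \is monic) (nzdpi : pderiv d pi != 0).

(** Since [pi] is monic and [d 1 = 0], its derivative has smaller degree. *)
Lemma deriv_ndvd : ~~ (pi %| pderiv d pi).
Proof.
apply/negP => /(dvdp_leq nzdpi); rewrite leqNgt => /negP; apply.
apply: leq_trans (_ : (size pi).-1 < _)%N; last by move: pi_gt1; case: (size pi).
rewrite ltnS; apply/leq_sizeP => j; rewrite leq_eqVlt => /orP[/eqP <-|ltj].
  by rewrite coef_map -lead_coefE (monicP monpi) (deriv1 dM).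
by rewrite coef_map nth_default ?raddf0 //; move: ltj; case: (size pi).
Qed.

(** The derivation applied to [c pi^(a+1) g h^(s+k)] yields [(a+1) c pi^a d(pi) g h^(s+k)] plus
    terms that still carry [pi^(a+1)]. The latter lie in every localized submodule, and
    [(a+1) c d(pi)] is invertible in the localization, so [a] drops by one. *)
Lemma inloc_all k k' : inloc k' (M k).
Proof.
have [r hr] := gen_mderivation_gh.
have [a] := inloc_bounded_power; elim: a k k' => [|a IHa] k k' loca.
  by apply: inloc_eq (loca k k') _ => m; rewrite expr0 hornerC scale1r.
apply: IHa => {}k {}k'.
(* Starting at [k' + r] compensates the loss of [r] when the derivation is applied. *)
have [c nc gc] := loca k (k' + r%:Z).
have := hr _ _ gc; rewrite addrK => gdc.
have ndpi := deriv_ndvd.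
have nca : ~~ (pi %| c * pderiv d pi * (a.+1%:R)%:P).
  by do 2?apply: prime_ndvdM => //; apply: prime_ndvdC => //; rewrite ((pcharf0P _).1 charK).
apply: (inloc_div nca).
have l1 := inloc_scale (pderiv d c) (loca k k').
have l2 : inloc k' (fun m => c.[m%:R] *:
    ((pi ^+ a.+1).[m%:R] *: (mderivation d \o M k) m)).
  apply: inloc_scale; apply: (inloc_mono (loca (k - r%:Z) k')); apply: hr.
  exact: gen_base.
apply: inloc_eq (inloc_sub (inloc_sub (inloc_gen gdc) l1) l2) _ => m /=.
rewrite !(mderivationZ dM) !(pderiv_horner dM) (leibniz_exp (pderivM dM)) scalerDr.
rewrite [X in X - _ - _]addrC !addrK !scalerA hornerMn !hornerM hornerC -mulr_natr.
by congr (_ *: _); ring.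
Qed.

End Localization.

End ConstantCoefficients.

Lemma minimal_annihilator (g : R) : exists b : {poly K},
  [/\ b \is monic, gen (gh g h 1) (fun m => b.[m%:R] *: gh g h 0 m) &
      forall c : {poly K}, gen (gh g h 1) (fun m => c.[m%:R] *: gh g h 0 m) -> b %| c].
Proof.
pose I (c : {poly K}) := gen (gh g h 1) (fun m => c.[m%:R] *: gh g h 0 m).
pose P k := `[< exists b : {poly K}, [/\ b != 0, I b & size b = k] >].
have exP : exists k, P k.
  have [c nzc Ic] := bernstein_polynomial_exists g h charK.
  by exists (size c); apply/asboolP; exists c.
case: (ex_minnP exP) => k /asboolP[b0 [nzb0 Ib0 szb0]] kmin.
pose b : {poly K} := (lead_coef b0)^-1 *: b0.
have nzl : lead_coef b0 != 0 by rewrite lead_coef_eq0.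
have szb : size b = k by rewrite size_scale ?invr_eq0.
exists b; split.
- by rewrite monicE lead_coefZ mulVf.
- by apply: gen_eq (gen_scaleK (lead_coef b0)^-1 Ib0) _ => m; rewrite hornerZ scalerA.
move=> c Ic; apply/modp_eq0P/eqP/negPn/negP => nzr.
have : (k <= size (c %% b)%R)%N.
  apply: kmin; apply/asboolP; exists (c %% b); split=> //.
  have e : c %% b = c - c %/ b * b by rewrite {2}(divp_eq c b) addrC addKr.
  have Ib : I b.
    by apply: gen_eq (gen_scaleK (lead_coef b0)^-1 Ib0) _ => m; rewrite hornerZ scalerA.
  apply: gen_eq (gen_add Ic (gen_opp (gen_scale (c %/ b) Ib))) _ => m.
  by rewrite e hornerD hornerN hornerM scalerBl scalerA.
by rewrite leqNgt -szb ltn_modp -size_poly_gt0 szb -szb0 size_poly_gt0 nzb0.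
Qed.

Lemma minimal_annihilator_pderiv (g : R) (b : {poly K}) (d : {additive K -> K}) :
    g != 0 -> (forall x y, d (x * y) = d x * y + x * d y) -> b \is monic ->
    gen (gh g h 1) (fun m => b.[m%:R] *: gh g h 0 m) ->
    (forall c : {poly K}, gen (gh g h 1) (fun m => c.[m%:R] *: gh g h 0 m) -> b %| c) ->
  pderiv d b = 0.
Proof.
move=> nzg dM monb gb minb; apply/eqP/negPn/negP => nzdb.
have [pi [monpi dpi nzpi gt1 pri]] := nonconstant_prime_factor dM monb nzdb.
(* Localized membership at the indices 0 and 1 yields an annihilator [c] not divisible by [pi],
   although [pi] divides [b], which divides [c]. *)
have [c /negP nc gc] := inloc_all dM nzg gt1 pri (monic_neq0 monb) gb monpi nzpi 0 1.
by apply/nc/(dvdp_trans dpi)/minb.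
Qed.

Lemma rational_bernstein_polynomial (g : R) : g != 0 -> exists2 c : {poly rat}, c != 0 &
  gen (gh g h 1) (fun m => (map_poly ratr c).[m%:R] *: gh g h 0 m).
Proof.
move=> nzg; have [b [monb gb minb]] := minimal_annihilator g.
have algb i : exists2 p : {poly int}, p != 0 & (map_poly intr p).[b`_i] = 0.
  apply: contrapT => tr.
  have [|d [dD dM] d1] := @transcendental_derivation K charK b`_i.
    by move=> p nzp; apply/eqP => e; apply: tr; exists p.
  have dB : zmod_morphism d.
    move=> x y; by apply: (@addIr _ (d y)); rewrite -dD !subrK.
  pose dA := GRing.isZmodMorphism.Build _ _ _ dB.
  pose da : {additive K -> K} := HB.pack d dA.
  have := @minimal_annihilator_pderiv g b da nzg dM monb gb minb.
  move=> /(congr1 (fun p : {poly K} => p`_i)); rewrite coef_map coef0 /= d1.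
  by move=> /eqP; rewrite oner_eq0.
have [c nzc /dvdpP[q eq]] := dvdp_rat_multiple charK (monic_neq0 monb) algb.
exists c => //; rewrite eq; apply: gen_eq (gen_scale q gb) _ => m.
by rewrite hornerM scalerA.
Qed.

End RationalBernstein.

(** * Coefficients of powers of f_1 y_1 + ... + f_l y_l *)

Lemma mpoly_mulX_ind n (S : comNzRingType) (P : {mpoly S[n]} -> Prop) :
  (forall c, P c%:MP) -> (forall p q, P p -> P q -> P (p + q)) ->
  (forall i p, P p -> P ('X_i * p)) -> forall p, P p.
Proof.
move=> PC PD PX p; rewrite [p]mpolyE; elim/big_ind: _ => [||a _]; first exact: (PC 0).
- exact: PD.
move: p@_a => c; elim/mnm_ind: a => [|a i IHa]; first by rewrite mpolyX0 -mul_mpolyC mulr1.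
by rewrite addmC mpolyXD scalerAr; apply: PX.
Qed.

Section YCoefficients.
Variables (K : fieldType) (n l : nat).
Local Notation R := {mpoly K[n]}.
Local Notation S := {mpoly K[n + l]}.
Local Notation xv i := (lshift l i).
Local Notation yv j := (rshift n j).
Implicit Types (p q : S) (r : R) (c : 'X_{1..l}).

Definition at_y0 p : R :=
  mmap (@mpolyC n K) (fun i => if split i is inl j then 'X_j else 0) p.

Definition of_x r : S := mmap (@mpolyC (n + l) K) (fun i => 'X_(xv i)) r.

Lemma at_y0D p q : at_y0 (p + q) = at_y0 p + at_y0 q.
Proof. exact: raddfD. Qed.
Lemma at_y0M p q : at_y0 (p * q) = at_y0 p * at_y0 q.
Proof. exact: rmorphM. Qed.
Lemma at_y0C (a : K) : at_y0 a%:MP = a%:MP.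
Proof. exact: mmapC. Qed.
Lemma at_y0_0 : at_y0 0 = 0.
Proof. exact: raddf0. Qed.
Lemma at_y0_1 : at_y0 1 = 1.
Proof. exact: rmorph1. Qed.
Lemma at_y0Z (a : K) p : at_y0 (a *: p) = a *: at_y0 p.
Proof. by rewrite -mul_mpolyC at_y0M at_y0C mul_mpolyC. Qed.
Lemma at_y0_x i : at_y0 'X_(xv i) = 'X_i.
Proof. by rewrite /at_y0 mmapX mmap1U (unsplitK (inl i)). Qed.
Lemma at_y0_y j : at_y0 'X_(yv j) = 0.
Proof. by rewrite /at_y0 mmapX mmap1U (unsplitK (inr j)). Qed.

Lemma of_xD r s : of_x (r + s) = of_x r + of_x s.
Proof. exact: raddfD. Qed.
Lemma of_xM r s : of_x (r * s) = of_x r * of_x s.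
Proof. exact: rmorphM. Qed.
Lemma of_xC (a : K) : of_x a%:MP = a%:MP.
Proof. exact: mmapC. Qed.
Lemma of_xX i : of_x 'X_i = 'X_(xv i).
Proof. by rewrite /of_x mmapX mmap1U. Qed.

Lemma of_xK r : at_y0 (of_x r) = r.
Proof.
elim/mpoly_mulX_ind: r => [a|r s IHr IHs|i r IHr].
- by rewrite of_xC at_y0C.
- by rewrite of_xD at_y0D IHr IHs.
- by rewrite of_xM of_xX at_y0M at_y0_x IHr.
Qed.

Lemma mderiv_var (T : comNzRingType) k (i j : 'I_k) :
  ('X_j : {mpoly T[k]})^`M(i) = (j == i)%:R.
Proof.
rewrite mderivX mnm1E; case: eqVneq => [->|_]; last by rewrite scale0r.
have -> : (U_(i) - U_(i) = 0 :> 'X_{1..k})%MM by apply/mnmP => a; rewrite mnmBE mnm0E subnn.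
by rewrite scale1r mpolyX0.
Qed.

Lemma at_y0_deriv i p : at_y0 p^`M(xv i) = (at_y0 p)^`M(i).
Proof.
elim/mpoly_mulX_ind: p => [a|p q IHp IHq|j p IHp].
- by rewrite at_y0C !mderivC at_y0_0.
- by rewrite mderivD !at_y0D mderivD IHp IHq.
rewrite mderivM at_y0D !at_y0M IHp mderivM; congr (_ * _ + _).
rewrite mderiv_var -[j]splitK; case: (split j) => a; rewrite /unsplit.
  rewrite at_y0_x mderiv_var eq_lshift.
  by case: eqP => _; rewrite (at_y0_1, at_y0_0).
by rewrite at_y0_y mderiv0 eq_rlshift at_y0_0.
Qed.

Lemma of_x_deriv j r : (of_x r)^`M(yv j) = 0.
Proof.
elim/mpoly_mulX_ind: r => [a|r s IHr IHs|i r IHr].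
- by rewrite of_xC mderivC.
- by rewrite of_xD mderivD IHr IHs addr0.
by rewrite of_xM of_xX mderivM IHr mulr0 mderiv_var eq_lrshift mul0r addr0.
Qed.

Definition yexp c : 'X_{1..n + l} :=
  [multinom (if split i is inr j then c j else 0%N) | i < n + l].

Lemma yexp_x c i : yexp c (xv i) = 0%N.
Proof. by rewrite mnmE (unsplitK (inl i)). Qed.
Lemma yexp_y c j : yexp c (yv j) = c j.
Proof. by rewrite mnmE (unsplitK (inr j)). Qed.

Lemma yexpD c j : yexp (c + U_(j)) = (yexp c + U_(yv j))%MM.
Proof.
apply/mnmP => i; rewrite mnmDE -[i]splitK; case: (split i) => a; rewrite /unsplit.
  by rewrite !yexp_x mnm1E eq_rlshift.
by rewrite !yexp_y mnmDE !mnm1E eq_rshift.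
Qed.

Lemma yexpB c j : yexp (c - U_(j)) = (yexp c - U_(yv j))%MM.
Proof.
apply/mnmP => i; rewrite mnmBE -[i]splitK; case: (split i) => a; rewrite /unsplit.
  by rewrite !yexp_x mnm1E eq_rlshift.
by rewrite !yexp_y mnmBE !mnm1E eq_rshift.
Qed.

Lemma yexp0 : yexp 0 = 0%MM.
Proof. by apply/mnmP => i; rewrite mnmE mnm0E; case: split => // j; rewrite mnm0E. Qed.

(* c! times the coefficient of y^c, read off the derivative of order c at y = 0 *)
Definition ycoef c p : R := at_y0 p^`M[yexp c].

Lemma ycoefD c p q : ycoef c (p + q) = ycoef c p + ycoef c q.
Proof. by rewrite /ycoef mderivmD at_y0D. Qed.

Lemma ycoefZ c (a : K) p : ycoef c (a *: p) = a *: ycoef c p.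
Proof. by rewrite /ycoef mderivmZ at_y0Z. Qed.

Lemma ycoef0 c : ycoef c 0 = 0.
Proof. by rewrite -(scale0r 0) ycoefZ scale0r. Qed.

Lemma ycoefMn c p k : ycoef c (p *+ k) = ycoef c p *+ k.
Proof. by rewrite -!(scaler_nat k) ycoefZ. Qed.

Lemma ycoef_x c i p : ycoef c ('X_(xv i) * p) = 'X_i * ycoef c p.
Proof. by rewrite /ycoef mderivm_mulX yexp_x mulr0n addr0 at_y0M at_y0_x. Qed.

(** The [c!] in the normalization produces the factor [c j]; in [ycoef_dy] it makes the
    corresponding factor disappear. *)
Lemma ycoef_y c j p : ycoef c ('X_(yv j) * p) = ycoef (c - U_(j))%MM p *+ c j.
Proof.
rewrite /ycoef mderivm_mulX yexp_y at_y0D at_y0M at_y0_y mul0r add0r yexpB.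
by rewrite -scaler_nat at_y0Z scaler_nat.
Qed.

Lemma ycoef_dx c i p : ycoef c p^`M(xv i) = (ycoef c p)^`M(i).
Proof. by rewrite /ycoef -at_y0_deriv -!mderivmU1m -!mderivmDm addmC. Qed.

Lemma ycoef_dy c j p : ycoef c p^`M(yv j) = ycoef (c + U_(j))%MM p.
Proof. by rewrite /ycoef yexpD -mderivmU1m -mderivmDm addmC. Qed.

Lemma ycoef_of_x c r p : ycoef c (of_x r * p) = r * ycoef c p.
Proof.
elim/mpoly_mulX_ind: r p => [a|r s IHr IHs|i r IHr] p.
- by rewrite of_xC !mul_mpolyC ycoefZ.
- by rewrite of_xD !mulrDl ycoefD IHr IHs.
- by rewrite of_xM of_xX -mulrA ycoef_x IHr mulrA.
Qed.

Section Powers.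
Variables (f : 'I_l -> R) (g : R).

Definition mustata_poly : S := \sum_i of_x (f i) * 'X_(yv i).

Definition fexp c : R := \prod_i f i ^+ c i.

Lemma fexpD1 c j : fexp (c + U_(j)) = fexp c * f j.
Proof.
rewrite /fexp (eq_bigr (fun i => f i ^+ c i * f i ^+ (j == i))) => [|i _]; last first.
  by rewrite mnmDE mnm1E exprD.
rewrite big_split /=; congr (_ * _); rewrite (bigD1 j) //= eqxx expr1 big1 ?mulr1 // => i.
by rewrite eq_sym => /negPf ->; rewrite expr0.
Qed.

Lemma mustata_poly_dy j : mustata_poly^`M(yv j) = of_x (f j).
Proof.
rewrite /mustata_poly raddf_sum /= (bigD1 j) //= big1 ?addr0 => [|i nij].
  by rewrite mderivM of_x_deriv mul0r add0r mderiv_var eqxx mulr1.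
by rewrite mderivM of_x_deriv mul0r add0r mderiv_var eq_rshift (negPf nij) mulr0.
Qed.

(* the multinomial theorem for (sum_i f_i y_i)^m *)
Lemma ycoef_pow c m : ycoef c (of_x g * mustata_poly ^+ m) =
  if mdeg c == m then m`!%:R *: (fexp c * g) else 0.
Proof.
elim/mnm_ind: c m => [|c j IHc] m.
  rewrite /ycoef yexp0 mderivm0m mdeg0 at_y0M of_xK; case: m => [|m].
    rewrite expr0 at_y0_1 mulr1 scale1r /fexp big1 ?mul1r // => i _.
    by rewrite mnm0E expr0.
  rewrite exprS at_y0M [at_y0 mustata_poly](_ : _ = 0) ?mul0r ?mulr0 //.
  by rewrite /at_y0 raddf_sum /= big1 // => i _; rewrite -/(at_y0 _) at_y0M at_y0_y mulr0.
rewrite -ycoef_dy mderivM of_x_deriv mul0r add0r mdegD mdeg1 addn1; case: m => [|m].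
  by rewrite expr0 -mpolyC1 mderivC mulr0 ycoef0.
rewrite (leibniz_exp (mderivM _)) mustata_poly_dy mulrnAr ycoefMn mulrA mulrC.
rewrite ycoef_of_x IHc eqSS; case: eqP => _; last first.
  by rewrite mulr0 mul0rn.
rewrite factS natrM -scalerA [in RHS]scaler_nat fexpD1; congr (_ *+ _).
by rewrite -scalerAr; congr (_ *: _); ring.
Qed.

End Powers.

End YCoefficients.

(** * Functions of c arising as coefficients of y^c *)

Section CoefficientClass.
Variables (K : fieldType) (charK : [pchar K] =i pred0) (n l : nat).
Local Notation R := {mpoly K[n]}.
Local Notation xv i := (lshift l i).
Local Notation yv j := (rshift n j).
Variables (f : 'I_l -> R) (g : R).
Implicit Types (c beta gamma : 'X_{1..l}) (d : int) (Psi : 'X_{1..l} -> R).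

Definition mffact c beta : nat := (\prod_i (c i) ^_ (beta i))%N.

(* The functions of c obtained as c!-multiples of coefficients of y^c, of degree
   shift d: sums of P(|c|) applied to c^_beta f^(c + gamma - beta) g, with P a
   differential operator in x depending polynomially on |c| and
   |beta| - |gamma| = d. *)
Inductive coef_class d : ('X_{1..l} -> R) -> Prop :=
| coef_base beta gamma : (mdeg beta)%:Z - (mdeg gamma)%:Z = d ->
    coef_class d (fun c => (mffact c beta)%:R *: (fexp f (c + gamma - beta)%MM * g))
| coef_ev Psi Psi' N : coef_class d Psi ->
    (forall c, (N <= mdeg c)%N -> Psi c = Psi' c) -> coef_class d Psi'
| coef_zero : coef_class d (fun=> 0)
| coef_add Psi Psi' : coef_class d Psi -> coef_class d Psi' ->
    coef_class d (fun c => Psi c + Psi' c)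
| coef_scale (a : {poly K}) Psi : coef_class d Psi ->
    coef_class d (fun c => a.[(mdeg c)%:R] *: Psi c)
| coef_mulX i Psi : coef_class d Psi -> coef_class d (fun c => 'X_i * Psi c)
| coef_deriv i Psi : coef_class d Psi -> coef_class d (fun c => (Psi c)^`M(i)).

Lemma coef_eq d Psi Psi' : coef_class d Psi -> Psi =1 Psi' -> coef_class d Psi'.
Proof. by move=> cP e; apply: (coef_ev (N := 0) cP) => c _. Qed.

Lemma coef_scaleK d (a : K) Psi : coef_class d Psi -> coef_class d (fun c => a *: Psi c).
Proof. by move=> /(coef_scale a%:P) cP; apply: coef_eq cP _ => c; rewrite hornerC. Qed.

Lemma mffactU c beta j : mffact c (beta + U_(j)) =
  (c j * mffact (c - U_(j)) beta)%N.
Proof.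
rewrite /mffact (bigD1 j) //= [X in (_ = _ * X)%N](bigD1 j) //= mulnA; congr muln.
  by rewrite mnmDE mnmBE mnm1E eqxx addn1 ffactnS subn1.
by apply: eq_bigr => i; rewrite mnmDE mnmBE mnm1E eq_sym => /negPf ->; rewrite addn0 subn0.
Qed.

Lemma mffactS c beta j : mffact (c + U_(j)) beta =
  (mffact c beta + beta j * mffact c (beta - U_(j)))%N.
Proof.
rewrite /mffact (bigD1 j) //= [X in (_ = X + _)%N](bigD1 j) //=.
rewrite [X in (_ = _ + _ * X)%N](bigD1 j) //=.
have e (b : 'X_{1..l}) : (forall i, i != j -> b i = beta i) ->
    (\prod_(i < l | i != j) (c + U_(j))%MM i ^_ beta i = \prod_(i < l | i != j) c i ^_ b i)%N.
  move=> hb; apply: eq_bigr => i nij.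
  by rewrite hb // mnmDE mnm1E eq_sym (negPf nij) addn0.
rewrite (e beta) // -(e (beta - U_(j))%MM) ?(e beta) // => [|i].
  rewrite mulnA -mulnDl; congr muln; rewrite mnmDE mnmBE mnm1E eqxx addn1 subn1.
  case: (beta j) => [|b]; first by rewrite mul0n addn0.
  rewrite ffactSS ffactnSr; have [leb|ltb] := leqP b (c j); last first.
    by rewrite ffact_small // !muln0.
  by rewrite [(b.+1 * _)%N]mulnC -mulnDr mulnC; congr muln; lia.
by rewrite mnmBE mnm1E eq_sym => /negPf ->; rewrite subn0.
Qed.

Lemma mdegDU c j : mdeg (c + U_(j)) = (mdeg c).+1.
Proof. by rewrite mdegD mdeg1 addn1. Qed.

Lemma mdegBU c j : (0 < c j)%N -> (mdeg (c - U_(j))).+1 = mdeg c.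
Proof. by move=> cj; rewrite -(mdegDU _ j) submK // lep1mP -lt0n. Qed.

(** The weight [c j] merges with the falling factorial of [c - U_(j)]. It also vanishes where the
    truncated subtraction would be wrong. *)
Lemma coef_y d j Psi : coef_class d Psi ->
  coef_class (d + 1) (fun c => Psi (c - U_(j))%MM *+ c j).
Proof.
elim=> {Psi} [b e ebe|Psi Psi' N _ IH eP||Psi Psi' _ IH _ IH'|a Psi _ IH|i Psi _ IH|i Psi _ IH].
- have h : (mdeg (b + U_(j)))%:Z - (mdeg e)%:Z = d + 1.
    by rewrite mdegDU -ebe -addn1 PoszD; ring.
  apply: coef_eq (coef_base h) _ => c.
  rewrite mffactU -scaler_nat scalerA -natrM; have [->|cj] := posnP (c j).
    by rewrite !mul0n !scale0r.
  congr (_ *: (fexp f _ * _)); apply/mnmP => i; rewrite !(mnmBE, mnmDE, mnm1E).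
  by have [<-|_] := eqVneq j i; lia.
- apply: (coef_ev (N := N.+1) IH) => c ltc; have [->|cj] := posnP (c j).
    by rewrite !mulr0n.
  by rewrite eP // -ltnS mdegBU.
- by apply: coef_eq (coef_zero _) _ => c; rewrite mul0rn.
- by apply: coef_eq (coef_add IH IH') _ => c; rewrite mulrnDl.
- apply: coef_eq (coef_scale (a \Po ('X - 1%:P)) IH) _ => c.
  have [->|cj] := posnP (c j); first by rewrite !mulr0n scaler0.
  rewrite -(mdegBU cj) horner_comp !hornerE -natr1 addrK.
  by rewrite -!scaler_nat !scalerA mulrC.
- by apply: coef_eq (coef_mulX i IH) _ => c; rewrite mulrnAr.
- by apply: coef_eq (coef_deriv i IH) _ => c; rewrite mderivMn.
Qed.

(** By [mffactS] the falling factorial at [c + U_(j)] splits in two, one term with [gamma] raised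
    and one with [beta] lowered. *)
Lemma coef_dy d j Psi : coef_class d Psi ->
  coef_class (d - 1) (fun c => Psi (c + U_(j))%MM).
Proof.
elim=> {Psi} [b e ebe|Psi Psi' N _ IH eP||Psi Psi' _ IH _ IH'|a Psi _ IH|i Psi _ IH|i Psi _ IH].
- have h1 : (mdeg b)%:Z - (mdeg (e + U_(j)))%:Z = d - 1.
    by rewrite mdegDU -ebe -addn1 PoszD; ring.
  have e1 c : (c + U_(j) + e - b = c + (e + U_(j)) - b)%MM.
    by rewrite [(e + _)%MM]addmC addmA.
  have [bj|bj] := posnP (b j).
    by apply: coef_eq (coef_base h1) _ => c; rewrite mffactS bj mul0n addn0 e1.
  have h2 : (mdeg (b - U_(j)))%:Z - (mdeg e)%:Z = d - 1.
    by rewrite -ebe -(mdegBU bj) -addn1 PoszD; ring.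
  apply: coef_eq (coef_add (coef_base h1) (coef_scaleK (b j)%:R (coef_base h2))) _ => c.
  rewrite mffactS natrD scalerDl e1 natrM -scalerA; congr (_ + _ *: (_ *: (fexp f _ * _))).
  apply/mnmP => i; rewrite !(mnmBE, mnmDE, mnm1E).
  by have [<-|_] := eqVneq j i; lia.
- by apply: (coef_ev (N := N) IH) => c lec; rewrite eP // mdegDU leqW.
- exact: coef_zero.
- by apply: coef_eq (coef_add IH IH') _.
- apply: coef_eq (coef_scale (a \Po ('X + 1%:P)) IH) _ => c.
  by rewrite mdegDU horner_comp !hornerE natr1.
- by apply: coef_eq (coef_mulX i IH) _.
- by apply: coef_eq (coef_deriv i IH) _.
Qed.

Let h := mustata_poly f.

(* the value of s at which g h^(s+1) has degree |c| - d in y *)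
Definition sdeg c d : nat := `|((mdeg c)%:Z - 1 - d)%R|%N.

(** A factor [y_j] or a derivative in [y_j] changes [d] by one and [c] by [U_(j)], leaving [sdeg]
    fixed. Division by [(s+1)!] removes the constant that [ycoef_pow] gives for [h^(s+1)]. *)
Lemma gen_coef_class w d : gen (gh (of_x l g) h 1) w ->
  coef_class d (fun c => ((sdeg c d).+1`!%:R)^-1 *: ycoef c (w (sdeg c d))).
Proof.
move=> gw; elim: gw d => {w} [|w w' N _ IH e|w w' _ IH _ IH'|a w _ IH|i w _ IH|i w _ IH] d.
(* As [h^(s+1)] is homogeneous of degree [s + 1] in [y], only [d = 0] contributes. *)
- have [->|nd] := eqVneq d 0; last first.
    apply: (coef_ev (N := `|d|.+1) (coef_zero _)) => c lec.
    rewrite /gh /h ycoef_pow; case: eqP => [|_]; last by rewrite scaler0.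
    by rewrite /sdeg; lia.
  have h0 : (mdeg (0%MM : 'X_{1..l}))%:Z - (mdeg (0%MM : 'X_{1..l}))%:Z = 0 by rewrite subrr.
  apply: (coef_ev (N := 1) (coef_base h0)) => c lec.
  have es : (sdeg c 0).+1 = mdeg c by rewrite /sdeg; lia.
  have -> : gh (of_x l g) h 1 (sdeg c 0) = of_x l g * h ^+ (mdeg c).
    by rewrite /gh -es; congr (_ * _ ^+ _); lia.
  rewrite es ycoef_pow eqxx scalerA mulVf ?fact_neq0 // !scale1r.
  have -> : mffact c 0 = 1%N by apply: big1 => i _; rewrite mnm0E.
  by rewrite scale1r addm0 subm0.
- apply: (coef_ev (N := (N + `|d|).+1) (IH d)) => c lec.
  by rewrite e // /sdeg; lia.
- by apply: coef_eq (coef_add (IH d) (IH' d)) _ => c; rewrite ycoefD scalerDr.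
- apply: (coef_ev (N := `|d|.+1) (coef_scale (a \Po ('X - ((1 + d)%:~R)%:P)) (IH d))) => c lec.
  rewrite ycoefZ horner_comp !hornerE [RHS]scalerA [X in _ = X *: _]mulrC -[RHS]scalerA.
  congr (_.[_] *: _).
  have es : (sdeg c d)%:Z = (mdeg c)%:Z - (1 + d) by rewrite /sdeg; lia.
  by rewrite [RHS]pmulrn es intrB -pmulrn.
- rewrite -[i]splitK; case: (split i) => a; rewrite /unsplit.
    by apply: coef_eq (coef_mulX a (IH d)) _ => c; rewrite ycoef_x scalerAr.
  have := coef_y a (IH (d - 1)); rewrite subrK => cy; apply: coef_eq cy _ => c.
  have [c0|cj] := posnP (c a); first by rewrite ycoef_y c0 !mulr0n scaler0.
  have -> : sdeg (c - U_(a)) (d - 1) = sdeg c d by rewrite /sdeg -(mdegBU cj); lia.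
  by rewrite ycoef_y -!scaler_nat !scalerA mulrC.
- rewrite -[i]splitK; case: (split i) => a; rewrite /unsplit.
    by apply: coef_eq (coef_deriv a (IH d)) _ => c; rewrite ycoef_dx mderivZ.
  have := coef_dy a (IH (d + 1)); rewrite addrK => cy; apply: coef_eq cy _ => c.
  have -> : sdeg (c + U_(a)) (d + 1) = sdeg c d by rewrite /sdeg mdegDU; lia.
  by rewrite ycoef_dy.
Qed.

Lemma gen_coef_class_shift (b : {poly K}) :
  gen (gh (of_x l g) h 1) (fun m => b.[m%:R] *: gh (of_x l g) h 0 m) ->
  coef_class (-1) (fun c => b.[(mdeg c)%:R] *: (fexp f c * g)).
Proof.
(* At [d = -1] the index [s] is [|c|]; the factor [s + 1] compensates [s! / (s+1)!]. *)
move=> /(@gen_coef_class _ (-1))/(coef_scale ('X + 1%:P)) cb; apply: coef_eq cb _ => c.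
have -> : sdeg c (-1) = mdeg c by rewrite /sdeg; lia.
rewrite ycoefZ /gh addr0 absz_nat ycoef_pow eqxx !scalerA; congr (_ *: _).
rewrite !hornerE natr1 factS natrM; have := fact_neq0 charK (mdeg c).+1; rewrite factS natrM.
rewrite mulf_eq0 negb_or; move: (_.+1%:R : K) (_`!%:R : K) => x y /andP[nx ny].
by field; apply/andP.
Qed.

End CoefficientClass.

(** * Descent to the direct summand *)

Section Retraction.
Variables (K : fieldType) (n : nat) (A : subalgClosed {mpoly K[n]}).
Local Notation R := {mpoly K[n]}.
Local Notation SA := (subalg A).

Definition A_retraction (rho : R -> SA) : Prop :=
  [/\ forall a : SA, rho (val a) = a, forall x y, rho (x + y) = rho x + rho y &
      forall (a : SA) x, rho (val a * x) = a * rho x].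

Lemma direct_summand_retraction : direct_summand A -> exists rho, A_retraction rho.
Proof.
move=> [N [[N0 NB] AN dec triv]].
have ND u v : u \in N -> v \in N -> u + v \in N.
  by move=> Nu Nv; rewrite -[v]opprK -[- v]sub0r; apply: (NB _ _ Nu); apply: NB.
have ex x : exists a : SA, x - val a \in N.
  have [a Aa [u Nu ->]] := dec x; exists (Subalg Aa).
  by rewrite /= addrC addKr.
have [rho hrho] := choice ex; exists rho.
have uniq x (a : SA) : x - val a \in N -> rho x = a.
  move=> Na; apply/val_inj/eqP; rewrite -subr_eq0; apply/eqP; apply: triv.
    by rewrite -raddfB; apply: valP.
  have -> : val (rho x) - val a = (x - val a) - (x - val (rho x)) by ring.
  exact: NB.
split=> [a|x y|a x]; apply: uniq.
- by rewrite subrr.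
- by rewrite [val (_ + _)]raddfD opprD addrACA; apply: ND.
- rewrite [val (_ * _)]rmorphM -mulrBr; apply: AN; [exact: valP|exact: hrho].
Qed.

Variables (rho : R -> SA) (rhoP : A_retraction rho).

Lemma retractionK (a : SA) : rho (val a) = a. Proof. by case: rhoP. Qed.
Lemma retractionD x y : rho (x + y) = rho x + rho y. Proof. by case: rhoP. Qed.
Lemma retractionM (a : SA) x : rho (val a * x) = a * rho x. Proof. by case: rhoP. Qed.

Lemma retraction0 : rho 0 = 0.
Proof. exact: (retractionK 0). Qed.

Lemma retractionN x : rho (- x) = - rho x.
Proof. by apply: (@addIr _ (rho x)); rewrite -retractionD !addNr retraction0. Qed.

Lemma retractionB x y : rho (x - y) = rho x - rho y.
Proof. by rewrite retractionD retractionN. Qed.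

Lemma retractionZ (c : K) x : rho (c *: x) = c *: rho x.
Proof.
have -> : c *: x = val (c%:A : SA) * x.
  by rewrite -[val _]/(c *: 1) -scalerAl mul1r.
by rewrite retractionM -scalerAl mul1r.
Qed.

(** Since [rho] is linear over [A], the commutator of the retracted operator with [a] is the
    retraction of the commutator of [D] with [a]. *)
Lemma retract_order m (D : R -> R) : order_lt m D ->
  order_lt m (fun a : SA => rho (D (val a))).
Proof.
elim: m D => [|m IHm] D hD /=; first by move=> x; rewrite hD retraction0.
move=> a; apply: order_lt_eq (IHm _ (hD (val a))) => x.
by rewrite /comm_op retractionB retractionM.
Qed.

Lemma retract_diffop (D : R -> R) : is_diffop D ->
  is_diffop (fun a : SA => rho (D (val a))).
Proof.
move=> [Dl [m hm]]; split; last by exists m; apply: retract_order.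
by move=> c x y; rewrite -retractionZ -retractionD -Dl.
Qed.

End Retraction.

Section Diffops.
Variables (K : fieldType) (n : nat).
Local Notation R := {mpoly K[n]}.

Lemma is_diffop_id : is_diffop (@id R).
Proof.
by split=> //; exists 1%N => a x; rewrite /comm_op subrr.
Qed.

Lemma is_diffop_mulX (D : R -> R) i : is_diffop D -> is_diffop (fun x => D ('X_i * x)).
Proof.
move=> [Dl [m hm]]; split; first by move=> c x y; rewrite mulrDr -scalerAr Dl.
by exists m; apply: order_lt_eq (order_lt_mul 1 'X_i hm) => x; rewrite mul1r.
Qed.

Lemma is_diffop_deriv (D : R -> R) i : is_diffop D -> is_diffop (fun x => D x^`M(i)).
Proof.
move=> [Dl [m hm]]; split; first by move=> c x y; rewrite mderivD mderivZ Dl.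
exists (m + 2)%N; apply: (order_lt_comp (F := D) (G := mderiv i)) => //.
  by move=> x y; rewrite -[x - y]/(x + - y) addrC -scaleN1r Dl scaleN1r addrC.
move=> a b x; rewrite /comm_op /= !mderivM; ring.
Qed.

End Diffops.

(** * Operators depending polynomially on s *)

Section OperatorFamilies.
Variables (T : nzRingType) (l : nat).

(* families t |-> F t of the form t |-> delta(t), with delta in T[s] *)
Definition poly_family (F : ('I_l -> int) -> T) : Prop :=
  exists E : {mpoly T[l]}, forall t, E.@[fun i => (t i)%:~R] = F t.

Lemma poly_familyC (a : T) : poly_family (fun=> a).
Proof. by exists a%:MP => t; rewrite mevalC. Qed.

Lemma poly_familyX i : poly_family (fun t => (t i)%:~R).
Proof. by exists 'X_i => t; rewrite mevalXU. Qed.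

Lemma poly_familyD F G : poly_family F -> poly_family G -> poly_family (fun t => F t + G t).
Proof. by move=> [E hE] [E' hE']; exists (E + E') => t; rewrite mevalD hE hE'. Qed.

Lemma poly_familyM F G : poly_family F -> poly_family G -> poly_family (fun t => F t * G t).
Proof.
by move=> [E hE] [E' hE']; exists (E * E') => t; rewrite meval_int_central hE hE'.
Qed.

Lemma poly_family_eq F G : poly_family F -> F =1 G -> poly_family G.
Proof. by move=> [E hE] e; exists E => t; rewrite hE e. Qed.

Lemma poly_family_sum (I : Type) (r : seq I) (F : I -> ('I_l -> int) -> T) :
  (forall i, poly_family (F i)) -> poly_family (fun t => \sum_(i <- r) F i t).
Proof.
move=> hF; elim: r => [|i r IHr].
  by apply: poly_family_eq (poly_familyC 0) _ => t; rewrite big_nil.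
by apply: poly_family_eq (poly_familyD (hF i) IHr) _ => t; rewrite big_cons.
Qed.

Lemma poly_family_int_prod (I : Type) (r : seq I) (z : I -> ('I_l -> int) -> int) :
  (forall i, poly_family (fun t => (z i t)%:~R)) ->
  poly_family (fun t => (\prod_(i <- r) z i t)%:~R).
Proof.
move=> hz; elim: r => [|i r IHr].
  by apply: poly_family_eq (poly_familyC 1) _ => t; rewrite big_nil.
by apply: poly_family_eq (poly_familyM (hz i) IHr) _ => t; rewrite big_cons intrM.
Qed.

Lemma poly_family_falling i (a b : nat) :
  poly_family (fun t => (\prod_(k < b) (t i - (a + k)%N%:Z))%:~R).
Proof.
apply: poly_family_int_prod => k.
apply: poly_family_eq (poly_familyD (poly_familyX i) (poly_familyC (- (a + k)%:R))) _ => t.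
by rewrite intrB pmulrn.
Qed.

Lemma poly_family_pow_sum m : poly_family (fun t => ((\sum_i t i) ^+ m)%:~R).
Proof.
elim: m => [|m IHm]; first by apply: poly_family_eq (poly_familyC 1) _.
have hs : poly_family (fun t => (\sum_i t i)%:~R).
  apply: poly_family_eq (poly_family_sum (index_enum _) poly_familyX) _ => t.
  by rewrite rmorph_sum.
by apply: poly_family_eq (poly_familyM hs IHm) _ => t; rewrite exprS intrM.
Qed.

End OperatorFamilies.

Lemma falling_ffact (c b : nat) :
  \prod_(k < b) (c%:Z - (k : nat)%:Z) = (c ^_ b)%:Z.
Proof.
elim: b => [|b IHb]; first by rewrite big_ord0.
rewrite big_ord_recr /= IHb ffactnSr; have [leb|ltb] := leqP b c.
  by rewrite PoszM -subzn.
by rewrite ffact_small // !mul0r mul0n.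
Qed.

Section BinomialFactor.
Variables (K : fieldType) (charK : [pchar K] =i pred0).

(* the cofactor of binom(s, -e) in the falling factorial s^_b, where b >= -e *)
Definition bin_cofactor (e : int) (b : nat) (s : int) : int :=
  if e < 0 then `|e|%N`!%:Z * \prod_(k < b - `|e|%N) (s - (`|e|%N + k)%N%:Z)
  else \prod_(k < b) (s - (0 + k)%N%:Z).

(** For negative [e], the first [-e] factors of the falling factorial form the binomial up to a
    factorial, and the others go to the cofactor. *)
Lemma bin_cofactorE (e : int) (b c : nat) : - e <= b%:Z ->
  (bin_cofactor e b c)%:~R * (if e < 0 then binK (c%:Z%:~R) `|e|%N else 1) = (c ^_ b)%:R :> K.
Proof.
move=> leb; rewrite /bin_cofactor [RHS]pmulrn; case: ifP => lt0; last first.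
  by rewrite mulr1 -falling_ffact.
rewrite -falling_ffact; have -> : b = (`|e| + (b - `|e|))%N by lia.
rewrite big_split_ord /= addKn /binK !intrM mulrACA -pmulrn mulfV ?fact_neq0 // mul1r mulrC.
congr (_ * _); rewrite rmorph_prod; apply: eq_bigr => k _.
exact/esym/intrB.
Qed.

Lemma binK_small (c m : nat) : (c < m)%N -> binK (c%:Z%:~R : K) m = 0.
Proof.
by move=> ltc; rewrite /binK (bigD1 (Ordinal ltc)) //= -pmulrn subrr mul0r mulr0.
Qed.

End BinomialFactor.

(** * Values of the generators at natural exponents *)

Section PhiValues.
Variables (K : fieldType) (A : comAlgType K) (l : nat) (f : 'I_l -> A) (g : A).
Local Notation F := (\prod_i f i).
Implicit Types (c : 'X_{1..l}).

Definition intmnm c : 'I_l -> int := fun i => (c i)%:Z.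

Lemma specM t (x y : sloc f) : spec t (x * y) = spec t x * spec t y.
Proof. exact: rmorphM. Qed.

Lemma spec_zpow t e : spec t (zpow (polyfam f) e) = zpow f e.
Proof. by rewrite rmorph_prod; apply: eq_bigr => i _; apply: spec_zpow1. Qed.

Lemma zpow_nat (e : 'I_l -> int) (k : 'I_l -> nat) : (forall i, e i = (k i)%:Z) ->
  zpow f e = toloc F (\prod_i f i ^+ k i).
Proof.
by move=> ek; rewrite rmorph_prod; apply: eq_bigr => i _; rewrite ek rmorphXn.
Qed.

Lemma zpowD (e t : 'I_l -> int) : zpow f e * zpow f t = zpow f (fun i => e i + t i).
Proof. by rewrite -big_split; apply: eq_bigr => i _; rewrite zpow1D. Qed.

Lemma phi_toloc c (p : {mpoly A[l]}) : phi (intmnm c) (toloc _ p : sloc f) =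
  toloc F (p.@[intpt A (intmnm c)] * \prod_i f i ^+ c i).
Proof. by rewrite /phi spec_toloc (zpow_nat (k := c)) // -rmorphM. Qed.

Lemma phi_fs_gen c (e : 'I_l -> int) : phi (intmnm c) (fs_gen f g e) =
  toloc F (\prod_(i | e i < 0) (binK (c i)%:Z%:~R `|e i|%N : K)%:A) *
  zpow f (fun i => e i + (c i)%:Z) * toloc F g.
Proof.
rewrite /phi /fs_gen !specM spec_zpow !spec_toloc mevalC mulrAC -[_ * zpow f e * _]mulrA.
rewrite zpowD rmorph_prod; congr (toloc F _ * _ * _).
by apply: eq_bigr => i _; apply: meval_sbinom.
Qed.

Lemma phi_zero t : phi t (0 : sloc f) = 0.
Proof. by rewrite /phi raddf0 mul0r. Qed.

Lemma phi_fs_gen_nat c (e : 'I_l -> int) (k : 'I_l -> nat) :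
  (forall i, e i + (c i)%:Z = (k i)%:Z) -> phi (intmnm c) (fs_gen f g e) =
  toloc F ((\prod_(i | e i < 0) (binK (c i)%:Z%:~R `|e i|%N : K)) *: (\prod_i f i ^+ k i * g)).
Proof.
move=> ek; rewrite phi_fs_gen (zpow_nat ek) -!rmorphM; congr (toloc F _).
rewrite -mulrA; have -> : \prod_(i | e i < 0) (binK (c i)%:Z%:~R `|e i|%N : K)%:A =
    (\prod_(i | e i < 0) (binK (c i)%:Z%:~R `|e i|%N : K))%:A :> A.
  by rewrite -in_algE rmorph_prod.
by rewrite -scalerAl mul1r.
Qed.

(** A negative exponent forces [e i < 0] and [c i < - e i], so the binomial at [i] vanishes. *)
Lemma phi_fs_gen_small c (e : 'I_l -> int) i : e i + (c i)%:Z < 0 ->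
  phi (intmnm c) (fs_gen f g e) = 0.
Proof.
move=> lt0; have z0 : \prod_(i | e i < 0) (binK (c i)%:Z%:~R `|e i|%N : K)%:A = 0 :> A.
  rewrite (bigD1 i) /=; last by lia.
  by rewrite binK_small ?scale0r ?mul0r //; lia.
by rewrite phi_fs_gen z0 rmorph0 !mul0r.
Qed.

End PhiValues.

(** * Coefficient functions as values of elements of the submodule *)

Section Realization.
Variables (K : fieldType) (charK : [pchar K] =i pred0).
Variables (n : nat) (A : subalgClosed {mpoly K[n]}).
Local Notation R := {mpoly K[n]}.
Local Notation SA := (subalg A).
Variables (l : nat) (f : 'I_l -> SA) (g : SA).
Variables (rho : R -> SA) (rhoP : A_retraction rho).
Local Notation M := (fsmod_of f charK).
Local Notation F := (\prod_i f i).
Implicit Types (c : 'X_{1..l}) (Psi : 'X_{1..l} -> R).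

Variable N : {pred M}.
Hypotheses (subN : GRing.submod_closed N)
  (genN : forall e : 'I_l -> int, \sum_i e i = 1 -> fs charK (fs_gen f g e) \in N).

Lemma submodD v w : v \in N -> w \in N -> v + w \in N.
Proof. by case: subN => _ h Nv Nw; rewrite -[v]scale1r; apply: h. Qed.

Lemma submodZ D v : v \in N -> D *: v \in N.
Proof. by case: subN => N0 h Nv; rewrite -[_ *: _]addr0; apply: h. Qed.

Lemma mdeg_sum_int (b : 'X_{1..l}) : \sum_i (b i)%:Z = (mdeg b)%:Z.
Proof. by rewrite mdegE (big_morph Posz PoszD (erefl 0%:Z)). Qed.

(** The generator for [e = gamma - beta], whose entries sum to 1, is hit by the retracted operator
    times the cofactors [z], which complete its binomials to falling factorials. *)
Lemma realize_base (beta gamma : 'X_{1..l}) (D : R -> R) :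
  (mdeg beta)%:Z - (mdeg gamma)%:Z = -1 -> is_diffop D ->
  exists2 nu : M, nu \in N & forall c, phi (intmnm c) nu = toloc F (rho (D
    ((mffact c beta)%:R *: (fexp (fun i => val (f i)) (c + gamma - beta)%MM * val g)))).
Proof.
move=> ebg Dd; have D0 : D 0 = 0.
  by have [Dl _] := Dd; have := Dl (-1) 0 0; rewrite !scaleN1r !addNr.
pose e i : int := (gamma i)%:Z - (beta i)%:Z.
have sume : \sum_i e i = 1.
  by rewrite sumrB !mdeg_sum_int; lia.
pose DA : diffop SA := Diffop (introT (asboolP _) (retract_diffop rhoP Dd)).
pose z (t : 'I_l -> int) : int := \prod_i bin_cofactor (e i) (beta i) (t i).
have [E hE] : poly_family (fun t => (z t)%:~R * DA).
  apply: poly_familyM (poly_familyC _ DA); apply: poly_family_int_prod => i.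
  rewrite /bin_cofactor; case: (e i < 0); last exact: poly_family_falling.
  apply: poly_family_eq (poly_familyM (poly_familyC _ ((`|e i|%N`!%:Z)%:~R : diffop SA))
    (poly_family_falling _ i `|e i|%N (beta i - `|e i|%N))) _ => t.
  by rewrite intrM.
exists (E *: fs charK (fs_gen f g e)); first exact/submodZ/genN.
move=> c; rewrite phi_scale hE.
(* If an exponent of some [f i] is negative, the value of the generator and the falling factorial
   [mffact c beta] both vanish. *)
have [small|/existsPn large] := boolP [exists i, e i + (c i)%:Z < 0].
  have /existsP[i lti] := small.
  have ltb : (c i < beta i)%N by rewrite /e in lti; lia.
  rewrite (phi_fs_gen_small _ _ lti) scaler0.
  have -> : mffact c beta = 0%N by rewrite /mffact (bigD1 i) //= ffact_small.
  by rewrite scale0r D0 (retraction0 rhoP) rmorph0.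
rewrite (phi_fs_gen_nat _ _ (k := (c + gamma - beta)%MM)) => [|i]; last first.
  have := large i; rewrite /e mnmBE mnmDE; lia.
set B := \prod_(i | e i < 0) _; set y := (_ * g).
have zB : (z (intmnm c))%:~R * B = (mffact c beta)%:R :> K.
  rewrite /B big_mkcond /z rmorph_prod -big_split /mffact natr_prod /=.
  apply: eq_bigr => i _; apply: bin_cofactorE => //; rewrite /e; lia.
rewrite -scalerA scale_toloc scaler_int.
have -> (k : int) : toloc F (DA (B *: y)) *~ k = toloc F (DA ((B *: y) *~ k)).
  by rewrite !raddfMz.
congr (toloc F _); rewrite -scaler_int scalerA zB; congr (rho (D _)).
rewrite -[LHS]/(_ *: (val _ * val g)); congr (_ *: (_ * _)).
rewrite rmorph_prod; apply: eq_bigr => i _; exact: rmorphXn.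
Qed.

(** Operators in [x] cannot be pulled out of [rho], which is linear over [A] only, so the induction
    lets them accumulate in [D]. *)
Lemma realize Psi d (D : R -> R) : coef_class (fun i => val (f i)) (val g) d Psi ->
  d = -1 -> is_diffop D -> exists2 nu : M, nu \in N & exists N0, forall c,
  (N0 <= mdeg c)%N -> phi (intmnm c) nu = toloc F (rho (D (Psi c))).
Proof.
move=> cP.
elim: cP D => {Psi} [b e ebe|Psi Psi' N1 _ IH eP||Psi Psi' _ IH _ IH'|
  a Psi _ IH|i Psi _ IH|i Psi _ IH] D d1 Dd.
- have [nu Nnu hnu] := realize_base (etrans ebe d1) Dd.
  by exists nu => //; exists 0%N => c _.
- have [nu Nnu [N0 hnu]] := IH D d1 Dd; exists nu => //; exists (maxn N0 N1) => c.
  by rewrite geq_max => /andP[l0 l1]; rewrite hnu // eP.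
- exists 0; first by case: subN.
  exists 0%N => c _; rewrite (_ : D 0 = 0) ?(retraction0 rhoP) ?rmorph0 ?phi_zero //.
  by have [Dl _] := Dd; have := Dl (-1) 0 0; rewrite !scaleN1r !addNr.
- have [nu Nnu [N0 hnu]] := IH D d1 Dd; have [nu' Nnu' [N0' hnu']] := IH' D d1 Dd.
  exists (nu + nu'); first exact: submodD.
  exists (maxn N0 N0') => c; rewrite geq_max => /andP[l0 l1].
  have DD x y : D (x + y) = D x + D y.
    by have [Dl _] := Dd; rewrite -[x in LHS]scale1r Dl scale1r.
  by rewrite phiD hnu // hnu' // DD (retractionD rhoP) rmorphD.
- have [nu Nnu [N0 hnu]] := IH D d1 Dd.
  (* The operator [a(s_1 + ... + s_l)]; at [intmnm c] the sum is [mdeg c]. *)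
  have [E hE] : poly_family (fun t : 'I_l -> int =>
      \sum_(i < size a) mulop ((a`_i)%:A : SA) * ((\sum_j t j) ^+ i)%:~R).
    apply: poly_family_sum => i; apply: poly_familyM; first exact: poly_familyC.
    exact: poly_family_pow_sum.
  exists (E *: nu); first exact: submodZ.
  exists N0 => c lec; rewrite phi_scale hE hnu // scaler_suml.
  have DZ (k : K) x : D (k *: x) = k *: D x.
    have [Dl _] := Dd; have D0 : D 0 = 0.
      by have := Dl (-1) 0 0; rewrite !scaleN1r !addNr.
    by rewrite -[k *: x]addr0 Dl D0 addr0.
  rewrite DZ (retractionZ rhoP) horner_coef scaler_suml rmorph_sum.
  apply: eq_bigr => i _; rewrite -scalerA scale_mulop scaler_int.
  rewrite mdeg_sum_int -rmorphMz -rmorphM; congr (toloc F _).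
  by rewrite -scalerAl mul1r -scaler_int scalerA rmorphXn pmulrn.
- exact: IH (is_diffop_mulX i Dd).
- exact: IH (is_diffop_deriv i Dd).
Qed.

End Realization.

(** * Elements determined by their values at large exponents *)

Section VanishLarge.
Variables (T : idomainType) (charT : forall k, k.+1%:R != 0 :> T).

(** By induction on the number of variables, [p] as a polynomial in the last one has the infinitely
    many roots [N], [N + 1], and so on. *)
Lemma mpoly_vanish_large l (p : {mpoly T[l]}) (N : nat) :
  (forall t : 'I_l -> nat, (forall i, (N <= t i)%N) -> p.@[fun i => (t i)%:R] = 0) ->
  p = 0.
Proof.
elim: l p => [|l IHl] p p0.
  have := p0 (fun=> N) (fun=> leqnn N).
  by rewrite [p]nvar0_mpolyC mevalC => ->.
apply: muni_inj0; apply/eqP/negPn/negP => nz.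
have inj : injective (fun k : nat => (k%:R)%:MP : {mpoly T[l]}).
  move=> i j e; have {e} : i%:R = j%:R :> T.
    by have := congr1 (mcoeff 0%MM) e; rewrite !mcoeffC eqxx !mulr1.
  wlog le : i j / (i <= j)%N => [hw|].
    by case/orP: (leq_total i j) => le e; [|symmetry]; apply: hw.
  move=> /eqP; rewrite eq_sym -subr_eq0 -natrB //.
  case e: (j - i)%N => [|d]; last by rewrite (negPf (charT d)).
  by move=> _; lia.
have := @max_poly_roots _ (muni p) [seq (k%:R)%:MP | k <- iota N (size (muni p))] nz.
rewrite size_map size_iota ltnn => h; suff : false by []; apply: h; last first.
  by rewrite map_inj_uniq ?iota_uniq.
apply/allP => x /mapP[k]; rewrite mem_iota => /andP[leNk _] ->.
apply/rootP; apply: IHl => t Nt; rewrite horner_muni.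
rewrite -[RHS](p0 (fun i => oapp t k (unlift ord_max i))) => [|i]; last by case: unlift.
by apply: meval_eq => i; case: unlift.
Qed.

End VanishLarge.

Section PhiInjective.
Variables (K : fieldType) (charK : [pchar K] =i pred0) (A : comAlgType K).
Variables (l : nat) (f : 'I_l -> A).
Variables (T : idomainType) (iota : {rmorphism A -> T}) (iotaI : injective iota).
Hypotheses (l0 : (0 < l)%N) (nzf : \prod_i f i != 0).

(** Points with all coordinates at least [N] suffice, and [l > 0] makes their degree at least [N].
    The nonzero product of the [f i] can be cancelled in the domain [T]. *)
Lemma phi_inj_large (v w : sloc f) N :
  (forall c : 'X_{1..l}, (N <= mdeg c)%N -> phi (intmnm c) v = phi (intmnm c) w) ->
  v = w.
Proof.
move=> e; apply/eqP; rewrite -subr_eq0; apply/eqP.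
have e0 c : (N <= mdeg c)%N -> spec (intmnm c) (v - w) = 0.
  move=> /e/(congr1 ( *%R^~ (zpow f (fun i => - intmnm c i)))).
  by rewrite /phi -!mulrA zpow_inv !mulr1 rmorphB /= => ->; rewrite subrr.
move: (v - w) e0 => x; have [p [m ->]] := locP x => e0.
apply/lfracP; exists 0%N; rewrite mul0r subr0 !expr0 mul1r mulr1.
suff p0 : map_mpoly iota p = 0.
  apply/mpolyP => u; apply: iotaI.
  by rewrite mcoeff0 rmorph0 -mcoeff_map_mpoly p0 mcoeff0.
have charT k : k.+1%:R != 0 :> T.
  by rewrite -(rmorph_nat (iota \o in_alg A)) fmorph_eq0 natK.
apply: (mpoly_vanish_large charT (N := N)) => t Nt.
pose c : 'X_{1..l} := [multinom t i | i < l].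
have Nc : (N <= mdeg c)%N.
  rewrite mdegE (bigD1 (Ordinal l0)) //= mnmE.
  by apply: leq_trans (Nt _) (leq_addr _ _).
have := e0 c Nc; rewrite spec_lfrac => /lfracP[j].
rewrite mul0r subr0 expr0 mulr1 => /(congr1 iota).
rewrite rmorphM rmorphXn rmorph0 => /eqP; rewrite mulf_eq0 expf_eq0.
rewrite -(rmorph0 iota) (inj_eq iotaI) (negPf nzf) andbF /= (rmorph0 iota) => /eqP <-.
rewrite /map_mpoly /mmap [LHS]raddf_sum /= mevalE raddf_sum /=.
apply: eq_bigr => u _; rewrite mmap1_id mevalM mevalC mevalX rmorphM rmorph_prod.
congr (_ * _); apply: eq_bigr => i _.
by rewrite rmorphXn /intpt /intmnm mnmE rmorph_int pmulrn.
Qed.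

End PhiInjective.

Lemma loc0_all_eq (A : comNzRingType) (f : A) (x y : loc f) : f = 0 -> x = y.
Proof.
move=> f0; have [a [k ->]] := locP x; have [b [m ->]] := locP y.
by apply/lfracP; exists 1%N; rewrite expr1 f0 mul0r.
Qed.

Lemma meval_rat_poly_sum (K : fieldType) (A : comAlgType K) l (b : {poly rat}) c :
  (rat_poly_sum A l b).@[intpt A (intmnm c)] = ((map_poly ratr b).[(mdeg c)%:R] : K)%:A.
Proof.
have s : (\sum_i 'X_i : {mpoly A[l]}).@[intpt A (intmnm c)] = ((mdeg c)%:R : K)%:A.
  rewrite raddf_sum /= mdegE -in_algE rmorph_nat natr_sum; apply: eq_bigr => i _.
  by rewrite mevalXU /intpt /intmnm pmulrn.
rewrite /rat_poly_sum /map_poly !horner_poly raddf_sum -in_algE rmorph_sum /=.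
apply: eq_bigr => i _; rewrite mevalM mevalC rmorphXn /= s.
by rewrite -[RHS]in_algE [RHS]rmorphM rmorphXn.
Qed.

Lemma toloc_rat_poly_sum_nvar0 (K : fieldType) (A : comAlgType K) f (p : {mpoly A[0]}) :
  toloc f (rat_poly_sum A 0 'X * p) = 0.
Proof.
have F0 : ((ratr 0 : K)%:A)%:MP_[0] = 0 :> {mpoly A[0]}.
  by rewrite (ratr_nat K 0) scale0r mpolyC0.
by rewrite /rat_poly_sum big_ord0 horner_coef0 coef_map_id0 // coefX F0 mul0r rmorph0.
Qed.

Lemma toloc_mulC0 (A : comNzRingType) l f (p : {mpoly A[l]}) : toloc f (p * 0%:MP_[l]) = 0.
Proof. by rewrite mpolyC0 mulr0 rmorph0. Qed.

(** * Descent of the equation for the Mustata polynomial, with the degenerate cases *)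

Theorem theorem3p27 (K : fieldType) (charK : [pchar K] =i pred0) (n : nat)
    (A : subalgClosed {mpoly K[n]})
    (fgA : fin_gen_subalg A) (dsA : direct_summand A)
    (l : nat) (f : 'I_l -> subalg A) (g : subalg A) :
  exists2 b : {poly rat}, b != 0 &
    submod_gen (S := {mpoly (diffop (subalg A))[l]})
      (fun v : fsmod_of f charK =>
         exists2 c : 'I_l -> int, \sum_i c i = 1 & v = fs charK (fs_gen f g c))
      (fs charK (toloc _ (rat_poly_sum (subalg A) l b * g%:MP_[l]) : sloc f)).
Proof.
have in0 (N : {pred fsmod_of f charK}) v : GRing.submod_closed N -> v = 0 -> v \in N.
  by case=> N0 _ ->.
have [->|nzg] := eqVneq g 0.
  exists 1 => [|N subN _]; first exact: oner_neq0.
  by apply: in0 => //; apply: toloc_mulC0.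
have [l0|lgt0] := posnP l.
  (* Without variables no [c] has sum 1 and the submodule is zero; ['X] is chosen since it vanishes
     at the empty sum. *)
  subst l; exists 'X => [|N subN _]; first by rewrite polyX_eq0.
  by apply: in0 => //; apply: toloc_rat_poly_sum_nvar0.
(* If the product of the [f i] is zero, so is the localization. *)
have [F0|nzF] := eqVneq (\prod_i f i) 0.
  exists 1 => [|N subN _]; first exact: oner_neq0.
  apply: in0 => //; apply: loc0_all_eq.
  by rewrite -[RHS](mpolyC0 l) -F0 rmorph_prod.
have [rho rhoP] := direct_summand_retraction dsA.
pose fR i : {mpoly K[n]} := val (f i); pose gR : {mpoly K[n]} := val g.
have nzg' : of_x l gR != 0.
  apply: contraNneq nzg => e; apply/eqP/val_inj.
  by have := of_xK l gR; rewrite e at_y0_0 => /esym.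
have [b nzb gb] := rational_bernstein_polynomial charK (mustata_poly fR) nzg'.
exists b => // N subN genN.
have genN' (e : 'I_l -> int) : \sum_i e i = 1 -> fs charK (fs_gen f g e) \in N.
  by move=> se; apply: genN; exists e.
have cb := gen_coef_class_shift charK gb.
have [nu Nnu [N0 hnu]] := realize rhoP subN genN' cb (erefl (-1)) (is_diffop_id K n).
(* By the choice of [nu], both sides take the same values at all [c] of large degree. *)
suff <- : nu = fs charK (toloc _ (rat_poly_sum (subalg A) l b * g%:MP_[l]) : sloc f) by [].
pose iota : {rmorphism subalg A -> {mpoly K[n]}} := \val.
apply: (phi_inj_large charK (iota := iota) (@val_inj _ _ _) lgt0 nzF (N := N0)) => c lec.
rewrite hnu // /fs phi_toloc mevalM mevalC meval_rat_poly_sum; congr (toloc _ _).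
rewrite (retractionZ rhoP).
have -> : fexp fR c * gR = val ((\prod_i f i ^+ c i) * g).
  rewrite rmorphM; congr (_ * _); rewrite rmorph_prod; apply: eq_bigr => i _.
  by rewrite rmorphXn.
by rewrite (retractionK rhoP) -!scalerAl mul1r [_ * g]mulrC.
Qed.
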